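(* Let $E$ be an elliptic curve over a number field $K$ with $\#E(K)[2]=2$. Then there are infinitely many quadratic twists of $E$ over $K$ that have a non-trivial locally $2$-imprimitive point.
   Context: Let $F$ be an elliptic curve over a number field $K$. For a prime $\mathfrak p$ of $K$ of good reduction of $F$, $k_{\mathfrak p}$ is the residue class field and $\overline P\in F(k_{\mathfrak p})$ is the reduction of $P\in F(K)$. A point $P\in F(K)$ is locally $2$-imprimitive if $2$ divides the index $[F(k_{\mathfrak p}):\langle \overline P\rangle]$ for all but finitely many primes $\mathfrak p$ of $K$ (of good reduction). A locally $2$-imprimitive non-torsion point $P\in F(K)$ is called non-trivial if condition (C) below holds, but neither (A) nor (B) holds: (A) $F(K)$ contains a torsion point of order $2$ and $P\in 2\cdot F(K)$; (B) $F$ has complete rational $2$-torsion over $K$; (C) there exists an isogeny $\phi: F'\to F$ of elliptic curves defined over $K$ with kernel generated by a torsion point of $F'(K)$ of order $2$ and $P\in\phi[F'(K)]$. For $E$ given by $y^2=x(x^2+ax+b)$ over $K$, the quadratic twists of $E$ over $K$ are the curves $E_D: y^2=x(x^2+aDx+bD^2)$ with $D\in K^*$, where $D$ matters only modulo ${K^*}^2$. *)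

(* Defs.v *)
From HB Require Import structures.
From mathcomp Require Import all_boot all_order all_algebra all_field.
From mathcomp Require Import boolp classical_sets functions cardinality.
From mathcomp Require Import mpoly ring.
Set Implicit Arguments.
Unset Strict Implicit.
Unset Printing Implicit Defensive.
Import Order.TTheory GRing.Theory Num.Theory.
Local Open Scope ring_scope.
Local Open Scope classical_set_scope.
Local Open Scope quotient_scope.

(* Weierstrass equations y^2 + a1 xy + a3 y = x^3 + a2 x^2 + a4 x + a6. *)

Record weierstrass (R : Type) :=
  Weierstrass { wa1 : R; wa2 : R; wa3 : R; wa4 : R; wa6 : R }.

Definition wmap (R S : Type) (f : R -> S) (W : weierstrass R) : weierstrass S :=
  Weierstrass (f (wa1 W)) (f (wa2 W)) (f (wa3 W)) (f (wa4 W)) (f (wa6 W)).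

Section Weierstrass.
Variables (k : fieldType) (W : weierstrass k).
Local Notation a1 := (wa1 W).
Local Notation a2 := (wa2 W).
Local Notation a3 := (wa3 W).
Local Notation a4 := (wa4 W).
Local Notation a6 := (wa6 W).

Definition wb2 : k := a1 ^+ 2 + 4 * a2.
Definition wb4 : k := 2 * a4 + a1 * a3.
Definition wb6 : k := a3 ^+ 2 + 4 * a6.
Definition wb8 : k :=
  a1 ^+ 2 * a6 + 4 * a2 * a6 - a1 * a3 * a4 + a2 * a3 ^+ 2 - a4 ^+ 2.
Definition wdisc : k :=
  - wb2 ^+ 2 * wb8 - 8 * wb4 ^+ 3 - 27 * wb6 ^+ 2 + 9 * wb2 * wb4 * wb6.

Definition elliptic : Prop := wdisc != 0.
End Weierstrass.

(* [None] is the point at infinity (0 : 1 : 0). *)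
Definition curve_point (k : Type) : Type := option (k * k).

Definition pmap_point (k l : Type) (f : k -> l) :
    curve_point k -> curve_point l :=
  omap (fun xy => (f xy.1, f xy.2)).

Section GroupLaw.
Variables (k : fieldType) (W : weierstrass k).
Local Notation a1 := (wa1 W).
Local Notation a2 := (wa2 W).
Local Notation a3 := (wa3 W).
Local Notation a4 := (wa4 W).
Local Notation a6 := (wa6 W).

Definition rational_points : set (curve_point k) :=
  [set P | match P with
           | None => True
           | Some (x, y) =>
               y ^+ 2 + a1 * x * y + a3 * y = x ^+ 3 + a2 * x ^+ 2 + a4 * x + a6
           end].

Definition point_opp (P : curve_point k) : curve_point k :=
  if P is Some (x, y) then Some (x, - y - a1 * x - a3) else None.

Definition point_add (P Q : curve_point k) : curve_point k :=
  match P, Q with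
  | None, _ => Q
  | _, None => P
  | Some (x1, y1), Some (x2, y2) =>
      if (x1 == x2) && (y1 + y2 + a1 * x2 + a3 == 0) then None
      else
        let lam :=
          if x1 == x2
          then (3 * x1 ^+ 2 + 2 * a2 * x1 + a4 - a1 * y1)
                 / (2 * y1 + a1 * x1 + a3)
          else (y2 - y1) / (x2 - x1) in
        let x3 := lam ^+ 2 + a1 * lam - a2 - x1 - x2 in
        Some (x3, - (lam * (x3 - x1) + y1) - a1 * x3 - a3)
  end.

Definition point_muln (n : nat) (P : curve_point k) : curve_point k :=
  iter n (point_add P) None.

Definition point_mulz (z : int) (P : curve_point k) : curve_point k :=
  match z with
  | Posz n => point_muln n P
  | Negz n => point_opp (point_muln n.+1 P)
  end.

Definition cyclic_subgroup (P : curve_point k) : set (curve_point k) :=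
  range (fun z : int => point_mulz z P).

Definition two_torsion : set (curve_point k) :=
  rational_points `&` [set P | point_muln 2 P = None].

Definition torsion_point (P : curve_point k) : Prop :=
  exists n : nat, (0 < n)%N /\ point_muln n P = None.

Definition cosets (H : set (curve_point k)) : set (set (curve_point k)) :=
  [set point_add Q @` H | Q in rational_points].

Definition dvd_index (q : nat) (H : set (curve_point k)) : Prop :=
  exists m : nat, (cosets H #= `I_m)%card /\ (q %| m)%N.
End GroupLaw.

(* The substitution x = u^2 x' + r, y = u^3 y' + s u^2 x' + t. *)
Section ChangeOfVariables.
Variables (k : fieldType) (u r s t : k).

Definition change_curve (W : weierstrass k) : weierstrass k :=
  let: Weierstrass a1 a2 a3 a4 a6 := W in
  Weierstrass
    ((a1 + 2 * s) / u)
    ((a2 - s * a1 + 3 * r - s ^+ 2) / u ^+ 2)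
    ((a3 + r * a1 + 2 * t) / u ^+ 3)
    ((a4 - s * a3 + 2 * r * a2 - (t + r * s) * a1 + 3 * r ^+ 2 - 2 * s * t)
       / u ^+ 4)
    ((a6 + r * a4 + r ^+ 2 * a2 + r ^+ 3 - t * a3 - t ^+ 2 - r * t * a1)
       / u ^+ 6).

Definition change_point : curve_point k -> curve_point k :=
  omap (fun xy => ((xy.1 - r) / u ^+ 2, (xy.2 - s * (xy.1 - r) - t) / u ^+ 3)).
End ChangeOfVariables.

Section Primes.
Variable K : fieldExtType rat.

Definition integer (x : K) : Prop := integralOver (intr : int -> K) x.

(* Nonzero prime ideals of the ring of integers of K. *)
Record prime_of := PrimeOf {
  prime_set :> K -> Prop;
  prime_integer : forall x, prime_set x -> integer x;
  prime_0 : prime_set 0;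
  prime_add : forall x y, prime_set x -> prime_set y -> prime_set (x + y);
  prime_mul : forall x y, integer x -> prime_set y -> prime_set (x * y);
  prime_1 : ~ prime_set 1;
  prime_prime : forall x y, integer x -> integer y ->
    prime_set (x * y) -> prime_set x \/ prime_set y;
  prime_neq0 : exists2 x, prime_set x & x != 0 }.

Section Localization.
Variable p : prime_of.

Definition local_pred : {pred K} :=
  fun x => `[< exists a s, [/\ integer a, integer s, ~ p s & x = a / s] >].

Lemma local_predP x : reflect
  (exists a s, [/\ integer a, integer s, ~ p s & x = a / s]) (x \in local_pred).
Proof. exact: asboolP. Qed.

Lemma prime_nz s : ~ p s -> s != 0.
Proof. by move=> ps; apply/eqP => s0; apply: ps; rewrite s0; exact: prime_0. Qed.

Lemma prime_mulN s t : integer s -> integer t -> ~ p s -> ~ p t -> ~ p (s * t).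
Proof. by move=> si ti ps pt /(prime_prime si ti)[]. Qed.

Lemma local_subring : subring_closed local_pred.
Proof.
split.
- apply/local_predP; exists 1, 1; split; rewrite ?divr1 //;
    do ?[exact: (integral1 (intr : {rmorphism int -> K}))|exact: prime_1].
- move=> _ _ /local_predP[a [s [ai si ps ->]]] /local_predP[b [t [bi ti pt ->]]].
  apply/local_predP; exists (a * t - b * s), (s * t); split.
  + by apply: (@integral_sub int K intr); apply: (@integral_mul int K intr).
  + exact: (@integral_mul int K intr).
  + exact: prime_mulN.
  + by rewrite -mulNr addf_div ?prime_nz // mulNr.
- move=> _ _ /local_predP[a [s [ai si ps ->]]] /local_predP[b [t [bi ti pt ->]]].
  apply/local_predP; exists (a * b), (s * t); split.
  + exact: (@integral_mul int K intr).
  + exact: (@integral_mul int K intr).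
  + exact: prime_mulN.
  + by rewrite mulf_div.
Qed.

HB.instance Definition _ := GRing.isSubringClosed.Build K local_pred local_subring.

Record local_ring := LocalRing { local_val :> K; _ : local_val \in local_pred }.
HB.instance Definition _ := [isSub for local_val].
HB.instance Definition _ := [Choice of local_ring by <:].
HB.instance Definition _ := [SubChoice_isSubComNzRing of local_ring by <:].

Definition local_max : {pred local_ring} :=
  fun x => `[< exists a s, [/\ p a, integer s, ~ p s & val x = a / s] >].

Lemma local_maxP x : reflect
  (exists a s, [/\ p a, integer s, ~ p s & val x = a / s]) (x \in local_max).
Proof. exact: asboolP. Qed.

Lemma local_ideal : idealr_closed local_max.
Proof.
split.
- apply/local_maxP; exists 0, 1; split.
  + exact: prime_0.
  + exact: (integral1 (intr : {rmorphism int -> K})).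
  + exact: prime_1.
  + by rewrite rmorph0 mul0r.
- apply/local_maxP => -[a [s [pa si ps /eqP]]].
  rewrite rmorph1 eq_sym -(inj_eq (mulIf (prime_nz ps))) mul1r divfK ?prime_nz //.
  by move=> /eqP sa; apply: ps; rewrite -sa.
- move=> x y z /local_maxP[a [s [pa si ps ye]]] /local_maxP[b [t [pb ti pt ze]]].
  case/local_predP: (valP x) => c [r [ci ri pr xe]].
  have rsi : integer (r * s) by exact: (@integral_mul int K intr).
  have prs : ~ p (r * s) by exact: prime_mulN.
  apply/local_maxP; exists (c * a * t + b * (r * s)), (r * s * t); split.
  + apply: prime_add; last by rewrite mulrC; exact: prime_mul.
    by rewrite mulrC; apply: prime_mul => //; exact: prime_mul.
  + exact: (@integral_mul int K intr).
  + exact: prime_mulN.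
  + by rewrite rmorphD rmorphM /= xe ye ze mulf_div addf_div ?prime_nz.
Qed.

HB.instance Definition _ := isIdealr.Build local_ring local_max local_ideal.

(* The residue class field, as the quotient of the localization of the ring of
   integers at p by its maximal ideal. *)
Definition residue_field : Type := {ideal_quot local_max}.
HB.instance Definition _ : NzRingQuotient local_ring
    (Quotient.equiv local_max) 0 -%R +%R 1 *%R residue_field :=
  NzRingQuotient.on residue_field.
HB.instance Definition _ := GRing.ComNzRing.on residue_field.

Definition local_inv (x : local_ring) : local_ring := insubd 0 (val x)^-1.

Definition residue_inv (x : residue_field) : residue_field :=
  if x == 0 then 0 else \pi_residue_field (local_inv (repr x)).

Lemma residue_inv0 : residue_inv 0 = 0.
Proof. by rewrite /residue_inv eqxx. Qed.

Lemma residue_mulVf x : x != 0 -> residue_inv x * x = 1.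
Proof.
rewrite /residue_inv => x0; rewrite (negPf x0).
pose f : {rmorphism local_ring -> residue_field} := \pi_residue_field.
case/local_predP: (valP (repr x)) => a [s [ai si ps xe]].
have pa : ~ p a.
  move=> pa; move/eqP: x0; apply; rewrite -[x]reprK.
  rewrite -[RHS](rmorph0 f : f 0 = 0); apply/eqP; rewrite -Quotient.idealrBE subr0.
  by apply/local_maxP; exists a, s.
have xV : (val (repr x))^-1 \in local_pred.
  by apply/local_predP; exists s, a; split; rewrite // xe invf_div.
rewrite -{2}[x]reprK -[RHS](rmorph1 f : f 1 = 1) -[LHS](rmorphM f).
congr (f _); apply: val_inj; rewrite rmorphM rmorph1 /= insubdK //.
by rewrite mulVf // xe mulf_neq0 ?invr_eq0 ?prime_nz //; apply: contra_notN pa.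
Qed.

HB.instance Definition _ :=
  GRing.ComNzRing_isField.Build residue_field residue_mulVf residue_inv0.

(* Elements outside the local ring are sent to 0. *)
Definition residue (x : K) : residue_field :=
  \pi_residue_field (insubd (0 : local_ring) x).

Definition integral_model (W : weierstrass K) : Prop :=
  [/\ wa1 W \in local_pred, wa2 W \in local_pred, wa3 W \in local_pred,
      wa4 W \in local_pred & wa6 W \in local_pred].

Definition reduce_curve (W : weierstrass K) : weierstrass residue_field :=
  wmap residue W.

(* For a point of an integral model, a non-integral coordinate forces
   v(y) < v(x) < 0, so (x : y : 1) = (x/y : 1 : 1/y) reduces to (0 : 1 : 0). *)
Definition reduce_point (P : curve_point K) : curve_point residue_field :=
  match P with
  | Some (x, y) => if (x \in local_pred) && (y \in local_pred)
                   then Some (residue x, residue y) else None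
  | None => None
  end.

Definition good_model (W : weierstrass K) : Prop :=
  integral_model W /\ elliptic (reduce_curve W).

Definition good_reduction (W : weierstrass K) : Prop :=
  exists u r s t, u != 0 /\ good_model (change_curve u r s t W).

(* The reduction at p, taken with respect to every model of W with good
   reduction at p (these reductions are all isomorphic). *)
Definition reduction_index_dvd (q : nat) (W : weierstrass K)
    (P : curve_point K) : Prop :=
  forall u r s t, u != 0 -> good_model (change_curve u r s t W) ->
    dvd_index (reduce_curve (change_curve u r s t W)) q
      (cyclic_subgroup (reduce_curve (change_curve u r s t W))
         (reduce_point (change_point u r s t P))).
End Localization.

Definition locally_imprimitive (q : nat) (W : weierstrass K)
    (P : curve_point K) : Prop :=
  finite_set [set p : prime_of |
    good_reduction p W /\ ~ reduction_index_dvd p q W P].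
End Primes.

Section AlgebraicClosure.
Variable K : fieldExtType rat.

Definition countable_mixin : isCountable K :=
  CanIsCountable (@VectorInternalTheory.v2rK _ K).

Definition countable_copy : countFieldType :=
  HB.pack (K : Type) (GRing.Field.class K) countable_mixin.

Definition alg_closure : closedFieldType :=
  projT1 (countable_algebraic_closure countable_copy).

Definition to_closure : {rmorphism K -> alg_closure} :=
  sval (projT2 (countable_algebraic_closure countable_copy)).

Lemma to_closure_integral : integralRange to_closure.
Proof. exact: (svalP (projT2 (countable_algebraic_closure countable_copy))). Qed.
End AlgebraicClosure.

Section Isogenies.
Variable K : fieldExtType rat.
Local Notation Kbar := (alg_closure K).
Local Notation iota := (to_closure K).

Definition geom_curve (W : weierstrass K) : weierstrass Kbar := wmap iota W.

Definition geom_point (P : curve_point K) : curve_point Kbar :=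
  pmap_point iota P.

Definition hcoord (P : curve_point Kbar) : 'I_3 -> Kbar :=
  if P is Some (x, y) then tnth [tuple x; y; 1] else tnth [tuple 0; 1; 0].

Definition form_eval (f : {mpoly K[3]}) (P : curve_point Kbar) : Kbar :=
  (map_mpoly iota f).@[hcoord P].

(* phi is regular at Q over K: near Q it is (f_0 : f_1 : f_2) for forms f_i of
   the same degree with coefficients in K. *)
Definition regular_at (W' : weierstrass K)
    (phi : curve_point Kbar -> curve_point Kbar)
    (Q : curve_point Kbar) : Prop :=
  exists (d : nat) (f : 'I_3 -> {mpoly K[3]}),
    [/\ forall i, f i \is d.-homog,
        exists i, form_eval (f i) Q != 0
      & forall R, rational_points (geom_curve W') R ->
          (exists i, form_eval (f i) R != 0) ->
          exists c : Kbar,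
            c != 0 /\ forall i, form_eval (f i) R = c * hcoord (phi R) i].

(* Nonconstant morphisms over K preserving the point at infinity, given by
   their action on points over an algebraic closure. *)
Record isogeny (W' W : weierstrass K)
    (phi : curve_point Kbar -> curve_point Kbar) : Prop := Isogeny {
    isogeny_maps : forall Q, rational_points (geom_curve W') Q ->
      rational_points (geom_curve W) (phi Q);
    isogeny_regular : forall Q, rational_points (geom_curve W') Q ->
      regular_at W' phi Q;
    isogeny_infty : phi None = None;
    isogeny_nonconst : exists2 Q,
      rational_points (geom_curve W') Q & phi Q <> None }.

Definition isogeny_kernel (W' : weierstrass K)
    (phi : curve_point Kbar -> curve_point Kbar) : set (curve_point Kbar) :=
  rational_points (geom_curve W') `&` [set Q | phi Q = None].

Definition point_of_order2 (W : weierstrass K) (T : curve_point K) : Prop :=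
  [/\ rational_points W T, T <> None & point_muln W 2 T = None].

Definition condA (W : weierstrass K) (P : curve_point K) : Prop :=
  (exists T, point_of_order2 W T) /\
  (exists2 Q, rational_points W Q & P = point_muln W 2 Q).

Definition condB (W : weierstrass K) : Prop :=
  two_torsion (geom_curve W) `<=` geom_point @` rational_points W.

Definition condC (W : weierstrass K) (P : curve_point K) : Prop :=
  exists (W' : weierstrass K) (phi : curve_point Kbar -> curve_point Kbar),
    [/\ elliptic W',
        isogeny W' W phi,
        exists2 T, point_of_order2 W' T &
          isogeny_kernel W' phi =
            cyclic_subgroup (geom_curve W') (geom_point T)
      & exists2 Q, rational_points W' Q & phi (geom_point Q) = geom_point P].

Definition nontrivial_point (W : weierstrass K) (P : curve_point K) : Prop :=
  [/\ rational_points W P,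
      locally_imprimitive 2 W P,
      ~ torsion_point W P
    & [/\ condC W P, ~ condA W P & ~ condB W]].
End Isogenies.

Section Twists.
Variable k : fieldType.

(* Completing the square turns W into y^2 = x^3 + (b2/4)x^2 + (b4/2)x + b6/4,
   whose twist by D has the coefficients scaled by D, D^2, D^3. *)
Definition quadratic_twist (D : k) (W : weierstrass k) : weierstrass k :=
  Weierstrass
    0 (D * (wb2 W / 4)) 0 (D ^+ 2 * (wb4 W / 2)) (D ^+ 3 * (wb6 W / 4)).

(* The class of D modulo nonzero squares. *)
Definition square_class (D : k) : set k :=
  [set D * c ^+ 2 | c in [set c : k | c != 0]].

Hypothesis two_neq0 : (2 : k) != 0.

Let four_neq0 : (4 : k) != 0.
Proof. by rewrite (natrM _ 2 2) mulf_neq0. Qed.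

Lemma quadratic_twistE (a b D : k) :
  quadratic_twist D (Weierstrass 0 a 0 b 0) =
  Weierstrass 0 (a * D) 0 (b * D ^+ 2) 0.
Proof.
rewrite /quadratic_twist /wb2 /wb4 /wb6 /=; congr Weierstrass; field.
- exact: four_neq0.
- exact: two_neq0.
- exact: four_neq0.
Qed.

Lemma elliptic_quadratic_twist (D : k) (W : weierstrass k) :
  D != 0 -> elliptic W -> elliptic (quadratic_twist D W).
Proof.
rewrite /elliptic => D0 dW.
suff -> : wdisc (quadratic_twist D W) = D ^+ 6 * wdisc W.
  by rewrite mulf_neq0 ?expf_neq0.
case: W {dW} => a1 a2 a3 a4 a6.
rewrite /wdisc /wb8 /wb2 /wb4 /wb6 /= /wb2 /wb4 /wb6 /=; field.
by rewrite two_neq0 four_neq0.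
Qed.
End Twists.

(* Main.v *)
Require Import Defs.
From HB Require Import structures.
From mathcomp Require Import all_boot all_order all_algebra all_field.
From mathcomp Require Import finmap.
From mathcomp Require fingroup cyclic.
From mathcomp Require Import boolp classical_sets functions cardinality.
From mathcomp Require Import mpoly ring zify.
Set Implicit Arguments.
Unset Strict Implicit.
Unset Printing Implicit Defensive.
Import GRing.Theory.
Local Open Scope ring_scope.
Local Open Scope classical_set_scope.
Local Open Scope quotient_scope.

(** The rational point of order 2 brings E to the form y^2 = x (x^2 + a x + b) with
    d = a^2 - 4 b not a square, and the twist by D to
    E_D : y^2 = x (x^2 + a D x + b D^2). A point of E_D whose x-coordinate is a nonzero
    square is the image, under the 2-isogeny with kernel generated by (0, 0), of a
    rational point of the isogenous curve y^2 = x (x^2 - 2 a D x + d D^2). Such a point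
    is locally 2-imprimitive: over a finite field of odd characteristic the class of x
    modulo squares is a homomorphism onto a group of order 2, so the points of trivial
    class form a subgroup of index 2, which contains all multiples of the reduction
    (even_index_square_class). Surjectivity comes from counting points on a conic. For
    almost all primes this applies to every model with good reduction, because two such
    models differ by a change of variables over the local ring
    (locally_imprimitive_square).

    Points with square x-coordinate are found by parametrizing a conic: for s in K^*,
    put q = s^2 + 2 a s + d and D = - q / (4 s). Then D^2 + a D + b is the square of
    w = D + (a + s) / 2, and E_D has the point (D^2, D^2 w). If this point were a
    double, q or d q would be a square. It has infinite order if 1 / D is 2-adically
    small enough: doubling then multiplies D / x by 4 and a 2-adic unit, so the points
    2^k P are distinct (not_torsion_2adic). Condition (B) fails because d is not a
    square. All this is twist_nontrivial_point.

    Given finitely many classes D', the parameter s = N / c^2 is chosen by congruences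
    (exists_twist_param). A high power of 2 in c and an odd N make 1 / D small. Modulo
    one prime for each of q and d q, a suitable N makes it a nonsquare. Finally c is
    divisible by one prime for each D', modulo which the class of D D' is that of - N D'
    and can be prescribed; so D avoids all the classes D', and the classes that occur
    are infinite in number.

    Two pieces of theory support this. Associativity of the addition of points is
    obtained by embedding the points into the ideal class group of the coordinate ring
    k[x] + k[x] y, through the ideal of a point (line_ideal, point_ideal_inj): this
    treats chords, tangents and coincidences uniformly. Finiteness of residue fields and
    of the set of primes over a rational prime, and the existence of such primes, follow
    from finite_quotient: every subgroup S of K has finite index over l S. *)

(** * The coordinate ring of a cubic y^2 = f(x) and its ideal classes *)

Definition coord_ring (k : fieldType) (f : {poly k}) : Type :=
  ({poly k} * {poly k})%type.

Section CoordinateRing.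
Variables (k : fieldType) (f : {poly k}).
Local Notation R := (coord_ring f).

HB.instance Definition _ :=
  GRing.Zmodule.copy R ({poly k} * {poly k})%type.

Definition coord_one : R := (1, 0).
Definition coord_mul (g h : R) : R :=
  (g.1 * h.1 + f * (g.2 * h.2), g.1 * h.2 + g.2 * h.1).

Lemma coord_eq (g h : R) : g.1 = h.1 -> g.2 = h.2 -> g = h.
Proof. by case: g => p q; case: h => p' q' /= -> ->. Qed.

Lemma coord_mulA : associative coord_mul.
Proof. by move=> g h l; apply: coord_eq => /=; ring. Qed.
Lemma coord_mulC : commutative coord_mul.
Proof. by move=> g h; apply: coord_eq => /=; ring. Qed.
Lemma coord_mul1 : left_id coord_one coord_mul.
Proof. by move=> g; apply: coord_eq => /=; ring. Qed.
Lemma coord_mulDl : left_distributive coord_mul +%R.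
Proof. by move=> g h l; apply: coord_eq => /=; ring. Qed.
Lemma coord_one_neq0 : coord_one != 0.
Proof. by apply/eqP => -[/eqP]; rewrite oner_eq0. Qed.

HB.instance Definition _ := GRing.Zmodule_isComNzRing.Build R
  coord_mulA coord_mulC coord_mul1 coord_mulDl coord_one_neq0.

Lemma coordD (g h : R) : g + h = (g.1 + h.1, g.2 + h.2).
Proof. by []. Qed.
Lemma coordM (g h : R) :
  g * h = (g.1 * h.1 + f * (g.2 * h.2), g.1 * h.2 + g.2 * h.1).
Proof. by []. Qed.

Definition coord_norm (g : R) : {poly k} := g.1 ^+ 2 - f * g.2 ^+ 2.

Lemma coord_normM g h : coord_norm (g * h) = coord_norm g * coord_norm h.
Proof. by rewrite /coord_norm coordM /=; ring. Qed.

Hypothesis size_f : size f = 4%N.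

Let f_neq0 : f != 0.
Proof. by rewrite -size_poly_gt0 size_f. Qed.

(** The terms p^2 and f q^2 of the norm have degrees of opposite parity, so their
    leading terms never cancel. *)
Lemma size_coord_norm (g : R) : size (coord_norm g) =
  maxn (size g.1).*2.-1 (if g.2 == 0 then 0%N else (size g.2).*2.+2).
Proof.
have sz2 (p : {poly k}) : size (p ^+ 2) = (size p).*2.-1.
  have [->|p0] := eqVneq p 0; first by rewrite expr0n size_poly0.
  by rewrite expr2 size_mul // addnn.
rewrite /coord_norm; have [->|q0] := eqVneq g.2 0.
  by rewrite expr0n mulr0 subr0 maxn0 sz2.
have szq : size (- (f * g.2 ^+ 2)) = (size g.2).*2.+2.
  rewrite size_polyN size_mul ?expf_neq0 // size_f sz2.
  by move: q0; rewrite -size_poly_gt0; lia.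
rewrite /maxn; case: ltnP => cmp.
  by rewrite addrC size_polyDl szq // sz2.
rewrite size_polyDl ?sz2 // szq; lia.
Qed.

(** In particular no norm has degree 1: this gap in the pole orders at infinity is
    where the genus enters. *)
Lemma coord_norm_cases (g : R) :
  (g.2 = 0 /\ size (coord_norm g) = (size g.1).*2.-1) \/
  (exists m n : nat, [/\ size g.2 = n.+1, size g.1 = m &
     size (coord_norm g) = maxn m.*2.-1 n.*2.+4]).
Proof.
rewrite size_coord_norm; case: (eqVneq g.2 0) => [e|]; first by rewrite maxn0; left.
rewrite -size_poly_gt0 => g2; right; exists (size g.1), (size g.2).-1.
by split=> //; [rewrite prednK|rewrite -{1}(prednK g2) doubleS].
Qed.

Lemma coord_norm_eq0 (g : R) : (coord_norm g == 0) = (g == 0).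
Proof.
rewrite -size_poly_eq0 size_coord_norm; case: g => p q /=.
have -> : (((p, q) : R) == 0) = (p == 0) && (q == 0) by [].
rewrite -(size_poly_eq0 p) -(size_poly_eq0 q).
by case: (size p) => [|n]; case: (size q) => [|m] //=; rewrite /maxn; case: ifP.
Qed.

Lemma coord_mulI (a g h : R) : a != 0 -> a * g = a * h -> g = h.
Proof.
move=> a0 /eqP; rewrite -subr_eq0 -mulrBr -coord_norm_eq0 coord_normM mulf_eq0.
by rewrite !coord_norm_eq0 (negPf a0) subr_eq0 => /eqP.
Qed.

Lemma coord_mul_neq0 (g h : R) : g != 0 -> h != 0 -> g * h != 0.
Proof.
by rewrite -!coord_norm_eq0 coord_normM => g0 h0; rewrite mulf_neq0.
Qed.

Definition coord_poly (p : {poly k}) : R := (p, 0).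
Definition coord_y : R := (0, 1).
Lemma coord_y_subE (L : {poly k}) : coord_y - coord_poly L = (- L, 1).
Proof. by apply: coord_eq; rewrite coordD /=; ring. Qed.

Definition coord_eval (x y : k) (g : R) : k := g.1.[x] + g.2.[x] * y.

Lemma coord_evalM x y g h : y ^+ 2 = f.[x] ->
  coord_eval x y (g * h) = coord_eval x y g * coord_eval x y h.
Proof. by move=> xy; rewrite /coord_eval coordM /= !(hornerD, hornerM) -xy; ring. Qed.

Lemma coord_evalD x y g h :
  coord_eval x y (g + h) = coord_eval x y g + coord_eval x y h.
Proof. by rewrite /coord_eval coordD /= !hornerD; ring. Qed.

Inductive ideal_mul (I J : R -> Prop) : R -> Prop :=
| IdealMul i j of I i & J j : ideal_mul I J (i * j)
| IdealAdd g h of ideal_mul I J g & ideal_mul I J h : ideal_mul I J (g + h).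

Lemma ideal_mulC I J g : ideal_mul I J g -> ideal_mul J I g.
Proof.
by elim=> [i j Ii Jj|? ? _ ? _ ?]; [rewrite mulrC; left|right].
Qed.

Lemma ideal_mulA I J L g :
  ideal_mul (ideal_mul I J) L g -> ideal_mul I (ideal_mul J L) g.
Proof.
elim=> [m l Mm Ll|? ? _ ? _ ?]; last by right.
elim: Mm => [i j Ii Jj|m1 m2 _ IH1 _ IH2]; last by rewrite mulrDl; right.
by rewrite -mulrA; left => //; left.
Qed.

(** Equality of classes in the ideal class group. *)
Definition ideal_equiv (I J : R -> Prop) : Prop := exists a b : R,
  [/\ a != 0, b != 0,
      forall i, I i -> exists2 j, J j & a * i = b * j
    & forall j, J j -> exists2 i, I i & a * i = b * j].

Lemma ideal_equiv_eq (I J : R -> Prop) : (forall g, I g <-> J g) -> ideal_equiv I J.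
Proof.
move=> IJ; exists 1, 1; split; rewrite ?oner_neq0 //.
- by move=> i /IJ; exists i.
- by move=> i /IJ; exists i.
Qed.

Lemma ideal_equiv_sym I J : ideal_equiv I J -> ideal_equiv J I.
Proof.
case=> a [b [a0 b0 IJ JI]]; exists b, a; split=> //.
- by move=> j /JI[i Ii e]; exists i.
- by move=> i /IJ[j Jj e]; exists j.
Qed.

Lemma ideal_equiv_trans I J L :
  ideal_equiv I J -> ideal_equiv J L -> ideal_equiv I L.
Proof.
case=> a [b [a0 b0 IJ JI]] [c [d [c0 d0 JL LJ]]].
exists (a * c), (b * d); split; rewrite ?coord_mul_neq0 //.
- move=> i /IJ[j /JL[l Ll e2] e1]; exists l => //.
  by rewrite mulrAC e1 mulrAC -mulrA e2 mulrA.
- move=> l /LJ[j /JI[i Ii e2] e1]; exists i => //.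
  by rewrite mulrAC e2 mulrAC -mulrA e1 mulrA.
Qed.

Lemma ideal_equiv_mull I J L :
  ideal_equiv I J -> ideal_equiv (ideal_mul I L) (ideal_mul J L).
Proof.
case=> a [b [a0 b0 IJ JI]]; exists a, b; split=> //.
- move=> g; elim=> [i l /IJ[j Jj e] Ll|g1 g2 _ [j1 J1 e1] _ [j2 J2 e2]].
    by exists (j * l); [left|rewrite !mulrA e].
  by exists (j1 + j2); [right|rewrite !mulrDr e1 e2].
- move=> g; elim=> [i l /JI[j Jj e] Ll|g1 g2 _ [j1 J1 e1] _ [j2 J2 e2]].
    by exists (j * l); [left|rewrite !mulrA e].
  by exists (j1 + j2); [right|rewrite !mulrDr e1 e2].
Qed.

Lemma ideal_equiv_mulC I J : ideal_equiv (ideal_mul I J) (ideal_mul J I).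
Proof. by apply: ideal_equiv_eq => g; split; apply: ideal_mulC. Qed.

Lemma ideal_equiv_mulA I J L :
  ideal_equiv (ideal_mul (ideal_mul I J) L) (ideal_mul I (ideal_mul J L)).
Proof.
apply: ideal_equiv_eq => g; split; first exact: ideal_mulA.
by move=> /ideal_mulC/ideal_mulA/ideal_mulC/ideal_mulA/ideal_mulC.
Qed.

Definition unit_ideal : R -> Prop := fun=> True.

Lemma ideal_equiv_mul1 (I : R -> Prop) :
  (forall g h, I g -> I h -> I (g + h)) -> (forall g h, I g -> I (g * h)) ->
  ideal_equiv (ideal_mul I unit_ideal) I.
Proof.
move=> ID IM; apply: ideal_equiv_eq => g; split.
  by elim=> [i j Ii _|? ? _ ? _ ?]; [apply: IM|apply: ID].
by move=> Ig; rewrite -[g]mulr1; left.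
Qed.

Definition point_ideal (P : curve_point k) : R -> Prop :=
  if P is Some (x, y) then fun g => coord_eval x y g = 0 else unit_ideal.

(** The second generator may be any y - L(x) with L through the point, so that the
    ideals of collinear points share a generator. *)
Lemma point_ideal_gen x y (L : {poly k}) g : L.[x] = y -> coord_eval x y g = 0 ->
  exists s t : {poly k},
    g = coord_poly ('X - x%:P) * coord_poly s + (coord_y - coord_poly L) * coord_poly t.
Proof.
move=> Lx; case: g => p q; rewrite /coord_eval /= => g0.
have : root (p + q * L) x by rewrite /root !hornerE Lx g0.
move=> /factor_theorem[s es]; exists s, q.
apply: coord_eq; rewrite !coordD !coordM /=; last by ring.
by rewrite [X in X + _]addrC mulr0 mulr0 add0r mulrC -es; ring.
Qed.

Lemma ideal_mul_absorb (I J : R -> Prop) r g :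
  (forall i, I i -> I (r * i)) -> ideal_mul I J g -> ideal_mul I J (r * g).
Proof.
move=> Ir; elim=> [i j Ii Jj|? ? _ ? _ ?]; last by rewrite mulrDr; right.
by rewrite mulrA; left; first exact: Ir.
Qed.

Definition coord_const (c : k) : R := coord_poly c%:P.

Lemma coord_constM c d : coord_const (c * d) = coord_const c * coord_const d.
Proof. by apply: coord_eq; rewrite coordM /= ?polyCM; ring. Qed.

Lemma ideal_const (J : R -> Prop) c : (forall r g, J g -> J (r * g)) ->
  c != 0 -> J (coord_const c) -> J 1.
Proof.
move=> JM c0 Jc.
suff -> : (1 : R) = coord_const c^-1 * coord_const c by apply: JM.
by rewrite -coord_constM mulVf.
Qed.

Lemma point_ideal_size x y (g : R) :
  g != 0 -> coord_eval x y g = 0 -> (2 < size (coord_norm g))%N.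
Proof.
rewrite -coord_norm_eq0 -size_poly_eq0 => g0 gxy.
case: (coord_norm_cases g) g0 => [[g2 ->]|[m [n [_ _ ->]]]] g0; last first.
  by rewrite leq_max orbC !ltnS.
suff : size g.1 <> 1%N by move: g0; case: (size g.1) => [|[|u]].
move=> /eqP/size_poly1P[c c0 g1].
by move: gxy c0; rewrite /coord_eval g1 g2 hornerC horner0 mul0r addr0 => ->; rewrite eqxx.
Qed.

Lemma coord_size_mul (a b g h : R) : a != 0 -> b != 0 -> g != 0 -> h != 0 ->
  a * g = b * h -> (size (coord_norm a) + size (coord_norm g))%N =
                   (size (coord_norm b) + size (coord_norm h))%N.
Proof.
rewrite -!coord_norm_eq0 => a0 b0 g0 h0 /(congr1 coord_norm).
rewrite !coord_normM => /(congr1 (fun p : {poly k} => size p)).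
rewrite !size_mul //; move: a0 b0 g0 h0; rewrite -!size_poly_gt0.
by move: (size _) (size _) (size _) (size _) => *; lia.
Qed.

(** Nonzero elements of a point ideal have norms of degree at least 2, those of
    degree 2 and 3 being x - x0 and y - y0 up to scalars and multiples of x - x0.
    Scalings that carry one point ideal to another must match them, which identifies
    the two points. *)
Lemma point_ideal_inj P Q :
  ideal_equiv (point_ideal P) (point_ideal Q) -> P = Q.
Proof.
have szx x : size (coord_norm (coord_poly ('X - x%:P))) = 3%N.
  by rewrite size_coord_norm eqxx maxn0 size_XsubC.
have szy y : size (coord_norm (coord_y - coord_poly y%:P)) = 4%N.
  rewrite coord_y_subE -polyCN size_coord_norm /= oner_eq0 size_polyC size_poly1 /=.
  by case: (_ != 0).
have nz (g : R) n : size (coord_norm g) = n.+1 -> g != 0.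
  by move=> e; rewrite -coord_norm_eq0 -size_poly_eq0 e.
have Ix x y : coord_eval x y (coord_poly ('X - x%:P)) = 0.
  by rewrite /coord_eval /= hornerXsubC horner0; ring.
have Iy x y : coord_eval x y (coord_y - coord_poly y%:P) = 0.
  by rewrite coord_y_subE /coord_eval /= hornerN !hornerC; ring.
have nz2 (a b g h : R) n : a != 0 -> b != 0 -> size (coord_norm g) = n.+1 ->
    a * g = b * h -> h != 0.
  move=> a0 b0 sg e; apply/eqP => h0; move: (coord_mul_neq0 a0 (nz _ _ sg)).
  by rewrite e h0 mulr0 eqxx.
have some_none x y (I : R -> Prop) : (forall g, I g <-> coord_eval x y g = 0) ->
    ~ ideal_equiv I unit_ideal.
  move=> II [a [b [a0 b0 IJ JI]]].
  have [i /II Ii e1] := JI 1 Logic.I.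
  have i0 : i != 0.
    apply/eqP => i0; move: e1 b0; rewrite i0 mulr0 mulr1 => <-.
    by rewrite eqxx.
  have s1 := coord_size_mul a0 b0 i0 (oner_neq0 _) e1.
  have [h _ e2] := IJ _ ((II _).2 (Ix x y)).
  have s2 := coord_size_mul a0 b0 (nz _ _ (szx x)) (nz2 _ _ _ _ _ a0 b0 (szx x) e2) e2.
  have [g _ e3] := IJ _ ((II _).2 (Iy x y)).
  have g0 := nz2 _ _ _ _ _ a0 b0 (szy y) e3.
  have s3 := coord_size_mul a0 b0 (nz _ _ (szy y)) g0 e3.
  have := point_ideal_size i0 Ii.
  have h0 := nz2 _ _ _ _ _ a0 b0 (szx x) e2.
  move: h0; rewrite -coord_norm_eq0 -size_poly_gt0 => h0.
  have : size (coord_norm g) <> 2%N.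
    case: (coord_norm_cases g) => [[_ ->]|[m [n [_ _ ->]]]]; first by case: (size g.1) => [|u] //=; lia.
    by rewrite /maxn; case: ifP; case: m => [|m] //=; lia.
  have n1 : size (coord_norm (1 : R)) = 1%N.
    by rewrite size_coord_norm eqxx maxn0 size_poly1.
  by move: s1 s2 s3 h0; rewrite szx szy n1; lia.
case: P Q => [[x y]|] [[x' y']|] //; first last.
- by move=> /ideal_equiv_sym/some_none H; case: (H x' y').
- by move=> /some_none H; case: (H x y).
move=> [a [b [a0 b0 IJ JI]]] /=.
have [h Jh e1] := IJ _ (Ix x y).
have h0 := nz2 _ _ _ _ _ a0 b0 (szx x) e1.
have s1 := coord_size_mul a0 b0 (nz _ _ (szx x)) h0 e1.
have [i Ii e2] := JI _ (Ix x' y').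
have i0 := nz2 _ _ _ _ _ b0 a0 (szx x') (esym e2).
have s2 := coord_size_mul a0 b0 i0 (nz _ _ (szx x')) e2.
have [g Jg e3] := IJ _ (Iy x y).
have g0 := nz2 _ _ _ _ _ a0 b0 (szy y) e3.
have s3 := coord_size_mul a0 b0 (nz _ _ (szy y)) g0 e3.
have hs := point_ideal_size h0 Jh; have i_s := point_ideal_size i0 Ii.
have sh : size (coord_norm h) = 3%N by move: s1 s2; rewrite !szx; lia.
have sg : size (coord_norm g) = 4%N by move: s1 s3; rewrite szx szy; lia.
have h2 : h.2 = 0.
  case: (coord_norm_cases h) sh => [[//]|[m [n [_ _ ->]]]].
  by rewrite /maxn; case: ifP; case: m => [|m] //=; lia.
have /size_poly1P[d d0 g2] : size g.2 == 1%N.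
  case: (coord_norm_cases g) sg => [[_ ->]|[m [n [-> _ ->]]]].
    by case: (size g.1) => [|u] //=; lia.
  by rewrite /maxn; case: ifP; case: m => [|m] //=; lia.
have e4 : coord_poly ('X - x%:P) * g = h * (coord_y - coord_poly y%:P).
  apply: (coord_mulI (coord_mul_neq0 a0 b0)); 
  have -> u v : a * b * (u * v) = (a * u) * (b * v) by move=> *; ring.
  by rewrite e1 -e3; ring.
have := congr1 snd e4; rewrite !coordM /= h2 g2 => e5.
have := congr1 fst e4; rewrite !coordM /= h2 g2 => e6.
have h1 : h.1 = d *: ('X - x%:P).
  by rewrite -mul_polyC; transitivity (h.1 * (1 - 0) + 0 * (0 - y%:P)); [ring|rewrite -e5; ring].
have xx : x' = x.
  move: Jh; rewrite /point_ideal /coord_eval h2 h1 horner0 hornerZ hornerXsubC mul0r addr0.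
  by move=> /eqP; rewrite mulf_eq0 (negPf d0) subr_eq0 => /eqP.
have g1 : g.1 = (- (y * d))%:P.
  have X0 : 'X - x%:P != 0 by rewrite polyXsubC_eq0.
  apply: (mulfI X0); transitivity (('X - x%:P) * g.1 + f * (0 * d%:P)); first by ring.
  by rewrite e6 h1 -mul_polyC polyCN polyCM; ring.
move: Jg; rewrite /point_ideal /coord_eval g2 g1 !hornerC xx => /eqP.
have -> : - (y * d) + d * y' = d * (y' - y) by ring.
by rewrite mulf_eq0 (negPf d0) subr_eq0 => /eqP ->.
Qed.

End CoordinateRing.

(** * The group law on y^2 = x^3 + a2 x^2 + a4 x + a6 *)

Section GroupLaw.
Variables (k : fieldType) (a2 a4 a6 : k).
Hypothesis two_neq0 : (2 : k) != 0.
Hypothesis separable_cubic : forall x : k,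
  x ^+ 3 + a2 * x ^+ 2 + a4 * x + a6 = 0 -> 3 * x ^+ 2 + 2 * a2 * x + a4 != 0.

Local Notation W := (Weierstrass 0 a2 0 a4 a6).

Definition cubic : {poly k} :=
  'X ^+ 3 + a2%:P * 'X ^+ 2 + a4%:P * 'X + a6%:P.
Local Notation R := (coord_ring cubic).
Local Notation cst := (@coord_const k cubic).

Lemma cubicE x : cubic.[x] = x ^+ 3 + a2 * x ^+ 2 + a4 * x + a6.
Proof. by rewrite /cubic !(hornerD, hornerM, hornerC, hornerXn, hornerX). Qed.

Lemma size_cubic : size cubic = 4%N.
Proof.
rewrite /cubic -!addrA size_polyDl ?size_polyXn //.
apply: leq_ltn_trans (_ : 3 < 4)%N => //.
apply: leq_trans (size_polyD _ _) _; rewrite geq_max mul_polyC.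
rewrite (leq_trans (size_scale_leq _ _)) ?size_polyXn //=.
apply: leq_trans (size_polyD _ _) _; rewrite geq_max mul_polyC.
rewrite (leq_trans (size_scale_leq _ _)) ?size_polyX //=.
by rewrite (leq_trans (size_polyC_leq1 _)).
Qed.

Lemma rational_pointsE x y :
  rational_points W (Some (x, y)) = (y ^+ 2 = cubic.[x]).
Proof.
rewrite /rational_points /= cubicE; apply: propext.
have -> : y ^+ 2 + 0 * x * y + 0 * y = y ^+ 2 by ring.
by [].
Qed.

Lemma point_ideal_mulr P (g h : R) :
  rational_points W P -> point_ideal P h -> point_ideal P (g * h).
Proof.
case: P => [[x y]|//]; rewrite rational_pointsE /= => xy h0.
by rewrite coord_evalM // h0 mulr0.
Qed.

Lemma point_ideal_add P (g h : R) :
  point_ideal P g -> point_ideal P h -> point_ideal P (g + h).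
Proof.
by case: P => [[x y]|//] /=; rewrite coord_evalD => -> ->; rewrite addr0.
Qed.

Lemma point_ideal_equiv1 (I J : R -> Prop) (l : R) : l != 0 ->
  (forall r g, ideal_mul I J g -> ideal_mul I J (r * g)) ->
  (forall g, ideal_mul I J g -> exists h, g = l * h) ->
  ideal_mul I J l ->
  ideal_equiv (ideal_mul I J) (@unit_ideal k cubic).
Proof.
move=> l0 absorb dvd Jl; exists 1, l; split; rewrite ?oner_neq0 //.
- by move=> g /dvd[h ->]; exists h => //; rewrite mul1r.
- by move=> h _; exists (l * h); rewrite ?mul1r // mulrC; apply: absorb.
Qed.

Section Line.
Variables (lam nu x1 x2 x3 : k).
Let y x := lam * x + nu.
Hypothesis line2 : a2 = lam ^+ 2 - (x1 + x2 + x3).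
Hypothesis line4 : a4 = 2 * lam * nu + (x1 * x2 + x1 * x3 + x2 * x3).
Hypothesis line6 : a6 = nu ^+ 2 - x1 * x2 * x3.

Let L : {poly k} := lam%:P * 'X + nu%:P.
Let l : R := coord_y cubic - coord_poly _ L.
Let lb : R := coord_y cubic + coord_poly _ L.
Let e x : R := coord_poly _ ('X - x%:P).

Let yL x : L.[x] = y x.
Proof. by rewrite /L !(hornerD, hornerM, hornerC, hornerX). Qed.

Let cubic_line x : x \in [:: x1; x2; x3] -> (y x) ^+ 2 = cubic.[x].
Proof.
rewrite cubicE line2 line4 line6 /y !inE.
by case/or3P => /eqP ->; ring.
Qed.

Let e_prod : e x1 * e x2 * e x3 = l * lb.
Proof.
rewrite /l /lb /e coord_y_subE coordD.
apply: coord_eq; rewrite !coordM /=; last by ring.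
rewrite /cubic line2 line4 line6 /L; ring.
Qed.

Let M : R -> Prop := ideal_mul (ideal_mul (point_ideal (Some (x1, y x1)))
  (point_ideal (Some (x2, y x2)))) (point_ideal (Some (x3, y x3))).

Let gen_e x : point_ideal (Some (x, y x)) (e x).
Proof. by rewrite /= /coord_eval /= hornerXsubC horner0; ring. Qed.

Let gen_l x : point_ideal (Some (x, y x)) l.
Proof. by rewrite /= /l coord_y_subE /coord_eval /= hornerN yL hornerC; ring. Qed.

Let M_absorb r g : M g -> M (r * g).
Proof.
apply: ideal_mul_absorb => h; apply: ideal_mul_absorb => i.
apply: point_ideal_mulr; rewrite rational_pointsE; apply: cubic_line.
by rewrite !inE eqxx.
Qed.

Let J h := M (l * h).

Let J_absorb r g : J g -> J (r * g).
Proof. by move=> Jg; rewrite /J mulrCA; apply: M_absorb. Qed.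

Let JD g h : J g -> J h -> J (g + h).
Proof. by move=> Jg Jh; rewrite /J mulrDr; right. Qed.

Let J_lb : J lb.
Proof. by rewrite /J -e_prod; left => //; left. Qed.

Let J12 : J (e x1 * e x2).
Proof. by rewrite /J mulrC; left => //; left. Qed.
Let J13 : J (e x1 * e x3).
Proof. by rewrite /J mulrA [l * _]mulrC; left => //; left. Qed.
Let J23 : J (e x2 * e x3).
Proof. by rewrite /J mulrA; left => //; left. Qed.
Let J_le x : x \in [:: x1; x2; x3] -> J (l * e x).
Proof.
rewrite /J !inE => /or3P[]/eqP ->.
- have -> : l * (l * e x1) = e x1 * l * l by ring.
  by left => //; left.
- by rewrite mulrA mulrAC; left => //; left.
- by rewrite mulrA; left => //; left.
Qed.
Let J_ll : J (l * l).
Proof. by rewrite /J mulrA; left => //; left. Qed.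

Let e_shift u v : e u = e v + cst (v - u).
Proof. by apply: coord_eq; rewrite coordD /= ?polyCB; ring. Qed.

Let lE x : l = lb - 2 * (cst (y x) + cst lam * e x).
Proof.
rewrite /l /lb /e coord_y_subE coordD; apply: coord_eq.
  rewrite !(coordD, coordM) /= /y /L !(polyCD, polyCM); ring.
by rewrite !(coordD, coordM) /=; ring.
Qed.

Let J_eqr g h : g = h -> J g -> J h. Proof. by move=> ->. Qed.

Let cst2 : cst 2 = 2.
Proof. by apply: coord_eq => /=; rewrite ?polyC_natr //=; ring. Qed.

(* J e^2 and J (l e) give J (2 y e) through 2 y e = 2 L e - 2 lam e^2, hence J e; then
   J (l^2) gives J (4 y^2) *)
Let J1_double x : x \in [:: x1; x2; x3] -> y x != 0 -> J (e x * e x) -> J 1.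
Proof.
move=> xs yx Jee.
have Je : J (e x).
  have J2 : J (cst (2 * y x) * e x).
    apply: J_eqr (JD (JD (J_absorb (e x) J_lb) (J_absorb (-1) (J_le xs)))
      (J_absorb (- (2 * cst lam)) Jee)).
    rewrite coord_constM cst2 {1}(lE x); ring.
  have -> : e x = cst (2 * y x)^-1 * (cst (2 * y x) * e x).
    rewrite mulrA -coord_constM mulVf ?mulf_neq0 //.
    by rewrite (_ : cst 1 = 1) ?mul1r.
  exact: J_absorb.
apply: (ideal_const J_absorb (_ : (2 * y x) ^+ 2 != 0)).
  by rewrite expf_neq0 // mulf_neq0.
apply: J_eqr (JD (JD J_ll (J_absorb (4 * cst (y x) + 4 * cst lam * e x - lb) J_lb))
  (J_absorb (- (4 * (2 * cst (y x) * cst lam + cst lam * cst lam * e x))) Je)).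
rewrite !(lE x) expr2 !coord_constM cst2; ring.
Qed.

(* where L vanishes, a double root of f - L^2 is a double root of f *)
Let y_double x : (x == x1) && (x1 == x2) || (x == x1) && (x1 == x3) ||
  (x == x2) && (x2 == x3) -> y x != 0.
Proof.
move=> h; apply/eqP => yx0.
suff [h1 h2] : x ^+ 3 + a2 * x ^+ 2 + a4 * x + a6 = y x ^+ 2 /\
    3 * x ^+ 2 + 2 * a2 * x + a4 = 2 * lam * y x.
  move: (separable_cubic (x := x)); rewrite h1 h2 yx0 mulr0 expr0n eqxx => H.
  by have := H erefl.
rewrite line2 line4 line6 /y.
by case/orP: h => [/orP[]|] /andP[/eqP -> /eqP ->]; split; ring.
Qed.

Let J1 : J 1.
Proof.
have [e12|n12] := eqVneq x1 x2.
  apply: (@J1_double x1); rewrite ?inE ?eqxx //; last by rewrite {2}e12.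
  by apply: y_double; rewrite e12 !eqxx.
have [e13|n13] := eqVneq x1 x3.
  apply: (@J1_double x1); rewrite ?inE ?eqxx //; last by rewrite {2}e13.
  by apply: y_double; rewrite e13 !eqxx ?orbT.
have [e23|n23] := eqVneq x2 x3.
  apply: (@J1_double x2); rewrite ?inE ?eqxx ?orbT //; last by rewrite {2}e23.
  by apply: y_double; rewrite e23 !eqxx ?orbT.
apply: (ideal_const J_absorb (_ : (x2 - x1) * ((x3 - x1) * (x3 - x2)) != 0)).
  by rewrite !mulf_neq0 // subr_eq0 eq_sym.
apply: J_eqr (JD (JD (J_absorb (cst (x2 - x1)) J12)
  (J_absorb (- (e x2 + cst (x3 - x1))) J13))
  (J_absorb (e x2 + cst (x3 - x1)) J23)).
rewrite !coord_constM (e_shift x1 x3) (e_shift x2 x3).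
have -> : cst (x2 - x1) = cst (x3 - x1) - cst (x3 - x2).
  by apply: coord_eq; rewrite coordD /= ?polyCB; ring.
ring.
Qed.

(** The line l = y - L(x) generates the product of the ideals of the three points.
    Products of generators are divisible by l because
    (x - x1)(x - x2)(x - x3) = l (y + L). Conversely, the ideal J of the h such that
    l h lies in the product contains (x2 - x1)(x3 - x1)(x3 - x2), and at a double
    point it contains 4 y^2. *)
Lemma line_ideal : ideal_equiv M (@unit_ideal k cubic).
Proof.
apply: (@point_ideal_equiv1 _ _ l) => //.
- by rewrite /l coord_y_subE; apply/eqP => -[_ /eqP]; rewrite oner_eq0.
- move=> g; elim=> [m h3 Mm M3|g1 g2 _ [h1 ->] _ [h2 ->]]; last first.
    by exists (h1 + h2); rewrite mulrDr.
  elim: Mm => [h1 h2 M1 M2|g1 g2 _ [i1 e1] _ [i2 e2]]; last first.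
    by exists (i1 + i2); rewrite mulrDl e1 e2 mulrDr.
  have [s1 [t1 ->]] := point_ideal_gen (yL x1) M1.
  have [s2 [t2 ->]] := point_ideal_gen (yL x2) M2.
  have [s3 [t3 ->]] := point_ideal_gen (yL x3) M3.
  rewrite -!/(e _) -!/l.
  have -> (u1 v1 u2 v2 u3 v3 : R) : (e x1 * u1 + l * v1) * (e x2 * u2 + l * v2)
      * (e x3 * u3 + l * v3) = (e x1 * e x2 * e x3) * (u1 * u2 * u3) +
      l * (v1 * (e x2 * u2 + l * v2) * (e x3 * u3 + l * v3) +
           e x1 * u1 * (v2 * (e x3 * u3 + l * v3) + e x2 * u2 * v3)).
    by ring.
  by rewrite e_prod -mulrA -mulrDr; eexists.
- by rewrite -[l]mulr1; apply: J1.
Qed.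
End Line.

Lemma point_oppE x y : point_opp W (Some (x, y)) = Some (x, - y).
Proof. by congr (Some (_, _)) => /=; ring. Qed.

Lemma point_opp_rational P : rational_points W P -> rational_points W (point_opp W P).
Proof. by case: P => [[x y]|] //; rewrite point_oppE !rational_pointsE sqrrN. Qed.

Lemma point_oppK : involutive (point_opp W).
Proof. by case=> [[x y]|] //; congr (Some (_, _)) => /=; ring. Qed.

(** Here the quotient of the product by x - x0 contains 2 y, and f'(x0) if y = 0. *)
Lemma vertical_ideal P : rational_points W P -> ideal_equiv
  (ideal_mul (point_ideal P) (point_ideal (point_opp W P))) (@unit_ideal k cubic).
Proof.
case: P => [[x y]|_]; last exact: ideal_equiv_mul1.
move=> Pr; have PNr := point_opp_rational Pr; move: Pr PNr.
rewrite point_oppE !rational_pointsE => xy xyN.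
pose l : R := coord_y cubic - coord_poly _ y%:P.
pose lb : R := coord_y cubic - coord_poly _ (- y)%:P.
pose e : R := coord_poly _ ('X - x%:P).
pose A : {poly k} := 'X ^+ 2 + x%:P * 'X + (x ^+ 2)%:P + a2%:P * ('X + x%:P) + a4%:P.
have llb : l * lb = e * coord_poly _ A.
  rewrite /l /lb !coord_y_subE; apply: coord_eq; rewrite !coordM /=; last by rewrite polyCN; ring.
  have -> : cubic = 'X ^+ 3 + a2%:P * 'X ^+ 2 + a4%:P * 'X +
     (y ^+ 2 - (x ^+ 3 + a2 * x ^+ 2 + a4 * x))%:P.
    by rewrite xy cubicE /cubic; ring.
  by rewrite /A; ring.
have gen_e y' : point_ideal (Some (x, y')) e.
  by rewrite /= /coord_eval /= hornerXsubC horner0; ring.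
have gen_l y' : point_ideal (Some (x, y')) (coord_y cubic - coord_poly _ y'%:P).
  by rewrite /= coord_y_subE /coord_eval /= hornerN !hornerC; ring.
set M := ideal_mul _ _.
have M_absorb r g : M g -> M (r * g).
  by apply: ideal_mul_absorb => h; apply: point_ideal_mulr; rewrite rational_pointsE.
pose J h := M (e * h).
have J_absorb r g : J g -> J (r * g) by rewrite /J mulrCA; apply: M_absorb.
have JD g h : J g -> J h -> J (g + h) by rewrite /J mulrDr; right.
have Jeq g h : g = h -> J g -> J h by move=> ->.
have Je : J e by left; apply: gen_e.
have Jl : J l by rewrite /J mulrC; left; [apply: gen_l|apply: gen_e].
have Jlb : J lb by left; [apply: gen_e|apply: gen_l].
have JA : J (coord_poly _ A) by rewrite /J -llb; left; apply: gen_l.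
have J1 : J 1.
  have [y0|y0] := eqVneq y 0; last first.
    apply: (ideal_const J_absorb (_ : 2 * y != 0)); first by rewrite mulf_neq0.
    apply: Jeq (JD _ _ (J_absorb (-1) _ Jl) Jlb).
    rewrite /l /lb !coord_y_subE; apply: coord_eq; rewrite !(coordD, coordM) /=; ring.
  apply: (ideal_const J_absorb (separable_cubic (x := x) _)).
    by rewrite -cubicE -xy y0 expr0n.
  apply: Jeq (JD _ _ JA (J_absorb (coord_poly _ (- ('X + (2 * x)%:P + a2%:P))) _ Je)).
  by rewrite /A /e; apply: coord_eq; rewrite !(coordD, coordM) /=; ring.
apply: (@point_ideal_equiv1 _ _ e) => //.
- by apply/eqP => -[/eqP]; rewrite polyXsubC_eq0.
- move=> g; elim=> [h1 h2 M1 M2|g1 g2 _ [h1 ->] _ [h2 ->]]; last first.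
    by exists (h1 + h2); rewrite mulrDr.
  have [s1 [t1 ->]] := point_ideal_gen (hornerC y x) M1.
  have [s2 [t2 ->]] := point_ideal_gen (hornerC (- y) x) M2.
  rewrite -/l -/lb -/e.
  have -> (u1 v1 u2 v2 : R) : (e * u1 + l * v1) * (e * u2 + lb * v2) =
      e * (u1 * (e * u2 + lb * v2) + l * v1 * u2 + coord_poly _ A * (v1 * v2)).
    transitivity (e * (u1 * (e * u2 + lb * v2) + l * v1 * u2) + (l * lb) * (v1 * v2)).
      by ring.
    by rewrite llb; ring.
  by eexists.
- by rewrite -[e]mulr1; apply: J1.
Qed.

(** Reduces an equation to an identity that the ring tactic proves, modulo a known
    equation. *)
Lemma eq_sub2 (R' : zmodType) (a b c d : R') : c = d -> a - b = c - d -> a = b.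
Proof. by move=> -> /eqP; rewrite subrr subr_eq0 => /eqP. Qed.

(** Chord and tangent are treated alike: the line meets the cubic at the three roots
    of f - (lam x + nu)^2, which the coefficient identities express. *)
Lemma point_addP x1 y1 x2 y2 :
  rational_points W (Some (x1, y1)) -> rational_points W (Some (x2, y2)) ->
  (x2 = x1 /\ y2 = - y1 /\ point_add W (Some (x1, y1)) (Some (x2, y2)) = None) \/
  exists lam nu x3, [/\ a2 = lam ^+ 2 - (x1 + x2 + x3),
    a4 = 2 * lam * nu + (x1 * x2 + x1 * x3 + x2 * x3),
    a6 = nu ^+ 2 - x1 * x2 * x3, y1 = lam * x1 + nu /\ y2 = lam * x2 + nu &
    point_add W (Some (x1, y1)) (Some (x2, y2)) = Some (x3, - (lam * x3 + nu))].
Proof.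
rewrite !rational_pointsE !cubicE => h1 h2.
rewrite /point_add /=; case: ifP => [/andP[/eqP e0]|].
  rewrite !mul0r !addr0 addrC addr_eq0 => /eqP ->; left.
  by rewrite e0.
move=> e0; right; 
pose lam := if x1 == x2
  then (3 * x1 ^+ 2 + 2 * a2 * x1 + a4 - 0 * y1) / (2 * y1 + 0 * x1 + 0)
  else (y2 - y1) / (x2 - x1).
pose nu := y1 - lam * x1; pose x3 := lam ^+ 2 - a2 - x1 - x2.
exists lam, nu, x3.
have line2 : a2 = lam ^+ 2 - (x1 + x2 + x3) by rewrite /x3; ring.
have y1E : y1 = lam * x1 + nu by rewrite /nu; ring.
suff [y2E line4] : y2 = lam * x2 + nu /\
    a4 = 2 * lam * nu + (x1 * x2 + x1 * x3 + x2 * x3).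
  split=> //; last by rewrite /x3 /nu -/lam; congr (Some (_, _)); ring.
  apply: (eq_sub2 (esym h1)); rewrite y1E {1}line2 {1}line4; ring.
move: e0; have [e12|n12] := eqVneq x1 x2; last first.
  move=> _; have d12 : x2 - x1 != 0 by rewrite subr_eq0 eq_sym.
  have lamE : lam * (x2 - x1) = y2 - y1 by rewrite /lam (negPf n12) divfK.
  have y2E : y2 = lam * x2 + nu.
    by apply: (eq_sub2 (esym lamE)); rewrite /nu; ring.
  split=> //; apply: (mulfI d12); rewrite {1}y1E in h1; rewrite {1}y2E in h2.
  have h : (lam * x1 + nu) ^+ 2 - (lam * x2 + nu) ^+ 2 =
    x1 ^+ 3 + a2 * x1 ^+ 2 + a4 * x1 + a6 - (x2 ^+ 3 + a2 * x2 ^+ 2 + a4 * x2 + a6).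
    by rewrite h1 h2.
  by apply: (eq_sub2 h); rewrite {1 2}line2; ring.
rewrite /= -e12 !mul0r !addr0 => /negbT yy.
have y12 : y2 = y1.
  have : (y1 - y2) * (y1 + y2) = 0 by rewrite -subr_sqr h1 h2 -e12 subrr.
  by move=> /eqP; rewrite mulf_eq0 (negPf yy) orbF subr_eq0 => /eqP.
rewrite y12 in yy *; split=> //.
have lamE : lam * (2 * y1) = 3 * x1 ^+ 2 + 2 * a2 * x1 + a4.
  rewrite /lam -e12 eqxx !mul0r subr0 !addr0 divfK //.
  by have -> : 2 * y1 = y1 + y1 by ring.
by apply: (eq_sub2 (esym lamE)); rewrite {1}line2 y1E -e12; ring.
Qed.

Lemma point_add_rational P Q : rational_points W P -> rational_points W Q ->
  rational_points W (point_add W P Q).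
Proof.
case: P Q => [[x1 y1]|] [[x2 y2]|] // Pr Qr.
have [[_ [_ ->]]//|[lam [nu [x3 [l2 l4 l6 _ ->]]]]] := point_addP Pr Qr.
by rewrite rational_pointsE cubicE l2 l4 l6; ring.
Qed.

Let equiv_trans (I J L : R -> Prop) :
  ideal_equiv I J -> ideal_equiv J L -> ideal_equiv I L.
Proof. exact: (ideal_equiv_trans size_cubic). Qed.

(** Sending a point to the class of its ideal turns addition into multiplication of
    ideals; as this map is injective, the group axioms follow. *)
Lemma point_ideal_point_add P Q : rational_points W P -> rational_points W Q ->
  ideal_equiv (point_ideal (point_add W P Q))
    (ideal_mul (@point_ideal k cubic P) (point_ideal Q)).
Proof.
have unit_l S : rational_points W S -> ideal_equiv (point_ideal S)
    (ideal_mul (@point_ideal k cubic S) (@unit_ideal k cubic)).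
  move=> Sr; apply/ideal_equiv_sym/ideal_equiv_mul1.
    by move=> g h; apply: point_ideal_add.
  by move=> g h Sg; rewrite mulrC; apply: point_ideal_mulr.
case: P Q => [[x1 y1]|] [[x2 y2]|] // Pr Qr.
- have S := point_add_rational Pr Qr.
  have [[-> [-> ->]]|[lam [nu [x3 [l2 l4 l6 [e1 e2] e3]]]]] := point_addP Pr Qr.
    by rewrite -point_oppE; exact: ideal_equiv_sym (vertical_ideal Pr).
  have := line_ideal l2 l4 l6; rewrite -e1 -e2.
  set S' := Some (x3, lam * x3 + nu) => H.
  rewrite -point_oppE -/S' in e3; rewrite e3 in S *.
  have S'r : rational_points W S'.
    suff -> : S' = point_opp W (point_opp W S') by exact: point_opp_rational.
    by rewrite point_oppK.
  have H1 := equiv_trans (ideal_equiv_mull (point_ideal (point_opp W S')) H)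
    (equiv_trans (ideal_equiv_mulC _ _) (ideal_equiv_sym (unit_l _ S))).
  apply: ideal_equiv_sym; apply: equiv_trans H1.
  have I : ideal_equiv (@unit_ideal k cubic)
     (ideal_mul (point_ideal S') (point_ideal (point_opp W S'))).
    exact/ideal_equiv_sym/vertical_ideal.
  apply: equiv_trans (ideal_equiv_sym (ideal_equiv_mulA _ _ _)).
  apply: equiv_trans (equiv_trans (ideal_equiv_mull _ I)
    (ideal_equiv_mulC _ _)).
  apply: ideal_equiv_sym; apply: equiv_trans (ideal_equiv_mulC _ _) _.
  apply: ideal_equiv_mul1 => [g h Mg Mh|g h]; first by right.
  rewrite [g * h]mulrC; apply: ideal_mul_absorb => i; exact: point_ideal_mulr.
- exact: unit_l.
- exact: equiv_trans (unit_l _ Qr) (ideal_equiv_mulC _ _).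
- exact: unit_l.
Qed.

Lemma point_addC P Q : rational_points W P -> rational_points W Q ->
  point_add W P Q = point_add W Q P.
Proof.
move=> Pr Qr; apply: (point_ideal_inj size_cubic).
apply: equiv_trans (point_ideal_point_add Pr Qr) _.
apply: equiv_trans (ideal_equiv_mulC _ _) _.
exact/ideal_equiv_sym/point_ideal_point_add.
Qed.

Lemma point_addA P Q S : rational_points W P -> rational_points W Q ->
  rational_points W S ->
  point_add W P (point_add W Q S) = point_add W (point_add W P Q) S.
Proof.
move=> Pr Qr Sr; apply: (point_ideal_inj size_cubic).
have PQ := point_add_rational Pr Qr; have QS := point_add_rational Qr Sr.
apply: ideal_equiv_sym; apply: equiv_trans (point_ideal_point_add PQ Sr) _.
apply: equiv_trans (ideal_equiv_mull _ (point_ideal_point_add Pr Qr)) _.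
apply: equiv_trans (ideal_equiv_mulA _ _ _) _; apply: ideal_equiv_sym.
apply: equiv_trans (point_ideal_point_add Pr QS) _.
apply: equiv_trans (ideal_equiv_mulC _ _) _.
apply: equiv_trans (ideal_equiv_mull _ (point_ideal_point_add Qr Sr)) _.
exact: ideal_equiv_mulC.
Qed.

Lemma point_addN P : rational_points W P -> point_add W P (point_opp W P) = None.
Proof.
case: P => [[x y]|] // _; rewrite point_oppE /= eqxx.
by have -> : y + - y + 0 * x + 0 == 0 by apply/eqP; ring.
Qed.
End GroupLaw.

(** * Changes of variables *)

Section ChangeOfVariables.
Variables (k : fieldType) (u r s t a2 a4 a6 : k).
Hypothesis u0 : u != 0.
Local Notation W := (Weierstrass 0 a2 0 a4 a6).
Local Notation W' := (change_curve u r s t W).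
Local Notation cp := (change_point u r s t).

Definition unchange_point : curve_point k -> curve_point k :=
  omap (fun xy => (u ^+ 2 * xy.1 + r, u ^+ 3 * xy.2 + s * (u ^+ 2 * xy.1) + t)).

Lemma change_pointK : cancel cp unchange_point.
Proof. by case=> [[x y]|] //=; congr (Some (_, _)); field. Qed.

Lemma unchange_pointK : cancel unchange_point cp.
Proof. by case=> [[x y]|] //=; congr (Some (_, _)); field. Qed.

Lemma change_point_rational P :
  rational_points W' (cp P) <-> rational_points W P.
Proof.
case: P => [[x y]|] //=; rewrite /rational_points /=.
set l' := (X in X = _ <-> _); set r' := (X in _ = X <-> _).
set l := (X in _ <-> X = _); set r'' := (X in _ <-> _ = X).
have e : l - r'' = u ^+ 6 * (l' - r') by rewrite /l /r'' /l' /r'; field.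
split=> /eqP; rewrite -subr_eq0 => /eqP h; apply/eqP; rewrite -subr_eq0.
  by rewrite e h mulr0.
by move/eqP: e; rewrite h eq_sym mulf_eq0 expf_eq0 (negPf u0).
Qed.

Lemma change_point_surj P' : rational_points W' P' ->
  exists2 P, rational_points W P & P' = cp P.
Proof.
move=> h; exists (unchange_point P'); last by rewrite unchange_pointK.
by apply/change_point_rational; rewrite unchange_pointK.
Qed.

Lemma change_point_opp P : cp (point_opp W P) = point_opp W' (cp P).
Proof. by case: P => [[x y]|] //=; congr (Some (_, _)); field. Qed.

(** The slope transforms by lam' = (lam - s) / u, both for chords and for tangents. *)
Lemma change_point_add P Q : rational_points W P -> rational_points W Q ->
  point_add W' (cp P) (cp Q) = cp (point_add W P Q).
Proof.
case: P Q => [[x1 y1]|] [[x2 y2]|] //= Pr Qr.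
rewrite !mul0r !addr0.
have ex : ((x1 - r) / u ^+ 2 == (x2 - r) / u ^+ 2) = (x1 == x2).
  rewrite (inj_eq (mulIf _)) ?invr_eq0 ?expf_neq0 //.
  by rewrite -subr_eq0 opprB addrA subrK subr_eq0.
rewrite ex; have [e12|n12] := eqVneq x1 x2; last first.
  rewrite /= ; have d12 : x2 - x1 != 0 by rewrite subr_eq0 eq_sym.
  by congr (Some (_, _)); field; rewrite ?u0 ?d12 /=.
rewrite /= -e12.
have -> : (y1 - s * (x1 - r) - t) / u ^+ 3 + (y2 - s * (x1 - r) - t) / u ^+ 3 +
   (0 + 2 * s) / u * ((x1 - r) / u ^+ 2) + (0 + r * 0 + 2 * t) / u ^+ 3 =
   (y1 + y2) / u ^+ 3 by field.
rewrite mulf_eq0 invr_eq0 expf_eq0 (negPf u0) /= orbF.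
have [//|yy] := eqVneq (y1 + y2) 0.
have y12 : y1 = y2.
  have : (y1 - y2) * (y1 + y2) = 0.
    rewrite -subr_sqr; apply/eqP; rewrite subr_eq0; apply/eqP.
    by move: Pr Qr; rewrite /rational_points /= -e12 !mul0r !addr0 => -> ->.
  by move=> /eqP; rewrite mulf_eq0 (negPf yy) orbF subr_eq0 => /eqP.
have y2n : 2 * y1 != 0 by rewrite mulr_natl mulr2n {2}y12.
have y0 : y1 != 0 by apply: contra y2n => /eqP ->; rewrite mulr0.
have two0 : (2 : k) != 0 by apply: contra y2n => /eqP ->; rewrite mul0r.
have -> : 2 * ((y1 - s * (x1 - r) - t) / u ^+ 3) +
    (0 + 2 * s) / u * ((x1 - r) / u ^+ 2) + (0 + r * 0 + 2 * t) / u ^+ 3 =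
    2 * y1 / u ^+ 3 by field.
set lam := (3 * x1 ^+ 2 + 2 * a2 * x1 + a4 - 0) / (2 * y1).
set lam' := (_ - _) / (2 * y1 / u ^+ 3).
have -> : lam' = (lam - s) / u by rewrite /lam /lam'; field; rewrite u0 y0 two0.
by congr (Some (_, _)) => /=; field.
Qed.

Lemma change_point_muln n P : rational_points W P ->
  (forall m, rational_points W (point_muln W m P)) ->
  point_muln W' n (cp P) = cp (point_muln W n P).
Proof.
move=> Pr mr; elim: n => [//|n IH].
by rewrite /point_muln !iterS -!/(point_muln _ _ _) IH change_point_add.
Qed.
End ChangeOfVariables.

Section ChangeCompose.
Variables (k : fieldType) (u r s t r0 a2 a4 a6 : k).
Hypothesis u0 : u != 0.

Lemma change_curve_translate :
  change_curve u r s t (change_curve 1 r0 0 0 (Weierstrass 0 a2 0 a4 a6)) =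
  change_curve u (r0 + r) s t (Weierstrass 0 a2 0 a4 a6).
Proof. by rewrite /change_curve /=; congr Weierstrass; field; rewrite u0 oner_neq0. Qed.

Lemma change_point_translate P :
  change_point u r s t (change_point 1 r0 0 0 P) = change_point u (r0 + r) s t P.
Proof. by case: P => [[x y]|] //=; congr (Some (_, _)); field; rewrite u0 oner_neq0. Qed.

Lemma wdisc_change (W : weierstrass k) :
  wdisc W = u ^+ 12 * wdisc (change_curve u r s t W).
Proof.
case: W => b1 b2 b3 b4 b6.
by rewrite /wdisc /wb8 /wb2 /wb4 /wb6 /= /wb2 /wb4 /wb6 /=; field.
Qed.
End ChangeCompose.

Lemma wdisc_two_torsion_curve (k : fieldType) (a b : k) :
  wdisc (Weierstrass 0 a 0 b 0) = 16 * b ^+ 2 * (a ^+ 2 - 4 * b).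
Proof. by rewrite /wdisc /wb8 /wb2 /wb4 /wb6 /= /wb2 /wb4 /wb6 /=; ring. Qed.

(** * Squares in finite fields *)

(** Transfers statements about enumerated fields to fields that are finite as
    sets. *)
Lemma finite_fieldW (P : fieldType -> Prop) :
  (forall F : finFieldType, P F) ->
  forall k : fieldType, finite_set [set: k] -> P k.
Proof.
move=> PF [T c]; set k := GRing.Field.Pack c => /finite_seqP[s es].
have ms x : x \in undup s.
  by rewrite mem_undup; have : [set: k] x by []; rewrite es.
have can : cancel (fun x => index x s) (nth 0 s).
  by move=> x; rewrite nth_index // -mem_undup.
have fin : Finite.axiom (undup s).
  by move=> x; rewrite count_uniq_mem ?undup_uniq // ms.
pose cm : isCountable k := CanIsCountable can.
pose ck : countType := HB.pack (k : Type) (GRing.Field.class k) cm.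
pose fm : isFinite ck := isFinite.Build ck (fin : Finite.axiom (undup s : seq ck)).
pose F : finFieldType := HB.pack (k : Type) (GRing.Field.class k) cm fm.
exact: (PF F).
Qed.

Definition square (k : fieldType) (x : k) : Prop := exists c, x = c ^+ 2.

Lemma squareM (k : fieldType) (x y : k) : square x -> square y -> square (x * y).
Proof. by move=> [c ->] [d ->]; exists (c * d); rewrite exprMn. Qed.

Lemma square_div (k : fieldType) (x y : k) :
  y != 0 -> square (x * y) -> square y -> square x.
Proof.
move=> y0 [c e] [d f]; exists (c / d); rewrite expr_div_n -e -f mulfK //.
Qed.

Lemma square_sqr (k : fieldType) (x : k) : square (x ^+ 2).
Proof. by exists x. Qed.

Section FiniteField.
Import fingroup cyclic.
Variable F : finFieldType.
Hypothesis two_neq0 : (2 : F) != 0.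

Let exists_nonsquare : exists n : F, ~ square n.
Proof.
apply: contrapT => H.
have sq (x : F) : square x by apply: contrapT => nx; apply: H; exists x.
have inj : injective (fun x : F => x ^+ 2).
  apply/injectiveP/card_uniqP; rewrite /= size_map -cardE.
  apply: eq_card => y; rewrite !inE; have [c e] := sq y.
  by apply/mapP; exists c; rewrite ?mem_enum.
have /eqP : (1 : F) = - 1 by apply: inj; rewrite /= sqrrN.
by rewrite -subr_eq0 opprK (negPf two_neq0).
Qed.

Let nonsquareM (x y : F) : ~ square x -> ~ square y -> square (x * y).
Proof.
move=> nx ny.
have x0 : x != 0 by apply/eqP => x0; apply: nx; exists 0; rewrite x0 expr0n.
have y0 : y != 0 by apply/eqP => y0; apply: ny; exists 0; rewrite y0 expr0n.
have /cyclicP[g eg] := field_unit_group_cyclic [set: {unit F}]%G.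
have gen z : z != 0 -> exists i, z = (val g : F) ^+ i.
  rewrite -unitfE => Uz; have /cycleP[i e] : FinRing.Unit Uz \in <[g]>%g.
    by rewrite -eg inE.
  by exists i; rewrite -FinRing.val_unitX -e.
have [i ex] := gen _ x0; have [j ey] := gen _ y0.
have oddn n : ~ square ((val g : F) ^+ n) -> odd n.
  apply: contraPT => /even_halfK <-; apply; rewrite -muln2 exprM.
  exact: square_sqr.
rewrite ex ey -exprD -[(i + j)%N]even_halfK; first by rewrite -muln2 exprM; apply: square_sqr.
by rewrite oddD !oddn // -?ex -?ey.
Qed.

(** Otherwise q(x) = x^2 + A x + B is a nonzero square at 0 and at every nonsquare x,
    which yields at least |F| + 1 points on the conic y^2 = q(x). But y - x - A/2 maps
    the points of this conic injectively to nonzero elements. *)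
Let conic_count (A B : F) : B != 0 -> A ^+ 2 - 4 * B != 0 ->
  ~ square B \/ exists x y, ~ square x /\ y ^+ 2 = x * (x ^+ 2 + A * x + B).
Proof.
move=> B0 d0; apply: contrapT => /not_orP[/contrapT sB H].
pose q (x : F) := x ^+ 2 + A * x + B.
pose S := [set x : F | ~~ [exists c, x == c ^+ 2]]%SET.
have inS x : x \in S <-> ~ square x.
  rewrite inE; split=> [/negP h [c e]|h]; first by apply: h; apply/existsP; exists c; apply/eqP.
  by apply/negP => /existsP[c /eqP e]; apply: h; exists c.
have qsq x : x \in 0 |: S -> exists w, q x == w ^+ 2 /\ w != 0.
  rewrite in_setU1 => /orP[/eqP ->|/inS nx].
    have [c e] := sB; exists c; rewrite /q expr0n mulr0 !add0r e; split=> //.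
    by apply: contra B0 => /eqP c0; rewrite e c0 expr0n.
  have q0 : q x != 0.
    apply/eqP => q0; apply: H; exists x, 0; split=> //.
    by rewrite -/(q x) q0 mulr0 expr0n.
  have [w e] : square (q x).
    apply: contrapT => nq; have [w e] := nonsquareM nx nq.
    by apply: H; exists x, w.
  by exists w; rewrite e eqxx; split=> //; apply: contra q0 => /eqP w0; rewrite e w0 expr0n.
pose w x := if [pick w | (q x == w ^+ 2) && (w != 0)] is Some w then w else 0.
have wP x : x \in 0 |: S -> w x ^+ 2 = q x /\ w x != 0.
  move=> /qsq[v [v1 v2]]; rewrite /w; case: pickP => [v' /andP[/eqP -> ->]//|/(_ v)].
  by rewrite v1 v2.
pose h (z : F * bool) := (-1) ^+ z.2 * w z.1 - z.1 - A / 2.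
have four_neq0 : (4 : F) != 0 by rewrite (natrM _ 2 2) mulf_neq0.
have hP x b : x \in 0 |: S ->
    h (x, b) * ((-1) ^+ b * w x + x + A / 2) = - ((A ^+ 2 - 4 * B) / 4).
  move=> /wP[e _].
  have -> : h (x, b) * ((-1) ^+ b * w x + x + A / 2) =
     ((-1) ^+ b) ^+ 2 * w x ^+ 2 - (x + A / 2) ^+ 2 by rewrite /h /=; ring.
  by rewrite sqrr_sign mul1r e /q; field; rewrite four_neq0 two_neq0.
have h0 x b : x \in 0 |: S -> h (x, b) != 0.
  move=> xS; apply/eqP => e; move: (hP x b xS); rewrite e mul0r => /esym/eqP.
  by rewrite oppr_eq0 mulf_eq0 invr_eq0 (negPf d0) (negPf four_neq0).
pose Z := finset.setX (0 |: S) [set: bool].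
have inj : {in Z &, injective h}.
  move=> [x b] [x' b'] /setXP[xS _] /setXP[x'S _] e.
  have := hP x b xS; rewrite -(hP x' b' x'S) e => /(mulfI (h0 _ _ x'S)) e2.
  have e3 : 2 * x = 2 * x'.
    have -> : 2 * x = (-1) ^+ b * w x + x + A / 2 - h (x, b) - A by rewrite /h /=; field.
    by rewrite e e2 /h /=; field.
  have xx : x = x' by exact: (mulfI two_neq0).
  rewrite -xx in e2 *; congr (_, _).
  have /(mulIf (wP x xS).2) : (-1) ^+ b * w x = (-1) ^+ b' * w x.
    by move: e2; move/addIr/addIr.
  case: b b' {e e2} => -[] //= /eqP.
    by rewrite expr0 expr1 -subr_eq0 -opprD oppr_eq0 (negPf two_neq0).
  by rewrite expr0 expr1 -subr_eq0 opprK (negPf two_neq0).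
have c1 : (#|h @: Z| <= #|F|.-1)%N.
  rewrite -(cardC1 (0 : F)); apply/subset_leq_card/fintype.subsetP => _ /imsetP[[x b] /setXP[xS _] ->].
  by rewrite !inE h0.
have [n nn] := exists_nonsquare.
have n0 : n != 0 by apply/eqP => n0; apply: nn; exists 0; rewrite n0 expr0n.
pose T := *%R n @: (~: (0 |: S))%SET.
have c2 : (#|T| <= #|S|)%N.
  apply/subset_leq_card/fintype.subsetP => _ /imsetP[x + ->].
  rewrite inE in_setU1 negb_or => /andP[x0 xS].
  have [c ex] : square x by apply: contrapT => /inS; apply/negP.
  apply/inS => -[d e]; apply: nn; apply: (square_div x0); first by exists d.
  by exists c.
have zS : 0 \notin S.
  by apply/negP => /inS; apply; exists 0; rewrite expr0n.
move: c1 c2; rewrite /T card_in_imset // card_imset; last exact: mulfI.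
rewrite (cardsCs (~: (0 |: S))%SET) finset.setCK cardsX cardsT card_bool cardsU1 zS /=.
have := max_card (mem (0 |: S)); rewrite cardsU1 zS /=.
by move: #|F| #|S| => a b; lia.
Qed.

Lemma finFieldType_descent :
  [/\ exists n : F, ~ square n,
      forall x y : F, ~ square x -> ~ square y -> square (x * y) &
      forall A B : F, B != 0 -> A ^+ 2 - 4 * B != 0 -> ~ square B \/
        exists x y, ~ square x /\ y ^+ 2 = x * (x ^+ 2 + A * x + B)].
Proof. by split. Qed.
End FiniteField.

(** * The 2-descent class and the parity of the index *)

(** Translation by R exchanges the cosets inside G0 with those outside. *)
Lemma even_index (T : Type) (op : T -> T -> T) (G G0 H : set T) (R R' h0 : T) :
  finite_set G -> G0 `<=` G -> H `<=` G0 -> H h0 -> G R -> G R' ->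
  (forall x y, G x -> G y -> G (op x y)) ->
  (forall x y z, G x -> G y -> G z -> op x (op y z) = op (op x y) z) ->
  (forall x, G x -> op R' (op R x) = x) -> (forall x, G x -> op R (op R' x) = x) ->
  (forall x, G0 x -> ~ G0 (op R x)) -> (forall x, G x -> ~ G0 x -> G0 (op R' x)) ->
  (forall x y, G x -> G0 y -> G0 (op x y) <-> G0 x) ->
  exists m : nat, ([set op x @` H | x in G] #= `I_m)%card /\ (2 %| m)%N.
Proof.
move=> Gfin G0G HG0 Hh0 GR GR' opG opA R'R RR' G0R G0R' G0op.
pose X := [set op x @` H | x in G0].
pose Y := [set op x @` H | x in G `\` G0].
pose f (C : set T) : set T := op R @` C.
have fE x : G x -> f (op x @` H) = op (op R x) @` H.
  move=> Gx; rewrite /f image_comp; apply: eq_imagel => h Hh /=.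
  by rewrite opA //; apply/G0G/HG0.
have XY : f @` X = Y.
  apply/seteqP; split=> [_ [_ [x xG0 <-] <-]|_ [x [Gx nx] <-]].
    rewrite fE; last exact: G0G.
    exists (op R x) => //; split; last exact: G0R.
    exact/opG/G0G.
  exists (op (op R' x) @` H); last by rewrite fE ?RR' //; apply: opG.
  by exists (op R' x) => //; apply: G0R'.
have finj : {in X &, injective f}.
  have sub C : X C -> C `<=` G.
    by move=> [x xG0 <-] _ [h /HG0 hG0 <-]; apply: opG; apply: G0G.
  have cancelf C : X C -> op R' @` f C = C.
    move=> /sub CG; apply/seteqP; split=> [_ [_ [x Cx <-] <-]|x Cx].
      by rewrite R'R //; apply: CG.
    by exists (op R x); [exists x|rewrite R'R //; apply: CG].
  by move=> C D /set_mem XC /set_mem XD e; rewrite -(cancelf C XC) e cancelf.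
have cosE : [set op x @` H | x in G] = X `|` Y.
  rewrite /X /Y -image_setU; congr (image _ _).
  by rewrite setDUK.
have dis : X `&` Y = set0.
  apply/seteqP; split=> // C [[x xG0 <-] [y [Gy ny]]] e.
  have : (op y @` H) (op y h0) by exists h0.
  rewrite e => -[h Hh e2]; apply: ny; apply/(G0op y h0 Gy (HG0 _ Hh0)).
  by rewrite -e2; apply/G0op; [apply: G0G|apply: HG0|].
have /finite_setP[n Xn] : finite_set X by apply/finite_image/(sub_finite_set G0G).
have Yn : (Y #= `I_n)%card.
  by rewrite -XY; apply: card_eq_trans Xn; apply: inj_card_eq.
have Xfin : finite_set X by apply/finite_setP; exists n.
have Yfin : finite_set Y by apply/finite_setP; exists n.
exists (n + n)%N; split; last by rewrite addnn -mul2n dvdn_mulr.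
have XYfin : finite_set (X `|` Y) by rewrite finite_setU.
rewrite cosE -(fset_setK XYfin); apply/card_eq_fsetP.
rewrite fset_setU // cardfsU -fset_setI // dis fset_set0 cardfs0 subn0.
by rewrite (card_fset_set Xn) (card_fset_set Yn).
Qed.

Section Descent.
Variables (k : fieldType) (a b : k).
Hypothesis two_neq0 : (2 : k) != 0.
Hypothesis b_neq0 : b != 0.
Hypothesis d_neq0 : a ^+ 2 - 4 * b != 0.
Local Notation M := (Weierstrass 0 a 0 b 0).

Lemma two_torsion_curve_separable (x : k) :
  x ^+ 3 + a * x ^+ 2 + b * x + 0 = 0 -> 3 * x ^+ 2 + 2 * a * x + b != 0.
Proof.
have -> : x ^+ 3 + a * x ^+ 2 + b * x + 0 = x * (x ^+ 2 + a * x + b) by ring.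
have [->|x0] := eqVneq x 0; first by rewrite expr0n !mulr0 !add0r.
move=> /eqP; rewrite mulf_eq0 (negPf x0) => /eqP q0; apply/eqP => dq0.
have e : 2 * x + a = 0.
  apply: (mulfI x0); rewrite mulr0 -[RHS]dq0.
  by rewrite (_ : b = - x ^+ 2 - a * x) ?[RHS]addr0; [ring|rewrite -[RHS]addr0 -q0; ring].
move: d_neq0; have -> : a = - (2 * x) by rewrite -[RHS]addr0 -e; ring.
have -> : b = x ^+ 2.
  have -> : b = (x ^+ 2 + a * x + b) - x * (2 * x + a) + x ^+ 2 by ring.
  by rewrite q0 e; ring.
by rewrite (_ : _ - _ = 0) ?eqxx //; ring.
Qed.

Let sep := two_torsion_curve_separable.

(** The class of x modulo squares; on the curve x times x^2 + a x + b is a square,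
    which gives the value b at (0, 0). *)
Definition descent_class (P : curve_point k) : k :=
  if P is Some (x, _) then if x == 0 then b else x else 1.

Lemma descent_class_neq0 P : descent_class P != 0.
Proof. by case: P => [[x y]|] /=; rewrite ?oner_neq0 //; case: ifP => [_|->]. Qed.

Lemma descent_class_opp P : descent_class (point_opp M P) = descent_class P.
Proof. by case: P => [[x y]|]. Qed.

(** For collinear points x1 x2 x3 = nu^2, and if one of these vanishes the product of
    the other two is b. *)
Lemma descent_class_add P Q : rational_points M P -> rational_points M Q ->
  square (descent_class (point_add M P Q) * (descent_class P * descent_class Q)).
Proof.
case: P Q => [[x1 y1]|] [[x2 y2]|] Pr Qr; last 3 first.
- by rewrite /= mulr1 -expr2; apply: square_sqr.
- by rewrite /= mul1r -expr2; apply: square_sqr.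
- by exists 1; rewrite /= expr1n !mulr1.
have [[-> [_ ->]]|[lam [nu [x3 [_ l4 l6 _ ->]]]]] := point_addP Pr Qr.
  by rewrite /descent_class mul1r -expr2; apply: square_sqr.
have e : nu ^+ 2 = x1 * x2 * x3.
  by rewrite -[RHS]add0r {1}l6; ring.
rewrite /descent_class; move: l4 e.
have [->|x10] := eqVneq x1 0.
  move=> l4 /eqP; rewrite !mul0r expf_eq0 => /eqP nu0.
  have be : b = x2 * x3 by rewrite l4 nu0; ring.
  have := b_neq0; rewrite be mulf_eq0 negb_or => /andP[/negPf -> /negPf ->].
  by exists (x2 * x3); ring.
have [->|x20] := eqVneq x2 0.
  move=> l4 /eqP; rewrite mulr0 !mul0r expf_eq0 => /eqP nu0.
  have be : b = x1 * x3 by rewrite l4 nu0; ring.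
  have := b_neq0; rewrite be mulf_eq0 negb_or => /andP[_ /negPf ->].
  by exists (x1 * x3); ring.
have [->|x30] := eqVneq x3 0.
  move=> l4 /eqP; rewrite mulr0 expf_eq0 => /eqP nu0.
  by exists b; rewrite l4 nu0; ring.
by move=> _ e; exists nu; rewrite e; ring.
Qed.

Lemma finite_curve_point : finite_set [set: k] -> finite_set [set: curve_point k].
Proof.
move=> kf; apply: (@sub_finite_set _ _ ([set None] `|` Some @` [set: k * k])).
  by case=> [xy|] _; [right; exists xy|left].
rewrite finite_setU; split; first exact: finite_set1.
by apply: finite_image; rewrite -setXTT; apply: finite_setX.
Qed.

Section Index.
Variables (u r s t : k).
Hypothesis u_neq0 : u != 0.
Hypothesis k_finite : finite_set [set: k].
Local Notation M' := (change_curve u r s t M).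
Local Notation cp := (change_point u r s t).

Let G0 : set (curve_point k) :=
  [set P' | exists P, [/\ rational_points M P, square (descent_class P) & P' = cp P]].

(** Over a finite field the descent class is onto k^* modulo squares, so its kernel,
    which contains the multiples of P, has index 2. *)
Lemma even_index_square_class P : rational_points M P -> square (descent_class P) ->
  dvd_index M' 2 (cyclic_subgroup M' (cp P)).
Proof.
move=> Pr Psq.
have [_ nonsqM conic] := finite_fieldW (P := fun k : fieldType => (2 : k) != 0 ->
  [/\ exists n : k, ~ square n,
      forall x y : k, ~ square x -> ~ square y -> square (x * y) &
      forall A B : k, B != 0 -> A ^+ 2 - 4 * B != 0 -> ~ square B \/
        exists x y, ~ square x /\ y ^+ 2 = x * (x ^+ 2 + A * x + B)])
  finFieldType_descent k_finite two_neq0.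
have [R Rr Rn] : exists2 R, rational_points M R & ~ square (descent_class R).
  have [nb|[x [y [nx e]]]] := conic a b b_neq0 d_neq0.
    exists (Some (0, 0)); last by rewrite /= eqxx.
    by rewrite rational_pointsE cubicE; ring.
  exists (Some (x, y)); first by rewrite rational_pointsE cubicE e; ring.
  rewrite /=; case: ifP => // /eqP x0; case: nx; exists 0.
  by rewrite x0 expr0n.
have addE := change_point_add r s t u_neq0 (a2 := a) (a4 := b) (a6 := 0).
have Gr := change_point_rational r s t a b 0 u_neq0.
have surj := change_point_surj u_neq0 (r := r) (s := s) (t := t) (a2 := a) (a4 := b) (a6 := 0).
have addr := @point_add_rational _ a b 0.
have oppr := @point_opp_rational _ a b 0.
have sqadd S Q : rational_points M S -> rational_points M Q ->
    square (descent_class S) <->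
    square (descent_class (point_add M S Q) * descent_class Q).
  move=> Sr Qr; have := descent_class_add Sr Qr.
  set c := descent_class _; rewrite mulrCA [_ * (c * _)]mulrC => sq.
  split=> h.
    exact: square_div (descent_class_neq0 S) sq h.
  apply: square_div (_ : c * descent_class Q != 0) _ h.
    by rewrite mulf_neq0 ?descent_class_neq0.
  by rewrite mulrC.
have G0cp Q : rational_points M Q -> G0 (cp Q) <-> square (descent_class Q).
  move=> Qr; split=> [[S [Sr sS /(can_inj (change_pointK r s t u_neq0)) ->]]//|sQ].
  by exists Q.
have assoc Q S : rational_points M Q -> rational_points M S ->
    point_add M (point_opp M Q) (point_add M Q S) = S.
  move=> Qr Sr; rewrite (point_addA two_neq0 sep) //; last exact: oppr.
  rewrite (point_addC two_neq0 sep _ Qr) ?point_addN //; exact: oppr.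
apply: (@even_index _ (point_add M') (rational_points M') G0
  (cyclic_subgroup M' (cp P)) (cp R) (cp (point_opp M R)) None).
- by apply: sub_finite_set (finite_curve_point k_finite).
- by move=> _ [Q [Qr _ ->]]; apply/Gr.
- have mulG0 n : G0 (point_muln M' n (cp P)).
    elim: n => [|n [Q [Qr sQ e]]].
      by exists None; split=> //; exists 1; rewrite expr1n.
    rewrite /point_muln iterS -/(point_muln _ _ _) e addE //.
    apply/G0cp; first exact: addr.
    apply: square_div (descent_class_neq0 Q) _ sQ; rewrite -sqadd //.
  move=> _ [[n|n] _ <-] //=; have [Q [Qr sQ e]] := mulG0 n.+1.
  rewrite [X in G0 X](_ : _ = point_opp M' (point_muln M' n.+1 (cp P))) // e.
  rewrite -change_point_opp //; apply/G0cp; first exact: oppr.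
  by rewrite descent_class_opp.
- by exists 0.
- exact/Gr.
- exact/Gr/oppr.
- by move=> _ _ /surj[Q Qr ->] /surj[S Sr ->]; rewrite addE //; apply/Gr/addr.
- move=> _ _ _ /surj[Q Qr ->] /surj[S Sr ->] /surj[U Ur ->].
  rewrite !addE //; [|exact: addr..].
  by rewrite (point_addA two_neq0 sep).
- move=> _ /surj[Q Qr ->]; rewrite !addE //; [|exact: oppr|exact: addr].
  by rewrite assoc.
- move=> _ /surj[Q Qr ->]; rewrite !addE //; [|exact: addr (oppr _ _) _|exact: oppr].
  have := assoc _ _ (oppr _ Rr) Qr; rewrite point_oppK => ->; exact.
- move=> _ [Q [Qr sQ ->]]; rewrite addE // G0cp; last exact: addr.
  move=> h; apply: Rn; apply/(sqadd _ Q) => //; exact: squareM.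
- move=> _ /surj[Q Qr ->]; rewrite G0cp // => nQ.
  rewrite addE //; last exact: oppr.
  rewrite G0cp; last by apply: addr => //; exact: oppr.
  apply: contrapT => h; apply: Rn; rewrite -descent_class_opp.
  by apply/(sqadd _ Q) => //; [exact: oppr|exact: nonsqM].
- move=> _ _ /surj[Q Qr ->] [S [Sr sS ->]]; rewrite addE // !G0cp //; last exact: addr.
  rewrite (sqadd Q S) //; split=> h; first exact: squareM.
  exact: square_div (descent_class_neq0 S) h sS.
Qed.
End Index.
End Descent.

(** * Integers and local rings of a number field *)

Section Integers.
Variable K : fieldExtType rat.
Implicit Types (x y : K) (p : prime_of K).

Lemma natr_number_eq0 n : ((n%:R : K) == 0) = (n == 0%N).
Proof.
rewrite -(rmorph_nat (in_alg K)) fmorph_eq0.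
by rewrite (_ : (n%:R : rat) = (n%:Z)%:~R) // intr_eq0.
Qed.

Lemma integer1 : integer (1 : K).
Proof. exact: (integral1 (intr : {rmorphism int -> K})). Qed.
Lemma integer0 : integer (0 : K).
Proof. exact: (integral0 (intr : {rmorphism int -> K})). Qed.
Lemma integerD x y : integer x -> integer y -> integer (x + y).
Proof. exact: (@integral_add int K intr). Qed.
Lemma integerB x y : integer x -> integer y -> integer (x - y).
Proof. exact: (@integral_sub int K intr). Qed.
Lemma integerM x y : integer x -> integer y -> integer (x * y).
Proof. exact: (@integral_mul int K intr). Qed.
Lemma integerX x n : integer x -> integer (x ^+ n).
Proof.
by move=> xi; elim: n => [|n IH]; [exact: integer1|rewrite exprS; apply: integerM].
Qed.
Lemma integer_nat n : integer (n%:R : K).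
Proof. exact: (integral_nat (intr : {rmorphism int -> K})). Qed.
Lemma integer_int (z : int) : integer (z%:~R : K).
Proof. exact: (integral_id (intr : {rmorphism int -> K})). Qed.

Lemma integer_monic (q : {poly K}) x :
  q \is monic -> root q x -> (forall i, integer q`_i) -> integer x.
Proof.
move=> qm qx qi; pose h : {rmorphism int -> K} := intr.
exact: (integral_root_monic qm qx ((integral_poly h q).1 qi)).
Qed.

Lemma integer_root x n : integer (x ^+ n.+1) -> integer x.
Proof.
move=> xn; apply: (@integer_monic ('X^(n.+1) - (x ^+ n.+1)%:P)).
- exact: monicXnsubC.
- by rewrite /root !hornerE subrr.
- move=> i; rewrite coefB coefXn coefC.
  apply: integerB; first exact: integer_nat.
  by case: ifP => // _; exact: integer0.
Qed.

(** The leading coefficient of an integral polynomial that annihilates x will do. *)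
Lemma integer_denom x : exists2 n : nat, (0 < n)%N & integer (x * n%:R).
Proof.
have /polyOver1P[q eq] := minPolyOver 1%VS x.
have rq : root (map_poly (in_alg K) q) x by rewrite -eq root_minPoly.
have q0 : q != 0.
  apply/eqP => q0; have := monic_minPoly 1%VS x.
  by rewrite eq q0 map_poly0 monicE lead_coef0 eq_sym oner_eq0.
have [P [a a0 eP]] := rat_poly_scale q.
pose z i : K := (P`_i)%:~R.
have Px : \sum_(i < size P) z i * x ^+ i = 0.
  have : (map_poly (in_alg K) (map_poly intr P)).[x] = 0.
    have -> : map_poly intr P = a%:~R *: q.
      by rewrite eP scalerA mulfV ?scale1r // intr_eq0.
    by rewrite linearZ hornerZ (rootP rq) mulr0.
  rewrite -map_poly_comp horner_coef size_map_inj_poly; last 2 first.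
  - by move=> u v /= /(fmorph_inj (in_alg K))/intr_inj.
  - by rewrite /= mulr0z scale0r.
  move=> e; rewrite -[RHS]e; apply: eq_bigr => i _.
  by rewrite coef_map_id0 /= ?mulr0z ?scale0r // scaler_int.
have P0 : P != 0 by apply: contra q0 => /eqP P0; rewrite eP P0 map_poly0 scaler0.
pose m := (size P).-1.
have sP : size P = m.+1 by rewrite /m prednK // size_poly_gt0.
have zm : z m != 0.
  rewrite /z -(rmorph_int (in_alg K)) fmorph_eq0 intr_eq0.
  by rewrite /m -/(lead_coef P) lead_coef_eq0.
suff int_zx : integer (z m * x).
  exists (absz (P`_m)).
    by rewrite absz_gt0 /m -/(lead_coef P) lead_coef_eq0.
  have -> : x * (absz (P`_m))%:R = (sgz (P`_m))%:~R * (z m * x).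
    by rewrite -[_%:R]/((absz (P`_m))%:Z%:~R) abszEsg intrM /z mulrC mulrA.
  by apply: integerM => //; exact: integer_int.
case: (posnP m) => [m0|m_gt0].
  by move: Px zm; rewrite sP m0 big_ord1 expr0 mulr1 => ->; rewrite eqxx.
pose R := \poly_(i < m.+1) (if i == m then 1 else z i * z m ^+ (m.-1 - i)).
apply: (@integer_monic R).
- by rewrite monicE lead_coef_poly ?eqxx ?oner_neq0.
- rewrite /root horner_poly.
  have -> : \sum_(i < m.+1) (if val i == m then 1 else z i * z m ^+ (m.-1 - i)) *
    (z m * x) ^+ i = z m ^+ m.-1 * \sum_(i < size P) z i * x ^+ i.
    rewrite sP mulr_sumr; apply: eq_bigr => i _; rewrite exprMn.
    case: eqP => [->|/eqP im].
      by rewrite mul1r mulrA -exprSr prednK.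
    have le_im : (i <= m.-1)%N by rewrite -ltnS prednK // ltn_neqAle im -ltnS ltn_ord.
    rewrite -[in RHS](subnK le_im) exprD; ring.
  by rewrite Px mulr0.
- move=> i; rewrite coef_poly.
  case: ifP => _; last exact: integer0.
  case: ifP => _; first exact: integer1.
  by apply: integerM; [exact: integer_int|apply: integerX; exact: integer_int].
Qed.

Section Local.
Variable p : prime_of K.
Local Notation loc := (local_pred p).

Lemma local_int x : integer x -> x \in loc.
Proof.
by move=> xi; apply/local_predP; exists x, 1; split; rewrite ?divr1 //;
  [exact: integer1|exact: prime_1].
Qed.

Lemma local_closed x n : x ^+ n.+1 \in loc -> x \in loc.
Proof.
move=> /local_predP[a [s [ai si ps e]]].
apply/local_predP; exists (x * s), s; split=> //; last by rewrite mulfK ?(prime_nz ps).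
apply: (@integer_root _ n); rewrite exprMn e exprS mulrA divfK ?(prime_nz ps) //.
by apply: integerM => //; exact: integerX.
Qed.

Lemma local_denom x (n : nat) : integer (x * n%:R) -> ~ p n%:R -> x \in loc.
Proof.
move=> xn pn; apply/local_predP; exists (x * n%:R), n%:R; split=> //.
  exact: integer_nat.
by rewrite mulfK ?(prime_nz pn).
Qed.

Let f : {rmorphism local_ring p -> residue_field p} := \pi_(residue_field p).

Let residueE x (xl : x \in loc) : residue p x = f (LocalRing xl).
Proof. by rewrite /residue; congr (f _); apply: val_inj; rewrite insubdK. Qed.

Lemma residueD x y : x \in loc -> y \in loc ->
  residue p (x + y) = residue p x + residue p y.
Proof.
move=> xl yl; rewrite (residueE xl) (residueE yl) (residueE (rpredD xl yl)) -rmorphD.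
by congr (f _); apply: val_inj.
Qed.

Lemma residueM x y : x \in loc -> y \in loc ->
  residue p (x * y) = residue p x * residue p y.
Proof.
move=> xl yl; rewrite (residueE xl) (residueE yl) (residueE (rpredM xl yl)) -rmorphM.
by congr (f _); apply: val_inj.
Qed.

Lemma residueN x : x \in loc -> residue p (- x) = - residue p x.
Proof.
move=> xl; have xNl : - x \in loc by rewrite rpredN.
rewrite (residueE xl) (residueE xNl) -rmorphN.
by congr (f _); apply: val_inj.
Qed.

Lemma residue1 : residue p 1 = 1.
Proof. by rewrite (residueE (rpred1 _)) -(rmorph1 f); congr (f _); apply: val_inj. Qed.

Lemma residue0 : residue p 0 = 0.
Proof. by rewrite (residueE (rpred0 _)) -(rmorph0 f); congr (f _); apply: val_inj. Qed.

Lemma residue_nat n : residue p n%:R = n%:R.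
Proof.
elim: n => [|n IH]; first exact: residue0.
by rewrite -natr1 residueD ?rpred1 ?rpred_nat // IH residue1 natr1.
Qed.

Lemma residueX x n : x \in loc -> residue p (x ^+ n) = residue p x ^+ n.
Proof.
move=> xl; elim: n => [|n IH]; first exact: residue1.
by rewrite !exprS residueM ?rpredX // IH.
Qed.

Lemma residue_eq0 x : x \in loc ->
  residue p x = 0 <-> exists a s, [/\ p a, integer s, ~ p s & x = a / s].
Proof.
move=> xl; rewrite (residueE xl) -(rmorph0 f).
have -> : f (LocalRing xl) = f 0 <-> (LocalRing xl \in @local_max K p).
  rewrite -[X in X \in _]subr0 Quotient.idealrBE.
  by split=> /eqP.
by split=> [/local_maxP//|h]; apply/local_maxP.
Qed.

Lemma residue_eq0_int x : integer x -> residue p x = 0 <-> p x.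
Proof.
move=> xi; rewrite residue_eq0; last exact: local_int.
split=> [[a [s [pa si ps e]]]|px]; last first.
  by exists x, 1; split; rewrite ?divr1 //; [exact: integer1|exact: prime_1].
have /(prime_prime xi si)[]// : p (x * s) by rewrite e divfK ?(prime_nz ps).
Qed.

Lemma residue_inv_local x : x \in loc -> residue p x != 0 -> x^-1 \in loc.
Proof.
move=> xl /eqP nx; case/local_predP: (xl) => a [s [ai si ps e]].
apply/local_predP; exists s, a; split=> //; last by rewrite e invf_div.
by move=> pa; apply: nx; apply/(residue_eq0 xl); exists a, s.
Qed.

Lemma residue_unit x : x != 0 -> x \in loc -> x^-1 \in loc -> residue p x != 0.
Proof.
move=> x0 xl xVl; apply/eqP => e; move: (residueM xl xVl).
by rewrite e mul0r mulfV // residue1 => /eqP; rewrite oner_eq0.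
Qed.

Lemma residueV x : x \in loc -> residue p x != 0 -> residue p x^-1 = (residue p x)^-1.
Proof.
move=> xl nx; have xVl := residue_inv_local xl nx.
have x0 : x != 0 by apply: contra nx => /eqP ->; rewrite residue0.
by apply: (mulfI nx); rewrite -residueM // !mulfV // residue1.
Qed.

Lemma residue_surj z : exists2 x, x \in loc & residue p x = z.
Proof.
exists (val (repr z)); first exact: valP.
rewrite (residueE (valP _)) -[RHS]reprK; congr (f _); exact: val_inj.
Qed.

Lemma residue_nat_eq0 n : ((n%:R : residue_field p) == 0) <-> p n%:R.
Proof.
by rewrite -residue_eq0_int ?residue_nat; [split=> /eqP|exact: integer_nat].
Qed.

End Local.
End Integers.

(** * Primes of a number field *)

Section FiniteQuotient.
Variables (K : fieldExtType rat) (l : nat) (S : K -> Prop).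
Hypothesis l_prime : prime l.
Hypothesis S0 : S 0.
Hypothesis SB : forall x y, S x -> S y -> S (x - y).

Let SN x : S x -> S (- x).
Proof. by move=> Sx; rewrite -sub0r; apply: SB. Qed.
Let SD x y : S x -> S y -> S (x + y).
Proof. by move=> Sx Sy; rewrite -[y]opprK; apply/SB/SN. Qed.
Let SMn x n : S x -> S (n%:R * x).
Proof.
move=> Sx; elim: n => [|n IH]; first by rewrite mul0r.
by rewrite -natr1 mulrDl mul1r; apply: SD.
Qed.
Let SMz x (z : int) : S x -> S (z%:~R * x).
Proof.
case: z => n Sx; first exact: SMn.
by rewrite NegzE mulrNz mulNr; apply/SN/SMn.
Qed.
Let Ssum m (F : 'I_m -> K) : (forall i, S (F i)) -> S (\sum_i F i).
Proof. by move=> SF; elim/big_ind: _ => // x y; apply: SD. Qed.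

Let lz : (l%:Z != 0) := lt0n_neq0 (prime_gt0 l_prime).

Let indep m (xs : 'I_m -> K) : Prop := (forall i, S (xs i)) /\
  forall c : 'I_m -> int, (exists2 s, S s & \sum_i (c i)%:~R * xs i = l%:R * s) ->
    forall i, (l %| c i)%Z.

Let indep_dim m (xs : 'I_m -> K) : indep xs -> (m <= \dim {:K})%N.
Proof.
move=> [Sxs ind]; rewrite leqNgt; apply/negP => dim_lt.
pose X := [tuple xs i | i < m].
have /negP : ~~ free X.
  by apply: contraTN dim_lt => /eqP fX; rewrite -leqNgt -[leqLHS](size_tuple X) -fX dimvS ?subvf.
apply; apply/freeP => k k0.
pose D := \prod_j denq (k j).
have D0 : D != 0 by apply/prodf_neq0 => j _; apply: denq_neq0.
pose c i := numq (k i) * \prod_(j | j != i) denq (k j).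
have cE i : (c i)%:~R = k i * D%:~R :> rat.
  rewrite /D (bigD1 i) //= /c !intrM mulrA; congr (_ * _).
  by rewrite -[X in _ = X * _]divq_num_den divfK // intr_eq0 denq_neq0.
have dvd N : forall c' : 'I_m -> int, \sum_i (c' i)%:~R * xs i = 0 ->
    forall i, ((l ^ N)%N %| c' i)%Z.
  elim: N => [|N IH] c' c0 i; first by rewrite expn0 dvd1z.
  have dvd1 : forall i, (l %| c' i)%Z.
    by apply: ind; exists 0; rewrite ?mulr0.
  pose c'' i := (c' i %/ l)%Z.
  have c''E j : c' j = c'' j * l by rewrite divzK.
  rewrite c''E expnSr PoszM dvdz_mul ?dvdzz // IH //.
  have l0 : (l%:R : K) != 0 by rewrite natr_number_eq0 -lt0n prime_gt0.
  apply: (mulIf l0); rewrite mul0r -[RHS]c0 mulr_suml; apply: eq_bigr => j _.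
  by rewrite (c''E j) intrM mulrAC.
have c0 i : c i = 0.
  have /(dvd `|c i|%N)/(_ i) : \sum_i (c i)%:~R * xs i = 0.
    transitivity ((D%:~R : rat) *: \sum_i k i *: X`_i); last by rewrite k0 scaler0.
    rewrite scaler_sumr; apply: eq_bigr => j _.
    rewrite scalerA -[D%:~R * _]mulrC -cE (nth_mktuple _ _ j) scaler_int.
    by rewrite mulrzl.
  apply: contraTeq; rewrite -absz_gt0 => c_gt0; rewrite dvdzE /=.
  by apply/negP => /(dvdn_leq c_gt0); rewrite leqNgt ltn_expl ?prime_gt1.
move=> i; apply/eqP; have /eqP := cE i.
by rewrite c0 eq_sym mulf_eq0 intr_eq0 (negPf D0) orbF.
Qed.

(** A family in S that is linearly independent modulo l has at most [K : Q] elements,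
    since a rational relation can be made integral and primitive; a maximal one spans
    S modulo l. *)
Lemma finite_quotient : exists r : seq K, (forall y, y \in r -> S y) /\
  forall x, S x -> exists2 y, y \in r & exists2 s, S s & x - y = l%:R * s.
Proof.
pose P m := `[< exists xs : 'I_m -> K, indep xs >].
have exP : exists m, P m.
  by exists 0%N; apply/asboolP; exists (fun=> 0); split=> [[]|? _ []].
have Pb m : P m -> (m <= \dim {:K})%N by move=> /asboolP[xs]; apply: indep_dim.
case: (ex_maxnP exP Pb) => m /asboolP[xs [Sxs ind]] max.
pose lin (g : {ffun 'I_m -> 'I_l}) : K := \sum_i (g i)%:R * xs i.
exists [seq lin g | g : {ffun 'I_m -> 'I_l}]; split.
  by move=> _ /mapP[g _ ->]; apply: Ssum => i; apply: SMn.
move=> x Sx.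
pose xs' (i : 'I_m.+1) := if unlift ord0 i is Some j then xs j else x.
have : ~ indep xs'.
  by move=> h; have := max m.+1 (asboolT (ex_intro _ xs' h)); rewrite ltnn.
move=> /not_andP[[]|/existsNP[c /not_implyP[[s Ss]]]].
  by move=> i; rewrite /xs'; case: unliftP.
rewrite big_ord_recl {1}/xs' unlift_none => e /existsNP[i0 ni0].
have {}e : (c ord0)%:~R * x + \sum_i (c (lift ord0 i))%:~R * xs i = l%:R * s.
  by rewrite -e; congr (_ + _); apply: eq_bigr => i _; rewrite /xs' liftK.
have nc0 : ~~ (l %| c ord0)%Z.
  apply/negP => /dvdzP[z ez]; apply: ni0.
  have ind' : forall i, (l %| c (lift ord0 i))%Z.
    apply: ind; exists (s - z%:~R * x); first exact/SB/SMz.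
    move: e => /(canRL (addKr _)) ->.
    by rewrite ez intrM -[l%:Z%:~R]/(l%:R : K); ring.
  by case: (unliftP ord0 i0) => [j ->|->]; [exact: ind'|rewrite ez dvdz_mull].
have cop : coprimez (c ord0) l.
  by rewrite coprimezE coprime_sym prime_coprime // -dvdzE.
have [[u v] /= uv] : exists uv : int * int, uv.1 * c ord0 + uv.2 * l = 1.
  have [u [v e1]] := Bezoutz (c ord0) l; exists (u, v) => /=.
  by move: cop; rewrite /coprimez e1 => /eqP.
pose g i := ((- u * c (lift ord0 i)) %% l)%Z.
pose q i := ((- u * c (lift ord0 i)) %/ l)%Z.
have g_ge0 i : (0 <= g i)%R by apply: modz_ge0.
have g_lt i : (`|g i| < l)%N.
  by rewrite -ltz_nat gez0_abs // ltz_pmod // ltz_nat prime_gt0.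
exists (lin [ffun i => Ordinal (g_lt i)]).
  by apply/mapP; exists [ffun i => Ordinal (g_lt i)]; rewrite ?mem_enum.
exists (u%:~R * s + v%:~R * x + \sum_i (q i)%:~R * xs i).
  apply: SD; first by apply: SD; apply: SMz.
  by apply: Ssum => i; apply: SMz.
have gq i : (g i)%:~R = (- u * c (lift ord0 i))%:~R - (q i)%:~R * l%:R :> K.
  have := divz_eq (- u * c (lift ord0 i)) l; rewrite -/(q i) -/(g i).
  move: (g i) (q i) => gi qi ->; rewrite intrD intrM -[l%:Z%:~R]/(l%:R : K).
  by ring.
have linE : lin [ffun i => Ordinal (g_lt i)] =
    - u%:~R * \sum_i (c (lift ord0 i))%:~R * xs i - l%:R * \sum_i (q i)%:~R * xs i.
  rewrite /lin !mulr_sumr -sumrB; apply: eq_bigr => i _; rewrite ffunE /=.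
  have -> : (`|g i|%N)%:R = (g i)%:~R :> K by rewrite -[LHS]/((`|g i|%N)%:Z%:~R) gez0_abs.
  by rewrite gq intrM mulrNz; ring.
have xE : x = u%:~R * ((c ord0)%:~R * x) + v%:~R * l%:R * x.
  by rewrite mulrA -intrM -[l%:R]/(l%:Z%:~R : K) -intrM -mulrDl -intrD uv mul1r.
rewrite linE {1}xE; move: e => /(canRL (addrK _)) ->; ring.
Qed.
End FiniteQuotient.

Section Primes.
Variable K : fieldExtType rat.
Implicit Types (p : prime_of K) (n l : nat).

Lemma prime_ext (p q : prime_of K) : (forall x, p x <-> q x) -> p = q.
Proof.
move=> pq; have : prime_set p = prime_set q by apply/funext => x; apply/propext.
case: p {pq} => P pi p0 pD pM p1 pp pn; case: q => Q qi q0 qD qM q1 qp qn /= PQ.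
subst Q; congr PrimeOf; exact: Prop_irrelevance.
Qed.

Lemma prime_sub p x y : p x -> p y -> p (x - y).
Proof.
move=> px py; apply: prime_add => //; rewrite -mulN1r; apply: prime_mul => //.
by rewrite -sub0r; apply: integerB; [exact: integer0|exact: integer1].
Qed.

Lemma prime_coprime_nat p l n : p l%:R -> coprime l n -> ~ p n%:R.
Proof.
case: l => [|l] pl co pn.
  by move: co; rewrite /coprime gcd0n => /eqP n1; apply: (@prime_1 _ p); rewrite n1 in pn.
have [u v e _] := egcdnP n (ltn0Sn l).
move: e; rewrite (eqP co) => e; apply: (@prime_1 _ p).
have -> : (1 : K) = u%:R * l.+1%:R - v%:R * n%:R.
  by rewrite -!natrM e natrD addrC addKr.
by apply: prime_sub; apply: prime_mul => //; exact: integer_nat.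
Qed.

Lemma prime_divisor p n : (0 < n)%N -> p n%:R -> exists2 l, prime l & (l %| n)%N /\ p l%:R.
Proof.
elim/ltn_ind: n => n IH n_gt0 pn.
have [n1|n_gt1] := leqP n 1.
  by move: pn; have -> : n = 1%N by [apply/eqP; rewrite eqn_leq n1 n_gt0]; move=> /prime_1.
have ln := pdiv_dvd n; move: pn; rewrite -{1}(divnK ln) natrM.
move=> /prime_prime[]; [exact: integer_nat|exact: integer_nat| |].
  move=> /IH[].
  - by rewrite ltn_Pdiv ?prime_gt1 ?pdiv_prime.
  - by rewrite divn_gt0 ?pdiv_gt0 // dvdn_leq.
  - by move=> l lp [ll pl]; exists l => //; split=> //; exact: dvdn_trans ll (dvdn_div ln).
by exists (pdiv n); rewrite ?pdiv_prime.
Qed.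

Lemma prime_contains_nat p : exists2 n, (0 < n)%N & p n%:R.
Proof.
have [x px x0] := prime_neq0 p; have [n n_gt0 xn] := integer_denom x^-1.
exists n => //; have -> : n%:R = (x^-1 * n%:R) * x by field.
exact: prime_mul.
Qed.

(** Residues are represented by the local ring modulo a prime number lying in p. *)
Lemma residue_field_finite p : finite_set [set: residue_field p].
Proof.
have [n n_gt0 pn] := prime_contains_nat p.
have [l lp [_ pl]] := prime_divisor n_gt0 pn.
have SB x y : x \in local_pred p -> y \in local_pred p -> x - y \in local_pred p.
  exact: rpredB.
have [r [rS cover]] := finite_quotient lp (rpred0 (local_pred p)) SB.
apply: (@sub_finite_set _ _ (residue p @` [set` r])); last first.
  exact/finite_image/finite_seq.
move=> z _; have [x xl <-] := residue_surj z; have [y yr [s sl e]] := cover x xl.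
exists y => //; have -> : x = l%:R * s + y by rewrite -e subrK.
have ll : l%:R \in local_pred p by apply: rpred_nat.
have ls : l%:R * s \in local_pred p by apply: rpredM.
rewrite (residueD ls (rS _ yr)) (residueM ll sl) residue_nat.
by have /residue_nat_eq0/eqP -> := pl; rewrite mul0r add0r.
Qed.

Let integer_cover l (l_prime : prime l) :=
  finite_quotient l_prime (integer0 K) (@integerB K).

(** A prime containing l is determined by its trace on finitely many representatives
    modulo l. *)
Lemma finite_primes_over_prime l : prime l -> finite_set [set p : prime_of K | p l%:R].
Proof.
move=> lp; have [r [rS cover]] := integer_cover lp.
pose f (p : prime_of K) := [set i : 'I_(size r) | `[< p r`_i >]]%SET.
have finj : {in [set p : prime_of K | p l%:R] &, injective f}.
  suff sub (p q : prime_of K) : p l%:R -> q l%:R -> f p = f q -> forall x, p x -> q x.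
    move=> p q /set_mem pl /set_mem ql e; apply: prime_ext => x.
    by split; apply: sub.
  move=> pl ql e x px; have [y yr [s si xy]] := cover x (prime_integer px).
  have -> : x = s * l%:R + y by rewrite mulrC -xy subrK.
  apply: prime_add; first exact: prime_mul.
  have py : p y.
    have -> : y = x - s * l%:R by rewrite mulrC -xy opprB addrC subrK.
    by apply: prime_sub => //; apply: prime_mul.
  have ir : (index y r < size r)%N by rewrite index_mem.
  have : Ordinal ir \in f p by rewrite inE /= nth_index //; apply/asboolP.
  by rewrite e inE /= nth_index // => /asboolP.
rewrite -(eq_finite_set (inj_card_eq finj)); exact: finite_finset.
Qed.

Lemma finite_primes_over n : (0 < n)%N -> finite_set [set p : prime_of K | p n%:R].
Proof.
move=> n_gt0.
apply: (@sub_finite_set _ _ (\bigcup_(l in [set` primes n]) [set p : prime_of K | p l%:R])).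
  move=> p /= pn; have [l lp [ln pl]] := prime_divisor n_gt0 pn.
  by exists l => //=; rewrite mem_primes lp n_gt0.
apply: bigcup_finite; first exact: finite_seq.
by move=> l /=; rewrite mem_primes => /and3P[lp _ _]; apply: finite_primes_over_prime.
Qed.

(** Clearing denominators in a monic equation for 1 / l shows that l divides 1. *)
Lemma not_integer_inv l : prime l -> ~ integer (l%:R^-1 : K).
Proof.
move=> lp [q qm qr].
have l0 : (l%:R : K) != 0 by rewrite natr_number_eq0 -lt0n prime_gt0.
pose m := (size q).-1.
have sq : size q = m.+1 by rewrite prednK // size_poly_gt0 monic_neq0.
have inj : injective (intr : int -> K).
  move=> u v /= /eqP; rewrite -subr_eq0 -intrB -(rmorph_int (in_alg K)) fmorph_eq0.
  by rewrite intr_eq0 subr_eq0 => /eqP.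
have int0 : (intr 0 : K) = 0 by exact: mulr0z.
have e : \sum_(i < m.+1) q`_i * l%:Z ^+ (m - i) = 0.
  apply: (inj); rewrite rmorph_sum mulr0z.
  transitivity ((l%:R : K) ^+ m * (map_poly intr q).[l%:R^-1]); last first.
    by rewrite (rootP qr) mulr0.
  rewrite horner_coef (size_map_inj_poly inj int0) sq mulr_sumr; apply: eq_bigr => i _.
  rewrite (coef_map_id0 q i int0) rmorphM rmorphXn /= mulrCA; congr (_ * _).
  by rewrite -[l%:~R]/(l%:R : K) exprB ?unitfE // -?exprVn // -ltnS.
move: e; rewrite big_ord_recr /= subnn expr0 mulr1.
have -> : q`_m = 1 by move: qm; rewrite monicE => /eqP.
move=> /(canRL (addrK _)) e.
have : (l %| (0 - 1 : int)%R)%Z.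
  rewrite -e; apply: rpred_sum => i _.
  by rewrite dvdz_mull // dvdz_exp // subn_gt0.
by rewrite dvdzE /= dvdn1 => /eqP l1; rewrite l1 in lp.
Qed.

(** A maximal ideal over l can be chosen among finitely many candidates, an ideal
    containing l being determined by its trace on a finite set of representatives. *)
Lemma exists_prime_over l : prime l -> exists p : prime_of K, p l%:R.
Proof.
move=> lp; have [r [rS cover]] := integer_cover lp.
pose proper (I : K -> Prop) := [/\ forall x, I x -> integer x,
  forall x y, I x -> I y -> I (x + y), forall x y, integer x -> I y -> I (x * y),
  I l%:R & ~ I 1].
pose f (I : K -> Prop) := [set i : 'I_(size r) | `[< I r`_i >]]%SET.
pose P n := `[< exists I, proper I /\ #|f I| = n >].
have exP : exists n, P n.
  pose I0 (x : K) := exists2 s, integer s & x = l%:R * s.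
  exists #|f I0|; apply/asboolP; exists I0; split=> //; split.
  - by move=> _ [s si ->]; apply: integerM => //; exact: integer_nat.
  - by move=> _ _ [s si ->] [t ti ->]; exists (s + t); [exact: integerD|rewrite mulrDr].
  - by move=> x _ xi [t ti ->]; exists (x * t); [exact: integerM|rewrite mulrCA].
  - by exists 1; [exact: integer1|rewrite mulr1].
  - move=> [s si e]; apply: (not_integer_inv lp).
    have l0 : (l%:R : K) != 0 by rewrite natr_number_eq0 -lt0n prime_gt0.
    by have -> : l%:R^-1 = s by apply: (mulfI l0); rewrite mulfV.
have Pb n : P n -> (n <= #|{: 'I_(size r)}|)%N.
  by move=> /asboolP[I [_ <-]]; apply: max_card.
case: (ex_maxnP exP Pb) => n /asboolP[I [[Ii ID IM Il I1] fI]] max.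
have IN x : I x -> I (- x).
  move=> Ix; rewrite -mulN1r; apply: IM => //.
  by rewrite -sub0r; apply: integerB; [exact: integer0|exact: integer1].
have maximal J : proper J -> (forall x, I x -> J x) -> forall x, J x -> I x.
  move=> pJ IJ x Jx; have [Ji JD JM Jl J1] := pJ.
  have sub : f I \subset f J.
    by apply/fintype.subsetP => i; rewrite inE => /asboolP h; rewrite inE; apply/asboolP; exact: IJ.
  have efJ : f I = f J.
    apply/eqP; rewrite eqEcard sub fI; apply: max.
    by apply/asboolP; exists J.
  have [y yr [s si xy]] := cover x (Ji x Jx).
  have ls : I (l%:R * s) by rewrite mulrC; apply: IM.
  have Jy : J y.
    have -> : y = x + (- s) * l%:R by rewrite mulNr [s * _]mulrC -xy opprB addrC subrK.
    apply: JD => //; apply: JM => //.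
    by rewrite -sub0r; apply: integerB => //; exact: integer0.
  have ir : (index y r < size r)%N by rewrite index_mem.
  have : Ordinal ir \in f J by rewrite inE /= nth_index //; apply/asboolP.
  rewrite -efJ inE /= nth_index // => /asboolP Iy.
  have -> : x = l%:R * s + y by rewrite -xy subrK.
  exact: (ID _ _ ls Iy).
have I0 : I 0 by rewrite -(subrr (l%:R)); apply: ID => //; apply: IN.
have Iprime x y : integer x -> integer y -> I (x * y) -> I x \/ I y.
  move=> xi yi Ixy; have [Ix|nIx] := pselect (I x); [by left|right].
  pose J z := exists2 u, I u & exists2 t, integer t & z = u + t * x.
  have IJ z : I z -> J z.
    by move=> Iz; exists z => //; exists 0; [exact: integer0|rewrite mul0r addr0].
  have Jx : J x by exists 0 => //; exists 1; [exact: integer1|rewrite add0r mul1r].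
  have [J1|J1] := pselect (J 1); last first.
    case: nIx; apply: (maximal J) => //; split=> //.
    - by move=> _ [u Iu [t ti ->]]; apply: integerD; [exact: Ii|exact: integerM].
    - move=> _ _ [u Iu [t ti ->]] [u' Iu' [t' ti' ->]].
      exists (u + u'); first exact: ID.
      by exists (t + t'); [exact: integerD|ring].
    - move=> z _ zi [u Iu [t ti ->]]; exists (z * u); first exact: IM.
      by exists (z * t); [exact: integerM|ring].
    - exact: IJ.
  have [u Iu [t ti e]] := J1.
  have -> : y = y * u + t * (x * y) by rewrite -[LHS]mulr1 e; ring.
  by apply: ID; apply: IM.
have Ineq0 : exists2 x, I x & x != 0.
  by exists l%:R => //; rewrite natr_number_eq0 -lt0n prime_gt0.
by exists (PrimeOf Ii I0 ID IM I1 Iprime Ineq0).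
Qed.

Lemma local_cofinite (x : K) :
  exists2 n, (0 < n)%N & forall p, ~ p n%:R -> x \in local_pred p.
Proof.
have [n n_gt0 xn] := integer_denom x; exists n => // p pn; exact: local_denom pn.
Qed.
End Primes.

(** * Reduction at almost all primes *)

Ltac solve_local :=
  lazymatch goal with
  | |- is_true (_ + _ \in _) => apply: rpredD; solve_local
  | |- is_true (- _ \in _) => rewrite rpredN; solve_local
  | |- is_true (_ * _ \in _) => apply: rpredM; solve_local
  | |- is_true (_ ^+ _ \in _) => apply: rpredX; solve_local
  | |- is_true (_%:R \in _) => exact: rpred_nat
  | |- is_true (0 \in _) => exact: rpred0
  | |- is_true (1 \in _) => exact: rpred1
  | |- _ => done
  end.

Section LocalReduction.
Variables (K : fieldExtType rat) (p : prime_of K).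
Local Notation loc := (local_pred p).
Local Notation res := (residue p).

Lemma residueB x y : x \in loc -> y \in loc -> res (x - y) = res x - res y.
Proof. by move=> xl yl; rewrite residueD ?residueN ?rpredN. Qed.

Ltac push_residue := rewrite ?(residueB, residueD, residueM, residueN, residueX,
  residue_nat, residue1, residue0); try solve_local.

Lemma residue_wdisc (W : weierstrass K) : integral_model p W ->
  wdisc W \in loc /\ wdisc (reduce_curve p W) = res (wdisc W).
Proof.
case: W => a1 a2 a3 a4 a6 [/= l1 l2 l3 l4 l6].
rewrite /wdisc /wb8 /wb2 /wb4 /wb6 /= /wb2 /wb4 /wb6 /=.
by split; [solve_local|push_residue].
Qed.

Variables (a b u r s t : K).
Local Notation M := (Weierstrass 0 a 0 b 0).

Lemma reduce_change_curve : a \in loc -> b \in loc -> u \in loc -> u^-1 \in loc ->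
  u != 0 -> r \in loc -> s \in loc -> t \in loc ->
  reduce_curve p (change_curve u r s t M) =
  change_curve (res u) (res r) (res s) (res t) (Weierstrass 0 (res a) 0 (res b) 0).
Proof.
move=> al bl ul uVl u0 rl sl tl; rewrite /reduce_curve /wmap /=.
have uE : res u^-1 = (res u)^-1 by rewrite residueV // residue_unit.
rewrite -!exprVn -uE.
by congr Weierstrass; push_residue.
Qed.

Lemma reduce_change_point x y : x \in loc -> y \in loc -> u \in loc -> u^-1 \in loc ->
  u != 0 -> r \in loc -> s \in loc -> t \in loc ->
  reduce_point p (change_point u r s t (Some (x, y))) =
  change_point (res u) (res r) (res s) (res t) (Some (res x, res y)).
Proof.
move=> xl yl ul uVl u0 rl sl tl /=.
have uE : res u^-1 = (res u)^-1 by rewrite residueV // residue_unit.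
rewrite -!exprVn -uE ifT; last by apply/andP; split; solve_local.
by congr (Some (_, _)); push_residue.
Qed.

(** The discriminants of the two models force u to be a unit. As 6 is invertible, the
    coefficients a1, a3 and a2 of the new model then determine s, t and r. *)
Lemma good_model_change_integral : (2 : K)^-1 \in loc -> (3 : K)^-1 \in loc ->
  a \in loc -> b \in loc -> b != 0 -> b^-1 \in loc ->
  a ^+ 2 - 4 * b != 0 -> (a ^+ 2 - 4 * b)^-1 \in loc ->
  u != 0 -> good_model p (change_curve u r s t M) ->
  [/\ u \in loc, u^-1 \in loc, r \in loc, s \in loc & t \in loc].
Proof.
move=> l2 l3 al bl b0 bV d0 dV u0 [int ell].
have two0 : (2 : K) != 0 by rewrite natr_number_eq0.
have three0 : (3 : K) != 0 by rewrite natr_number_eq0.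
have [Wl We] := residue_wdisc int.
have eD := wdisc_change r s t u0 M.
rewrite wdisc_two_torsion_curve in eD.
have D'V : (wdisc (change_curve u r s t M))^-1 \in loc.
  by apply: residue_inv_local => //; rewrite -We.
have D0 : 16 * b ^+ 2 * (a ^+ 2 - 4 * b) != 0.
  by rewrite !mulf_neq0 ?expf_neq0 // natr_number_eq0.
have DV : (16 * b ^+ 2 * (a ^+ 2 - 4 * b))^-1 \in loc.
  have -> : (16 * b ^+ 2 * (a ^+ 2 - 4 * b))^-1 =
    (2^-1) ^+ 4 * b^-1 ^+ 2 * (a ^+ 2 - 4 * b)^-1.
    by field; rewrite b0 d0 two0 natr_number_eq0.
  by solve_local.
have D'0 : wdisc (change_curve u r s t M) != 0.
  by apply: contra D0 => /eqP e; rewrite eD e mulr0.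
have ul : u \in loc.
  apply: (@local_closed _ _ _ 11).
  have -> : u ^+ 12 = 16 * b ^+ 2 * (a ^+ 2 - 4 * b) * (wdisc (change_curve u r s t M))^-1.
    by rewrite eD mulfK.
  by solve_local.
have uVl : u^-1 \in loc.
  apply: (@local_closed _ _ _ 11).
  have -> : u^-1 ^+ 12 = (16 * b ^+ 2 * (a ^+ 2 - 4 * b))^-1 * wdisc (change_curve u r s t M).
    by rewrite eD; field; rewrite u0 D'0.
  by solve_local.
case: int => /= i1 i2 i3 _ _.
have sl : s \in loc.
  have -> : s = (0 + 2 * s) / u * u * 2^-1 by field; rewrite u0 two0.
  by apply: rpredM => //; apply: rpredM.
have tl : t \in loc.
  have -> : t = (0 + r * 0 + 2 * t) / u ^+ 3 * u ^+ 3 * 2^-1 by field; rewrite u0 two0.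
  by apply: rpredM => //; apply: rpredM => //; apply: rpredX.
have rl : r \in loc.
  have -> : r = ((a - s * 0 + 3 * r - s ^+ 2) / u ^+ 2 * u ^+ 2 - a + s ^+ 2) * 3^-1.
    by field; rewrite u0 three0.
  apply: rpredM => //; apply: rpredD; last exact: rpredX.
  by apply: rpredB => //; apply: rpredM => //; apply: rpredX.
by split.
Qed.
End LocalReduction.

Section LocallyImprimitive.
Variable K : fieldExtType rat.

Lemma local_cofinite_seq (cs : seq K) : exists2 n, (0 < n)%N &
  forall p : prime_of K, ~ p n%:R -> forall c, c \in cs -> c \in local_pred p.
Proof.
elim: cs => [|c cs [n n_gt0 IH]]; first by exists 1%N.
have [m m_gt0 H] := local_cofinite c.
exists (m * n)%N; first by rewrite muln_gt0 m_gt0.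
move=> p pn e; rewrite inE => /orP[/eqP ->|].
  apply: H => pm; apply: pn; rewrite natrM mulrC.
  by apply: prime_mul => //; exact: integer_nat.
apply: IH => pm; apply: pn; rewrite natrM.
by apply: prime_mul => //; exact: integer_nat.
Qed.

(** At a prime where 6 and the data of the curve and of the point are units, the
    reduction of the point in any good model is the image of a point with square
    x-coordinate, hence generates a subgroup of even index. *)
Lemma locally_imprimitive_square (a b r0 z y : K) :
  b != 0 -> a ^+ 2 - 4 * b != 0 -> z != 0 ->
  rational_points (Weierstrass 0 a 0 b 0) (Some (z ^+ 2, y)) ->
  locally_imprimitive 2 (change_curve 1 r0 0 0 (Weierstrass 0 a 0 b 0))
    (change_point 1 r0 0 0 (Some (z ^+ 2, y))).
Proof.
move=> b0 d0 z0 Pr.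
pose cs := [:: 2^-1; 3^-1; a; b; b^-1; (a ^+ 2 - 4 * b)^-1; z; z^-1; y].
have [n n_gt0 Hn] := local_cofinite_seq cs.
apply: sub_finite_set (finite_primes_over K n_gt0) => p [_ bad].
apply: contrapT => /= pn; apply: bad => u r s t u0.
have l c : c \in cs -> c \in local_pred p by exact: Hn.
rewrite change_curve_translate // change_point_translate // => good.
have l2 : (2 : K)^-1 \in local_pred p by apply: l; rewrite !inE eqxx.
have l3 : (3 : K)^-1 \in local_pred p by apply: l; rewrite !inE eqxx ?orbT.
have al : a \in local_pred p by apply: l; rewrite !inE eqxx ?orbT.
have bl : b \in local_pred p by apply: l; rewrite !inE eqxx ?orbT.
have bVl : b^-1 \in local_pred p by apply: l; rewrite !inE eqxx ?orbT.
have dVl : (a ^+ 2 - 4 * b)^-1 \in local_pred p by apply: l; rewrite !inE eqxx ?orbT.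
have zl : z \in local_pred p by apply: l; rewrite !inE eqxx ?orbT.
have zVl : z^-1 \in local_pred p by apply: l; rewrite !inE eqxx ?orbT.
have yl : y \in local_pred p by apply: l; rewrite !inE eqxx ?orbT.
have [ul uVl rl sl tl] := good_model_change_integral l2 l3 al bl b0 bVl d0 dVl u0 good.
have dl : a ^+ 2 - 4 * b \in local_pred p by solve_local.
have z2l : z ^+ 2 \in local_pred p by solve_local.
rewrite reduce_change_curve // reduce_change_point //.
apply: even_index_square_class.
- rewrite -(residue_nat p 2); apply: residue_unit => //; last exact: rpred_nat.
  by rewrite natr_number_eq0.
- exact: residue_unit.
- have -> : residue p a ^+ 2 - 4 * residue p b = residue p (a ^+ 2 - 4 * b).
    rewrite -(residue_nat p 4) residueB ?residueM ?residueX //; solve_local.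
  exact: residue_unit.
- exact: residue_unit.
- exact: residue_field_finite.
- move: Pr; rewrite !rational_pointsE !cubicE => /(congr1 (residue p)).
  rewrite -residueX // => ->.
  by rewrite ?(residueD, residueM, residueX, residue0); try solve_local.
- rewrite /descent_class residueX // expf_eq0 /= (negPf (residue_unit z0 zl zVl)).
  exact: square_sqr.
Qed.
End LocallyImprimitive.

(** * The 2-isogeny *)

Section Forms.
Variables (K : fieldExtType rat) (L : fieldType) (iota : {rmorphism K -> L}).
Implicit Types (f g : {mpoly K[3]}) (P : curve_point L).

(** The charts are verified over an arbitrary extension field; the algebraic closure
    is an instance. *)
Definition hom_coord (P : curve_point L) : 'I_3 -> L :=
  if P is Some (x, y) then tnth [tuple x; y; 1] else tnth [tuple 0; 1; 0].

Definition hom_eval f P : L := (map_mpoly iota f).@[hom_coord P].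

Lemma hom_evalD f g P : hom_eval (f + g) P = hom_eval f P + hom_eval g P.
Proof. by rewrite /hom_eval rmorphD mevalD. Qed.
Lemma hom_evalN f P : hom_eval (- f) P = - hom_eval f P.
Proof. by rewrite /hom_eval rmorphN mevalN. Qed.
Lemma hom_evalM f g P : hom_eval (f * g) P = hom_eval f P * hom_eval g P.
Proof. by rewrite /hom_eval rmorphM mevalM. Qed.
Lemma hom_evalZ c f P : hom_eval (c *: f) P = iota c * hom_eval f P.
Proof. by rewrite /hom_eval map_mpolyZ mevalZ. Qed.
Lemma hom_evalX i P : hom_eval 'X_i P = hom_coord P i.
Proof. by rewrite /hom_eval map_mpolyX mevalXU. Qed.

Lemma homogX (i : 'I_3) : ('X_i : {mpoly K[3]}) \is 1.-homog.
Proof. by rewrite dhomogX; apply/eqP/mdeg1. Qed.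
Lemma homogXX (i j : 'I_3) : ('X_i * 'X_j : {mpoly K[3]}) \is 2.-homog.
Proof. exact: dhomogM (homogX i) (homogX j). Qed.
Lemma homogXXX (i j l : 'I_3) : ('X_i * 'X_j * 'X_l : {mpoly K[3]}) \is 3.-homog.
Proof. exact: dhomogM (homogXX i j) (homogX l). Qed.
Lemma homogD d f g : f \is d.-homog -> g \is d.-homog -> f + g \is d.-homog.
Proof. exact: rpredD. Qed.
Lemma homogB d f g : f \is d.-homog -> g \is d.-homog -> f - g \is d.-homog.
Proof. exact: rpredB. Qed.
Lemma homogZ d c f : f \is d.-homog -> c *: f \is d.-homog.
Proof. exact: rpredZ. Qed.
End Forms.

Definition two_isogeny (k : fieldType) (b' : k) (P : curve_point k) : curve_point k :=
  if P is Some (x, y) then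
    if x == 0 then None
    else Some (y ^+ 2 / (4 * x ^+ 2), y * (b' - x ^+ 2) / (8 * x ^+ 2))
  else None.

Section TwoIsogenyCharts.
Variables (K : fieldExtType rat) (L : fieldType) (iota : {rmorphism K -> L}).
Variables (a b r : K).
Hypothesis b_neq0 : b != 0.
Hypothesis d_neq0 : a ^+ 2 - 4 * b != 0.
Local Notation a' := (- (2 * a)).
Local Notation b' := (a ^+ 2 - 4 * b).
Local Notation W := (change_curve 1 r 0 0 (Weierstrass 0 a 0 b 0)).
Local Notation W' := (Weierstrass 0 a' 0 b' 0).

Definition translated_two_isogeny (Q : curve_point L) : curve_point L :=
  change_point 1 (iota r) 0 0 (two_isogeny (iota b') Q).
Local Notation phi := translated_two_isogeny.

Lemma natr_extension n : ((n%:R : L) == 0) = (n == 0%N).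
Proof. by rewrite -(rmorph_nat iota) fmorph_eq0 natr_number_eq0. Qed.

Let two0 : (2 : L) != 0. Proof. by rewrite natr_extension. Qed.
Let four0 : (4 : L) != 0. Proof. by rewrite natr_extension. Qed.
Let eight0 : (8 : L) != 0. Proof. by rewrite natr_extension. Qed.

Lemma geom_isogenous_curve :
  wmap iota W' = Weierstrass 0 (iota a') 0 (iota b') 0.
Proof. by rewrite /wmap /= !rmorph0. Qed.

Lemma geom_translated_curve :
  wmap iota W = change_curve 1 (iota r) 0 0 (Weierstrass 0 (iota a) 0 (iota b) 0).
Proof.
rewrite /wmap /change_curve /=; congr Weierstrass;
by rewrite ?(rmorphM, rmorphB, rmorphD, rmorphXn, rmorph0, fmorphV, rmorph1, rmorph_nat).
Qed.

Lemma geom_isogenous_eq x y : rational_points (wmap iota W') (Some (x, y)) ->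
  y ^+ 2 = x * (x ^+ 2 + iota a' * x + iota b').
Proof. by rewrite geom_isogenous_curve rational_pointsE cubicE => ->; ring. Qed.

Let aE : iota a' = - (2 * iota a). Proof. by rewrite rmorphN rmorphM rmorph_nat. Qed.
Let bE : iota b' = iota a ^+ 2 - 4 * iota b.
Proof. by rewrite rmorphB rmorphXn rmorphM rmorph_nat. Qed.
Let b'0 : iota b' != 0. Proof. by rewrite fmorph_eq0. Qed.

Lemma translated_two_isogenyE x y : x != 0 -> phi (Some (x, y)) =
  Some (y ^+ 2 / (4 * x ^+ 2) - iota r, y * (iota b' - x ^+ 2) / (8 * x ^+ 2)).
Proof.
move=> x0; rewrite /phi /= (negPf x0) /=; congr (Some (_, _)); rewrite ?expr1n ?divr1 //.
by rewrite mul0r !subr0.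
Qed.
Let phiE := translated_two_isogenyE.

Lemma translated_two_isogeny0 y : phi (Some (0, y)) = None.
Proof. by rewrite /phi /= eqxx. Qed.
Let phi0 := translated_two_isogeny0.

Lemma two_isogeny_maps Q : rational_points (wmap iota W') Q ->
  rational_points (wmap iota W) (phi Q).
Proof.
case: Q => [[x y]|//] /geom_isogenous_eq xy; rewrite geom_translated_curve.
have [x0|x0] := eqVneq x 0; first by rewrite x0 phi0.
rewrite /phi; apply/change_point_rational; first exact: oner_neq0.
rewrite /= (negPf x0) rational_pointsE cubicE.
move: xy; rewrite aE bE; move: (iota a) (iota b) => A B xy.
rewrite expr_div_n [(y * _) ^+ 2]exprMn xy.
by field; rewrite four0 eight0 x0.
Qed.

Definition ord3_0 : 'I_3 := @Ordinal 3 0 isT.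
Definition ord3_1 : 'I_3 := @Ordinal 3 1 isT.
Definition ord3_2 : 'I_3 := @Ordinal 3 2 isT.
Local Notation X := ('X_ord3_0 : {mpoly K[3]}).
Local Notation Y := ('X_ord3_1 : {mpoly K[3]}).
Local Notation Z := ('X_ord3_2 : {mpoly K[3]}).

(** What regularity of the isogeny asks of three forms at R. *)
Definition chart (f0 f1 f2 : {mpoly K[3]}) (R : curve_point L) : Prop :=
  [/\ hom_eval iota f0 R = 0, hom_eval iota f1 R = 0 & hom_eval iota f2 R = 0] \/
  exists c : L, [/\ c != 0, hom_eval iota f0 R = c * hom_coord (phi R) ord3_0,
     hom_eval iota f1 R = c * hom_coord (phi R) ord3_1
   & hom_eval iota f2 R = c * hom_coord (phi R) ord3_2].

Let coord_affine x y : (hom_coord (Some (x, y) : curve_point L) ord3_0 = x) *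
  (hom_coord (Some (x, y) : curve_point L) ord3_1 = y) *
  (hom_coord (Some (x, y) : curve_point L) ord3_2 = 1).
Proof. by []. Qed.
Let coord_infty : (hom_coord (None : curve_point L) ord3_0 = 0) *
  (hom_coord (None : curve_point L) ord3_1 = 1) *
  (hom_coord (None : curve_point L) ord3_2 = 0).
Proof. by []. Qed.
Let coordE := (coord_affine, coord_infty).

Let evalE := (hom_evalD, hom_evalN, hom_evalM, hom_evalZ, hom_evalX).
Let i2 : iota 2 = 2. Proof. exact: rmorph_nat. Qed.
Let i8 : iota 8 = 8. Proof. exact: rmorph_nat. Qed.
Let i8r : iota (8 * r) = 8 * iota r. Proof. by rewrite rmorphM i8. Qed.
Let i2b : iota (2 * b') = 2 * iota b'. Proof. by rewrite rmorphM i2. Qed.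

(** The triple (2 y^2 : y (b' - x^2) : 8 x^2), the defining formula of the isogeny. *)
Definition generic_x := 2 *: (Y * Y * Z) - (8 * r) *: (X * X * Z).
Definition generic_y := b' *: (Y * Z * Z) - Y * X * X.
Definition generic_z := 8 *: (X * X * Z).

Lemma chart_generic R : rational_points (wmap iota W') R ->
  chart generic_x generic_y generic_z R.
Proof.
rewrite /chart /generic_x /generic_y /generic_z.
case: R => [[u v]|] uv; last first.
  by left; rewrite !evalE !coordE; split; ring.
have e := geom_isogenous_eq uv; have [u0|u0] := eqVneq u 0.
  left; have v0 : v = 0.
    by move/eqP: e; rewrite u0 mul0r expf_eq0 => /eqP.
  by rewrite !evalE !coordE u0 v0; split; ring.
right; exists (8 * u ^+ 2); split; first by rewrite mulf_neq0 ?expf_neq0.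
all: rewrite !evalE (phiE _ u0) !coordE ?i8r ?i2 ?i8; move: (iota b') (iota r) => B r'.
all: by field; rewrite ?u0 ?eight0 ?four0.
Qed.

Lemma generic_nonzero x y : x != 0 -> hom_eval iota generic_z (Some (x, y)) != 0.
Proof. by move=> x0; rewrite /generic_z !evalE !coordE i8 mulr1 !mulf_neq0. Qed.

(** Near (0, 0), the same triple times y / x, where y^2 / x = x^2 + a' x + b'. *)
Definition kernel_q := X * X + a' *: (X * Z) + b' *: (Z * Z).
Definition kernel_x := 2 *: (Y * Z * kernel_q) - (8 * r) *: (X * Y * (Z * Z)).
Definition kernel_y := kernel_q * (b' *: (Z * Z) - X * X).
Definition kernel_z := 8 *: (X * Y * (Z * Z)).

Lemma chart_kernel R : rational_points (wmap iota W') R ->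
  chart kernel_x kernel_y kernel_z R.
Proof.
rewrite /chart /kernel_x /kernel_y /kernel_z.
case: R => [[u v]|] uv; last first.
  by left; rewrite /kernel_q !evalE !coordE; split; ring.
have e := geom_isogenous_eq uv; have [u0|u0] := eqVneq u 0.
  have v0 : v = 0.
    by move/eqP: e; rewrite u0 mul0r expf_eq0 => /eqP.
  right; exists (iota b' ^+ 2); rewrite u0 v0 phi0 /kernel_q !evalE !coordE.
  by split; rewrite ?expf_neq0 //; ring.
have qE : hom_eval iota kernel_q (Some (u, v)) = u ^+ 2 + iota a' * u + iota b'.
  by rewrite /kernel_q !evalE !coordE; ring.
move: kernel_q qE => q qE.
have [v0|v0] := eqVneq v 0.
  have q0 : u ^+ 2 + iota a' * u + iota b' = 0.
    by apply: (mulfI u0); rewrite -e v0 mulr0 expr0n.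
  by left; rewrite !evalE qE q0 v0 !coordE; split; ring.
have qE2 : hom_eval iota q (Some (u, v)) = v ^+ 2 / u.
  by rewrite qE e mulrAC mulfV ?mul1r.
right; exists (8 * (u * v)); split; first by rewrite !mulf_neq0.
all: rewrite !evalE ?qE2 (phiE _ u0) !coordE ?i8r ?i2 ?i8; move: (iota b') (iota r) => B r'.
all: by field; rewrite ?u0 ?eight0 ?four0.
Qed.

Lemma kernel_nonzero : hom_eval iota kernel_y (Some (0, 0)) != 0.
Proof.
rewrite /kernel_y /kernel_q !evalE !coordE.
by rewrite !(mulr0, mul0r, addr0, add0r, mulr1, subr0) mulf_neq0.
Qed.

(** Near infinity, the first triple divided by z / x = x^2 / (y^2 - a' x^2 - b' x z),
    an equality that is the homogeneous equation of the curve. *)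
Definition infty_x := 2 *: (X * Y * Y) - (8 * r) *: (X * X * X).
Definition infty_y := Y * ((2 * b') *: (X * Z) - Y * Y + a' *: (X * X)).
Definition infty_z := 8 *: (X * X * X).

Lemma chart_infty R : rational_points (wmap iota W') R ->
  chart infty_x infty_y infty_z R.
Proof.
rewrite /chart /infty_x /infty_y /infty_z.
case: R => [[u v]|] uv; last first.
  right; exists (- 1); rewrite oppr_eq0 oner_eq0 !evalE !coordE.
  by split=> //; ring.
have e := geom_isogenous_eq uv; have [u0|u0] := eqVneq u 0.
  left; have v0 : v = 0.
    by move/eqP: e; rewrite u0 mul0r expf_eq0 => /eqP.
  by rewrite !evalE !coordE u0 v0; split; ring.
right; exists (8 * u ^+ 3); rewrite !evalE (phiE _ u0) !coordE ?i8r ?i2 ?i8 ?i2b.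
split; first by rewrite mulf_neq0 ?expf_neq0.
- by move: (iota r) => r'; field; rewrite ?u0 ?eight0 ?four0.
- rewrite -expr2 e; move: (iota a') (iota b') => A B.
  by field; rewrite ?u0 ?eight0 ?four0.
- by ring.
Qed.

Lemma infty_nonzero : hom_eval iota infty_y None != 0.
Proof.
rewrite (_ : hom_eval iota infty_y None = - 1) ?oppr_eq0 ?oner_eq0 //.
by rewrite /infty_y !evalE !coordE; ring.
Qed.
End TwoIsogenyCharts.

Section TwoIsogeny.
Variables (K : fieldExtType rat) (a b r : K).
Hypothesis b_neq0 : b != 0.
Hypothesis d_neq0 : a ^+ 2 - 4 * b != 0.
Local Notation Kbar := (alg_closure K).
Local Notation iota := (to_closure K).
Local Notation a' := (- (2 * a)).
Local Notation b' := (a ^+ 2 - 4 * b).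
Local Notation W := (change_curve 1 r 0 0 (Weierstrass 0 a 0 b 0)).
Local Notation W' := (Weierstrass 0 a' 0 b' 0).
Local Notation phi := (translated_two_isogeny iota a b r).

Let triple T (u v w : T) (i : 'I_3) : T := tnth [tuple u; v; w] i.

Let triple_forall T (u v w : T) (P : T -> Prop) : P u -> P v -> P w ->
  forall i, P (triple u v w i).
Proof. by move=> Pu Pv Pw [[|[|[|]]]]. Qed.

Let regular_chart d f0 f1 f2 Q :
  f0 \is d.-homog -> f1 \is d.-homog -> f2 \is d.-homog ->
  [\/ hom_eval iota f0 Q != 0, hom_eval iota f1 Q != 0 | hom_eval iota f2 Q != 0] ->
  (forall R, rational_points (wmap iota W') R -> chart iota a b r f0 f1 f2 R) ->
  regular_at W' phi Q.
Proof.
move=> h0 h1 h2 nQ ch; exists d, (triple f0 f1 f2); split.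
- exact: (triple_forall (P := fun f => f \is d.-homog)).
- by case: nQ; [exists ord3_0|exists ord3_1|exists ord3_2].
- move=> R /ch[[e0 e1 e2] [i]|[c [c0 e0 e1 e2]] _].
    suff : form_eval (triple f0 f1 f2 i) R = 0 by move=> ->; rewrite eqxx.
    by move: i; apply: (triple_forall (P := fun f => form_eval f R = 0)).
  have ordE (i j : 'I_3) : val i = val j -> hcoord (phi R) i = hcoord (phi R) j.
    by move=> /val_inj ->.
  exists c; split=> // -[[|[|[|//]]] lti]; rewrite /triple (tnth_nth 0) /=.
  + by rewrite (ordE _ ord3_0).
  + by rewrite (ordE _ ord3_1).
  + by rewrite (ordE _ ord3_2).
Qed.

Lemma two_isogeny_regular Q : rational_points (geom_curve W') Q ->
  regular_at W' phi Q.
Proof.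
case: Q => [[x y]|] xyr; last first.
  apply: (@regular_chart 3 (infty_x r) (infty_y a b) (infty_z K)).
  - by apply: homogB; apply: homogZ; exact: homogXXX.
  - apply: (dhomogM (d := 1) (e := 2)); first exact: homogX.
    by apply: homogD; [apply: homogB|]; try apply: homogZ; exact: homogXX.
  - by apply: homogZ; exact: homogXXX.
  - by apply: Or32; exact: infty_nonzero.
  - by move=> R; apply: chart_infty.
have [x0|x0] := eqVneq x 0; last first.
  apply: (@regular_chart 3 (generic_x r) (generic_y a b) (generic_z K)).
  - by apply: homogB; apply: homogZ; exact: homogXXX.
  - by apply: homogB; [apply: homogZ|]; exact: homogXXX.
  - by apply: homogZ; exact: homogXXX.
  - by apply: Or33; exact: generic_nonzero.
  - by move=> R; apply: chart_generic.
have qh : kernel_q a b \is 2.-homog.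
  by apply: homogD; [apply: homogD|]; try apply: homogZ; exact: homogXX.
move: xyr (geom_isogenous_eq xyr); rewrite x0 mul0r => _ /eqP; rewrite expf_eq0 => /eqP ->.
apply: (@regular_chart 4 (kernel_x a b r) (kernel_y a b) (kernel_z K)).
- by apply: homogB; apply: homogZ; apply: (dhomogM (d := 2) (e := 2)) => //; exact: homogXX.
- apply: (dhomogM (d := 2) (e := 2)) => //; apply: homogB; last exact: homogXX.
  by apply: homogZ; exact: homogXX.
- by apply: homogZ; apply: (dhomogM (d := 2) (e := 2)); exact: homogXX.
- by apply: Or32; exact: kernel_nonzero.
- by move=> R; apply: chart_kernel.
Qed.

Lemma two_isogeny_isogeny : isogeny W' W phi.
Proof.
split.
- by move=> Q; apply: two_isogeny_maps.
- by move=> Q; apply: two_isogeny_regular.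
- by [].
- pose c := 1 + iota a' + iota b'.
  have /closed_rootP[y] : size ('X^2 - c%:P : {poly Kbar}) != 1%N by rewrite size_XnsubC.
  rewrite /root !hornerE subr_eq0 => /eqP yc; exists (Some (1, y)); last first.
    by rewrite translated_two_isogenyE ?oner_neq0.
  rewrite /geom_curve geom_isogenous_curve rational_pointsE cubicE yc /c.
  by rewrite !expr1n !mulr1 addr0.
Qed.

Let T : curve_point K := Some (0, 0).

Let T_order2 : point_of_order2 W' T.
Proof.
split=> //; first by rewrite rational_pointsE cubicE; ring.
by rewrite /point_muln /= eqxx !mul0r !addr0 eqxx.
Qed.

Lemma two_isogeny_kernel :
  isogeny_kernel W' phi = cyclic_subgroup (geom_curve W') (geom_point T).
Proof.
have gT : geom_point T = Some (0, 0) by rewrite /geom_point /pmap_point /= !rmorph0.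
rewrite gT; apply/seteqP; split=> [[[x y]|] [Qr]|].
- have [x0 _|x0 /=] := eqVneq x 0; last by rewrite translated_two_isogenyE.
  exists 1%Z => //=; rewrite /point_muln /=.
  by move: (geom_isogenous_eq Qr); rewrite x0 mul0r => /eqP; rewrite expf_eq0 => /eqP ->.
- by exists 0%Z.
have mulT n : point_muln (geom_curve W') n (Some (0, 0)) = None \/
    point_muln (geom_curve W') n (Some (0, 0)) = Some (0, 0).
  elim: n => [|n IH]; first by left.
  rewrite /point_muln iterS -/(point_muln _ _ _) in IH *.
  case: IH => ->; first by right.
  by left; rewrite /geom_curve geom_isogenous_curve /= eqxx !mul0r !addr0 eqxx.
have inker Q : Q = None \/ Q = Some (0, 0) -> isogeny_kernel W' phi Q.
  case=> ->; split=> //; last exact: translated_two_isogeny0.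
  rewrite /geom_curve geom_isogenous_curve rational_pointsE cubicE.
  by rewrite !expr0n /= !mulr0 !addr0.
move=> _ [[n|n] _ <-]; first by apply: inker; exact: mulT.
apply: inker; rewrite /point_mulz; case: (mulT n.+1) => ->; [by left|right].
by rewrite /geom_curve geom_isogenous_curve point_oppE oppr0.
Qed.

Lemma condC_two_isogeny x y : x != 0 -> rational_points W' (Some (x, y)) ->
  condC W (change_point 1 r 0 0 (two_isogeny b' (Some (x, y)))).
Proof.
move=> x0 Qr; exists W', phi; split.
- rewrite /elliptic wdisc_two_torsion_curve.
  have -> : (- (2 * a)) ^+ 2 - 4 * b' = 16 * b by ring.
  by rewrite !mulf_neq0 ?expf_neq0 // natr_number_eq0.
- exact: two_isogeny_isogeny.
- by exists T; [exact: T_order2|exact: two_isogeny_kernel].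
- exists (Some (x, y)) => //.
  rewrite /= (negPf x0) /= /geom_point /pmap_point /= translated_two_isogenyE ?fmorph_eq0 //.
  rewrite expr1n !divr1 mul0r !subr0.
  by rewrite expr1n divr1 !(rmorphXn, rmorph_nat, fmorphV, rmorphM, rmorphB).
Qed.

(** Full 2-torsion over K would make the discriminant of x^2 + a x + b a square. *)
Lemma not_condB_nonsquare : ~ square (a ^+ 2 - 4 * b) -> ~ condB W.
Proof.
move=> nd cB; apply: nd.
have tors (L : fieldType) (A B r' y : L) : (2 : L) != 0 -> y ^+ 2 = A ^+ 2 - 4 * B ->
    two_torsion (change_curve 1 r' 0 0 (Weierstrass 0 A 0 B 0))
      (Some ((y - A) / 2 - r', 0)).
  move=> two0 yc; have four0 : (4 : L) != 0 by rewrite (natrM _ 2 2) mulf_neq0.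
  split.
    have -> : Some ((y - A) / 2 - r', 0) = change_point 1 r' 0 0 (Some ((y - A) / 2, 0)).
      by rewrite /= !expr1n !divr1; congr (Some (_, _)); ring.
    apply/change_point_rational; first exact: oner_neq0.
    rewrite rational_pointsE cubicE expr0n /=; set x := (y - A) / 2.
    have -> : x ^+ 3 + A * x ^+ 2 + B * x + 0 = x * (y ^+ 2 - A ^+ 2 + 4 * B) / 4.
      by rewrite /x; field; rewrite two0 four0.
    by rewrite yc (_ : _ - _ + _ = 0) ?mulr0 ?mul0r //; ring.
  rewrite /point_muln /= eqxx /=.
  by rewrite !(mulr0, mul0r, addr0, divr1) eqxx.
have halve (L : fieldType) (A r' x y : L) : (2 : L) != 0 -> x = (y - A) / 2 - r' ->
    2 * (x + r') + A = y.
  by move=> two0 ->; field.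
have /closed_rootP[y] : size ('X^2 - (iota b')%:P : {poly Kbar}) != 1%N by rewrite size_XnsubC.
rewrite /root !hornerE subr_eq0 => /eqP yc.
have two0 : (2 : Kbar) != 0 by rewrite (natr_extension iota).
have bE : iota b' = iota a ^+ 2 - 4 * iota b.
  by rewrite rmorphB rmorphXn rmorphM rmorph_nat.
have := tors Kbar (iota a) (iota b) (iota r) y two0 (etrans yc bE).
rewrite -geom_translated_curve => /cB[[[x1 y1]|//] _] [e _].
exists (2 * (x1 + r) + a); apply: (fmorph_inj iota).
by rewrite -yc rmorphXn rmorphD rmorphM rmorph_nat rmorphD (halve _ _ _ _ y two0 e).
Qed.
End TwoIsogeny.

(** * Multiples of a point *)

Section Multiples.
Variables (k : fieldType) (a b : k).
Hypothesis two_neq0 : (2 : k) != 0.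
Hypothesis b_neq0 : b != 0.
Hypothesis d_neq0 : a ^+ 2 - 4 * b != 0.
Local Notation M := (Weierstrass 0 a 0 b 0).

Lemma point_muln_rational P n : rational_points M P -> rational_points M (point_muln M n P).
Proof.
move=> Pr; elim: n => [//|n IH]; rewrite /point_muln iterS -/(point_muln _ _ _).
exact: point_add_rational.
Qed.

Lemma point_mulnD P m n : rational_points M P ->
  point_muln M (m + n) P = point_add M (point_muln M m P) (point_muln M n P).
Proof.
move=> Pr; elim: m => [//|m IH].
rewrite addSn /point_muln !iterS -!/(point_muln _ _ _) IH.
rewrite (point_addA two_neq0 (two_torsion_curve_separable b_neq0 d_neq0)) //.
- exact: point_muln_rational.
- exact: point_muln_rational.
Qed.

Lemma torsion_point_modn P n j : rational_points M P -> point_muln M n P = None ->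
  point_muln M j P = point_muln M (j %% n)%N P.
Proof.
move=> Pr Pn; rewrite {1}(divn_eq j n) addnC point_mulnD //.
suff -> : point_muln M (j %/ n * n)%N P = None by case: (point_muln _ _ _) => [[]|].
by elim: (j %/ n)%N => [//|q IH]; rewrite mulSn point_mulnD // IH Pn.
Qed.

(** In the coordinate xi = c / x, doubling is multiplication by 4 up to a factor that
    is close to 1 when xi is small. *)
Lemma point_double_xi (c xi y a0 b0 : k) :
  a = a0 * c -> b = b0 * c ^+ 2 -> c != 0 -> xi != 0 ->
  1 + a0 * xi + b0 * xi ^+ 2 != 0 -> 1 - b0 * xi ^+ 2 != 0 ->
  rational_points M (Some (c / xi, y)) ->
  exists y', point_add M (Some (c / xi, y)) (Some (c / xi, y)) =
    Some (c / (4 * xi * (1 + a0 * xi + b0 * xi ^+ 2) / (1 - b0 * xi ^+ 2) ^+ 2), y').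
Proof.
move=> aE bE c0 xi0 h0 g0; rewrite rational_pointsE cubicE => e.
have four0 : (4 : k) != 0 by rewrite (natrM _ 2 2) mulf_neq0.
have yE : y ^+ 2 = c ^+ 3 * (1 + a0 * xi + b0 * xi ^+ 2) / xi ^+ 3.
  by rewrite e aE bE; field.
have y0 : y != 0.
  apply/eqP => y0; have /eqP := yE; rewrite y0 expr0n eq_sym !mulf_eq0 invr_eq0.
  by rewrite !expf_eq0 /= (negPf c0) (negPf h0) (negPf xi0).
have y2 : y + y != 0 by rewrite -mulr2n -mulr_natl mulf_neq0.
rewrite /point_add eqxx /= !mul0r !addr0 (negPf y2); eexists; congr (Some (_, _)).
rewrite subr0 expr_div_n [(2 * y) ^+ 2]exprMn yE aE bE.
by field; rewrite ?c0 ?xi0 ?h0 ?g0 ?two_neq0 ?four0.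
Qed.

(** Doubling factors through the isogenous curve. The square t^2 is the x-coordinate
    of the image of Q there, and the quartic says that the second isogeny sends this
    image to a point with x-coordinate z^2. *)
Lemma double_square_root z y Q : rational_points M Q ->
  point_muln M 2 Q = Some (z ^+ 2, y) ->
  exists t, (t ^+ 2) ^+ 2 - (2 * a + 4 * z ^+ 2) * t ^+ 2 + (a ^+ 2 - 4 * b) = 0.
Proof.
case: Q => [[u v]|//]; rewrite rational_pointsE cubicE => uv.
rewrite /point_muln /= eqxx /= !mul0r !addr0; case: eqP => [//|/eqP v2].
move=> [e _]; exists (v / u).
have v0 : v != 0 by apply: contra v2 => /eqP ->; rewrite addr0.
have four0 : (4 : k) != 0 by rewrite (natrM _ 2 2) mulf_neq0.
have uvE : v ^+ 2 = u * (u ^+ 2 + a * u + b) by rewrite uv; ring.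
have u0 : u != 0.
  by apply: contra v0 => /eqP u0; rewrite -[_ == _](expf_eq0 _ 2) uvE u0 mul0r.
have q0 : u ^+ 2 + a * u + b != 0.
  by apply: contra v0 => /eqP q0; rewrite -[_ == _](expf_eq0 _ 2) uvE q0 mulr0.
rewrite -e !expr_div_n [(2 * v) ^+ 2]exprMn uvE.
by field; rewrite ?u0 ?q0 ?two_neq0 ?four0.
Qed.
End Multiples.

Section TranslatedCurve.
Variables (K : fieldExtType rat) (a b r : K).
Hypothesis b_neq0 : b != 0.
Hypothesis d_neq0 : a ^+ 2 - 4 * b != 0.
Local Notation M := (Weierstrass 0 a 0 b 0).
Local Notation W := (change_curve 1 r 0 0 M).
Local Notation cp := (change_point 1 r 0 0).

Let cp_inj : injective (cp : curve_point K -> curve_point K).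
Proof. exact: can_inj (change_pointK r 0 0 (oner_neq0 K)). Qed.

Lemma translated_muln n P : rational_points M P ->
  point_muln W n (cp P) = cp (point_muln M n P).
Proof.
move=> Pr; apply: change_point_muln => //; first exact: oner_neq0.
by move=> m; apply: point_muln_rational.
Qed.

Lemma translated_torsion P : rational_points M P ->
  torsion_point W (cp P) -> torsion_point M P.
Proof.
move=> Pr [n [n0 e]]; exists n; split=> //.
by apply: cp_inj; rewrite -translated_muln.
Qed.

Lemma translated_condA z y : rational_points M (Some (z ^+ 2, y)) ->
  condA W (cp (Some (z ^+ 2, y))) ->
  exists t, (t ^+ 2) ^+ 2 - (2 * a + 4 * z ^+ 2) * t ^+ 2 + (a ^+ 2 - 4 * b) = 0.
Proof.
move=> Pr [_ [Q' /(change_point_surj (oner_neq0 _))[Q Qr ->]]].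
rewrite translated_muln // => /cp_inj e.
by apply: (double_square_root _ Qr (esym e)); rewrite natr_number_eq0.
Qed.
End TranslatedCurve.

Section NonTorsion.
Variables (K : fieldExtType rat) (p : prime_of K).
Hypothesis p2 : p 2.
Local Notation loc := (local_pred p).

Definition local_unit (x : K) := [/\ x != 0, x \in loc & x^-1 \in loc].

Lemma local_unitM x y : local_unit x -> local_unit y -> local_unit (x * y).
Proof.
by move=> [x0 xl xV] [y0 yl yV]; split; rewrite ?mulf_neq0 ?invfM ?rpredM.
Qed.

Lemma local_unitV x : local_unit x -> local_unit x^-1.
Proof. by move=> [x0 xl xV]; split; rewrite ?invr_eq0 ?invrK. Qed.

Lemma residue2 : residue p 2 = 0.
Proof. by apply/residue_eq0_int => //; exact: integer_nat. Qed.

Lemma local_unit_1D2 c : c \in loc -> local_unit (1 + 2 * c).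
Proof.
move=> cl; have l2 : 2 \in loc by exact: rpred_nat.
have l : 1 + 2 * c \in loc by rewrite rpredD ?rpred1 ?rpredM.
have e : residue p (1 + 2 * c) != 0.
  rewrite residueD ?rpred1 ?rpredM // residueM // residue2 residue1 mul0r addr0.
  exact: oner_neq0.
split=> //; last exact: residue_inv_local.
by apply: contra e => /eqP ->; rewrite residue0.
Qed.

Lemma two_power_not_unit n x : local_unit x -> local_unit (2 ^+ n * x) -> n = 0%N.
Proof.
move=> [x0 xl _] [_ _ h]; case: n h => // n h.
have l2 : 2 \in loc by exact: rpred_nat.
have : residue p (2 * ((2 ^+ n * x) * (2 ^+ n.+1 * x)^-1)) = 1.
  have two0 : (2 : K) != 0 by rewrite natr_number_eq0.
  by rewrite !mulrA -exprS mulfV ?residue1 // mulf_neq0 ?expf_neq0.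
rewrite residueM //; last by rewrite !rpredM ?rpredX.
by rewrite residue2 mul0r => /eqP; rewrite eq_sym oner_eq0.
Qed.

Variables (a b c : K) (m : nat).
Hypothesis b_neq0 : b != 0.
Hypothesis d_neq0 : a ^+ 2 - 4 * b != 0.
Hypothesis c_neq0 : c != 0.
Hypothesis ma : 2 ^+ m * a \in loc.
Hypothesis mb : 2 ^+ m * b \in loc.
Local Notation M := (Weierstrass 0 (a * c) 0 (b * c ^+ 2) 0).

(** Doubling multiplies c / x by 4 and a 2-adic unit when c / x is 2-adically
    small, so the points 2^k P are pairwise distinct. *)
Lemma not_torsion_2adic e v y : (m < e)%N -> local_unit v ->
  rational_points M (Some (c / (2 ^+ e * v), y)) ->
  ~ torsion_point M (Some (c / (2 ^+ e * v), y)).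
Proof.
move=> me vu Pr [n [n0 Pn]].
have two0 : (2 : K) != 0 by rewrite natr_number_eq0.
have B0 : b * c ^+ 2 != 0 by rewrite mulf_neq0 ?expf_neq0.
have D0 : (a * c) ^+ 2 - 4 * (b * c ^+ 2) != 0.
  have -> : (a * c) ^+ 2 - 4 * (b * c ^+ 2) = (a ^+ 2 - 4 * b) * c ^+ 2 by ring.
  by rewrite mulf_neq0 ?expf_neq0.
set P := Some (c / (2 ^+ e * v), y) in Pr Pn.
have mult j : exists w y', local_unit w /\
    point_muln M (2 ^ j) P = Some (c / (2 ^+ (e + j.*2) * w), y').
  elim: j => [|j [w [y' [wu IH]]]]; first by exists v, y; split; rewrite ?addn0.
  rewrite expnS mul2n -addnn point_mulnD // IH.
  have l2 : 2 \in loc by exact: rpred_nat.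
  have [w0 wl wV] := wu.
  set xi := 2 ^+ (e + j.*2) * w.
  pose f := (e + j.*2 - m.+1)%N.
  have xiE : xi = 2 * (2 ^+ f * w) * 2 ^+ m.
    have ef : (e + j.*2 = 1 + f + m)%N by rewrite addnAC add1n subnKC // ltn_addr.
    by rewrite /xi ef !exprD expr1; ring.
  have al : a * xi = 2 * ((2 ^+ m * a) * (2 ^+ f * w)) by rewrite xiE; ring.
  have bl : b * xi ^+ 2 = 2 * ((2 ^+ m * b) * (2 ^+ f * w) * xi).
    by rewrite expr2 {1}xiE; ring.
  have xil : xi \in loc by rewrite rpredM ?rpredX.
  have fwl : 2 ^+ f * w \in loc by rewrite rpredM ?rpredX.
  have hu : local_unit (1 + a * xi + b * xi ^+ 2).
    rewrite -addrA al bl -mulrDr; apply: local_unit_1D2.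
    by apply: rpredD; [exact: rpredM|apply: rpredM => //; exact: rpredM].
  have gu : local_unit (1 - b * xi ^+ 2).
    rewrite bl -mulrN; apply: local_unit_1D2; rewrite rpredN.
    by apply: rpredM => //; exact: rpredM.
  have [h0 _ _] := hu; have [g0 _ _] := gu.
  have xi0 : xi != 0 by rewrite mulf_neq0 ?expf_neq0.
  have Qr : rational_points M (Some (c / xi, y')).
    by rewrite /xi -IH; apply: point_muln_rational.
  have [y'' ->] := point_double_xi two0 (erefl _) (erefl _) c_neq0 xi0 h0 g0 Qr.
  exists (w * ((1 + a * xi + b * xi ^+ 2) *
    ((1 - b * xi ^+ 2)^-1 * (1 - b * xi ^+ 2)^-1))), y''; split.
    by do !apply: local_unitM => //; apply: local_unitV.
  congr (Some (_ / _, _)); rewrite doubleS !addnS !exprS {1}/xi.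
  by field.
have [i [j [ij e2]]] : exists i j, (i < j)%N /\ (2 ^ i = 2 ^ j %[mod n])%N.
  pose f (i : 'I_n.+1) := Ordinal (ltn_pmod (2 ^ i) n0).
  have : ~~ injectiveb f.
    by apply/negP => /injectiveP/leq_card; rewrite !card_ord ltnn.
  move=> /injectivePn[i [j ij /(congr1 val) /= e2]].
  case: (ltngtP i j) => lt; [by exists i, j|by exists j, i|].
  by move: ij; rewrite (val_inj lt) eqxx.
have [w [y1 [wu e3]]] := mult i; have [w' [y2 [w'u e4]]] := mult j.
have : point_muln M (2 ^ i) P = point_muln M (2 ^ j) P.
  rewrite (torsion_point_modn two0 B0 D0 (2 ^ i)%N Pr Pn) e2.
  by rewrite -(torsion_point_modn two0 B0 D0 _ Pr Pn).
rewrite e3 e4 => -[e5 _].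
have e6 : 2 ^+ (e + i.*2) * w = 2 ^+ (e + j.*2) * w'.
  by apply: invr_inj; apply: (mulfI c_neq0).
have u2 : local_unit (2 ^+ (j - i).*2 * w').
  have -> : 2 ^+ (j - i).*2 * w' = w; last by [].
  apply: (mulfI (expf_neq0 (e + i.*2) two0)); rewrite e6 mulrA -exprD.
  by rewrite -addnA -doubleD subnKC // ltnW.
by have /eqP := two_power_not_unit w'u u2; rewrite double_eq0 subn_eq0 leqNgt ij.
Qed.
End NonTorsion.

(** * Forcing nonsquares by congruences *)

Section FiniteFieldValues.
Variable k : fieldType.
Hypothesis k_finite : finite_set [set: k].

Lemma finite_inv_pow (x : k) : x != 0 -> exists n, x^-1 = x ^+ n.
Proof.
move: x; apply: (finite_fieldW (P := fun k : fieldType =>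
  forall x : k, x != 0 -> exists n, x^-1 = x ^+ n)) k_finite => F x x0.
exists #|F|.-2; apply: (mulfI x0); rewrite mulfV // -exprS.
apply: (mulfI x0); rewrite -exprS mulr1.
have F2 := finNzRing_gt1 F.
by rewrite (_ : #|F|.-2.+2 = #|F|) ?expf_card //; case: #|F| F2 => [|[|]].
Qed.

Hypothesis two_neq0 : (2 : k) != 0.

Lemma finite_nonsquare : exists n : k, ~ square n.
Proof.
move: two_neq0; apply: (finite_fieldW (P := fun k : fieldType =>
  (2 : k) != 0 -> exists n : k, ~ square n)) k_finite => F F2.
by case: (finFieldType_descent F2).
Qed.

Hypothesis three_neq0 : (3 : k) != 0.

(** For kappa a square: if u^2 - beta were always a square, the squares would be
    stable under translation by beta t^2 and - beta t^2 for all t, and every element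
    is a sum of two such. For kappa a nonsquare, some u^2 - beta is a nonzero
    square. *)
Lemma nonsquare_value l (beta kappa : k) : (0 < l)%N -> (l%:R : k) = 0 ->
  beta != 0 -> kappa != 0 -> exists u, ~ square (kappa * (u ^+ 2 - beta)).
Proof.
move=> l_gt0 l0 beta0 kappa0.
have [sk|nk] := pselect (square kappa); last first.
  have [z [z0 zb]] : exists z : k, z != 0 /\ z ^+ 2 != beta.
    have [e|ne] := eqVneq (1 : k) beta; last by exists 1; rewrite oner_neq0 expr1n.
    exists 2; split=> //; rewrite -e -subr_eq0.
    by have -> : (2 : k) ^+ 2 - 1 = 3 by ring.
  exists ((z + beta / z) / 2) => sq; apply: nk.
  have four0 : (4 : k) != 0 by rewrite (natrM _ 2 2) mulf_neq0.
  have sqE : ((z + beta / z) / 2) ^+ 2 - beta = ((z ^+ 2 - beta) / (2 * z)) ^+ 2.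
    by field; rewrite z0 two_neq0 ?four0.
  rewrite sqE in sq; apply: (square_div _ sq (square_sqr _)).
  by rewrite expf_neq0 // mulf_neq0 ?invr_eq0 ?mulf_neq0 ?subr_eq0.
apply: contrapT => /forallNP H.
have sub u : square (u ^+ 2 - beta).
  have /contrapT sq := H u.
  by apply: (square_div kappa0) sk; rewrite mulrC.
have subn s j : square s -> square (s - j%:R * beta).
  move=> ss; elim: j => [|j [c e]]; first by rewrite mul0r subr0.
  have -> : s - j.+1%:R * beta = (s - j%:R * beta) - beta by rewrite -natr1; ring.
  by rewrite e.
have add s : square s -> square (s + beta).
  move=> ss; have -> : s + beta = s - l.-1%:R * beta; last exact: subn.
  have -> : l.-1%:R = -1 :> k; last by ring.
  by apply/eqP; rewrite -subr_eq0 opprK natr1 prednK // l0.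
have scale (f : k -> k) (t : k) : (forall s, square s -> square (f s)) ->
    f 0 != 0 -> t != 0 -> forall s, square s -> square (t ^+ 2 * f (s / t ^+ 2)).
  move=> fs _ t0 s ss; apply: squareM; first exact: square_sqr.
  apply: fs; apply: (square_div (expf_neq0 2 t0)); last exact: square_sqr.
  by rewrite divfK ?expf_neq0.
have addt s t : square s -> square (s + beta * t ^+ 2).
  have [->|t0] := eqVneq t 0; first by rewrite expr0n mulr0 addr0.
  move=> ss; have -> : s + beta * t ^+ 2 = t ^+ 2 * (s / t ^+ 2 + beta) by field.
  by apply: (scale (fun s => s + beta)) => //; rewrite add0r.
have subt s t : square s -> square (s - beta * t ^+ 2).
  have [->|t0] := eqVneq t 0; first by rewrite expr0n mulr0 subr0.
  move=> ss; have -> : s - beta * t ^+ 2 = t ^+ 2 * (s / t ^+ 2 - beta) by field.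
  apply: (scale (fun s => s - beta)) => //; last by rewrite sub0r oppr_eq0.
  by move=> u su; have := subn u 1%N su; rewrite mul1r.
have [n nn] := finite_nonsquare; apply: nn.
have -> : n = 0 + beta * ((n / beta + 1) / 2) ^+ 2 - beta * ((n / beta - 1) / 2) ^+ 2.
  have four0 : (4 : k) != 0 by rewrite (natrM _ 2 2) mulf_neq0.
  by field; rewrite ?two_neq0 ?four0 ?beta0.
by apply: subt; apply: addt; exists 0; rewrite expr0n.
Qed.
End FiniteFieldValues.

Lemma neg_cube_mul (k : fieldType) (x y : k) : y != 0 ->
  - (- x / y * (- x / y) ^+ 2) * y = x * (x / y) ^+ 2.
Proof. by move=> y0; field. Qed.

Section Conditions.
Variable K : fieldExtType rat.

Lemma integer_residue_surj (p : prime_of K) z :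
  exists2 n, integer n & residue p n = z.
Proof.
have [x xl <-] := residue_surj z.
have /local_predP[u [s [ui si ps e]]] := xl.
have sl := local_int p si; have ul := local_int p ui.
have s0 : residue p s != 0 by apply/eqP => /(residue_eq0_int p si).
have [n en] := finite_inv_pow (residue_field_finite p) s0.
exists (u * s ^+ n); first by apply: integerM => //; exact: integerX.
rewrite residueM ?rpredX // residueX // -en e residueM ?residueV //.
exact: residue_inv_local.
Qed.

Lemma residue_congr (p : prime_of K) (l : nat) (N n t : K) : p l%:R ->
  integer n -> integer t -> N - n = l%:R * t -> residue p N = residue p n.
Proof.
move=> pl ni ti e; have -> : N = n + l%:R * t by rewrite -e addrC subrK.
have ll : l%:R \in local_pred p by exact: rpred_nat.
have tl := local_int p ti.
rewrite (residueD (local_int p ni) (rpredM ll tl)) (residueM ll tl) residue_nat.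
by have /residue_nat_eq0/eqP -> := pl; rewrite mul0r addr0.
Qed.

Lemma residue_square (p : prime_of K) x : x \in local_pred p ->
  square x -> square (residue p x).
Proof.
move=> xl [c e]; exists (residue p c); rewrite e residueX //.
by apply: (@local_closed _ _ _ 1); rewrite -e.
Qed.

(** Every rational prime beyond the denominators of cs will do. *)
Lemma exists_good_prime (cs : seq K) B : exists l (p : prime_of K),
  [/\ prime l, (B < l)%N, p l%:R, ~ p 2 /\ ~ p 3 & forall c, c \in cs -> c \in local_pred p].
Proof.
have [n n_gt0 Hn] := local_cofinite_seq cs.
have [l lB lp] := prime_above (B + n + 3).
have [p pl] := exists_prime_over K lp.
have notin j : (0 < j)%N -> (j < l)%N -> ~ p j%:R.
  move=> j0 jl; apply: (prime_coprime_nat pl).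
  by rewrite prime_coprime // gtnNdvd.
exists l, p; split=> //.
- by apply: leq_ltn_trans lB; rewrite -addnA leq_addr.
- by split; apply: notin => //; apply: leq_trans lB; rewrite addn3.
- apply: Hn; apply: notin => //; apply: leq_ltn_trans lB.
  by rewrite addnAC leq_addl.
Qed.

Lemma residue_natr_neq0 (p : prime_of K) n : ~ p n%:R -> (n%:R : residue_field p) != 0.
Proof. by move=> pn; apply/negP => /residue_nat_eq0. Qed.

Variables a b : K.
Hypothesis b_neq0 : b != 0.
Local Notation d := (a ^+ 2 - 4 * b).

Definition quadratic_form (N c : K) : K := N ^+ 2 + 2 * a * N * c ^+ 2 + d * c ^+ 4.

Definition congruence_forces (l : nat) (n : K) (Q : K -> Prop) : Prop :=
  forall N t, integer N -> integer t -> N - n = l%:R * t -> Q N.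

(** The form is (N + a c^2)^2 - 4 b c^4, of the shape u^2 - beta modulo a large
    prime. *)
Lemma nonsquare_quadratic (kappa c : K) B : kappa != 0 -> c != 0 ->
  exists l n, [/\ prime l, (B < l)%N, integer n &
    congruence_forces l n (fun N => ~ square (kappa * quadratic_form N c))].
Proof.
move=> k0 c0.
have [l [p [lp Bl pl [p2 p3] H]]] := exists_good_prime
  [:: kappa; kappa^-1; c; c^-1; a; b; b^-1] B.
have kl : kappa \in local_pred p by apply: H; rewrite !inE eqxx.
have kVl : kappa^-1 \in local_pred p by apply: H; rewrite !inE eqxx ?orbT.
have cl : c \in local_pred p by apply: H; rewrite !inE eqxx ?orbT.
have cVl : c^-1 \in local_pred p by apply: H; rewrite !inE eqxx ?orbT.
have al : a \in local_pred p by apply: H; rewrite !inE eqxx ?orbT.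
have bl : b \in local_pred p by apply: H; rewrite !inE eqxx ?orbT.
have bVl : b^-1 \in local_pred p by apply: H; rewrite !inE eqxx ?orbT.
have two0 := residue_natr_neq0 p2; have three0 := residue_natr_neq0 p3.
have l0 : (l%:R : residue_field p) = 0 by apply/eqP/residue_nat_eq0.
have beta_neq0 : 4 * residue p b * residue p c ^+ 4 != 0.
  by rewrite (natrM _ 2 2) !mulf_neq0 ?expf_neq0 // residue_unit.
have [u nu] := nonsquare_value (residue_field_finite p) two0 three0 (prime_gt0 lp) l0
  beta_neq0 (residue_unit k0 kl kVl).
have [n ni en] := integer_residue_surj (u - residue p a * residue p c ^+ 2).
exists l, n; split=> // N t Ni ti e sq; apply: nu.
have Nl := local_int p Ni.
have eN : residue p N = u - residue p a * residue p c ^+ 2.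
  by rewrite (residue_congr pl ni ti e).
have ql : quadratic_form N c = (N + a * c ^+ 2) ^+ 2 - 4 * b * c ^+ 4.
  by rewrite /quadratic_form; ring.
rewrite ql in sq.
have l1 : N + a * c ^+ 2 \in local_pred p by solve_local.
have l2 : 4 * b * c ^+ 4 \in local_pred p by solve_local.
have := residue_square (rpredM kl (rpredB (rpredX 2 l1) l2)) sq.
rewrite ?(residueB, residueD, residueM, residueX, residue_nat); try solve_local.
by rewrite eN subrK.
Qed.

(** Modulo a prime dividing the second argument of the form, the expression reduces to
    - N^3 D'. *)
Lemma nonsquare_cubic (D' : K) B : D' != 0 ->
  exists l n, [/\ prime l, (B < l)%N, integer n &
    forall c, integer c -> congruence_forces l n (fun N =>
      ~ square (- (N * quadratic_form N (l%:R * c)) * D'))].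
Proof.
move=> D0.
have [l [p [lp Bl pl [p2 p3] H]]] := exists_good_prime [:: D'; D'^-1; a; b] B.
have Dl : D' \in local_pred p by apply: H; rewrite !inE eqxx.
have DVl : D'^-1 \in local_pred p by apply: H; rewrite !inE eqxx ?orbT.
have al : a \in local_pred p by apply: H; rewrite !inE eqxx ?orbT.
have bl : b \in local_pred p by apply: H; rewrite !inE eqxx ?orbT.
have D'0 := residue_unit D0 Dl DVl.
have [nu nnu] := finite_nonsquare (residue_field_finite p) (residue_natr_neq0 p2).
have nu0 : nu != 0 by apply/eqP => e; apply: nnu; exists 0; rewrite e expr0n.
have [n ni en] := integer_residue_surj (- nu / residue p D').
exists l, n; split=> // c ci N t Ni ti e sq; apply: nnu.
have Nl := local_int p Ni; have cl := local_int p ci.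
have eN : residue p N = - nu / residue p D' by rewrite (residue_congr pl ni ti e).
have ll : l%:R \in local_pred p by exact: rpred_nat.
have lcl : l%:R * c \in local_pred p by exact: rpredM.
have lc0 : residue p (l%:R * c) = 0.
  by rewrite residueM // residue_nat; have /residue_nat_eq0/eqP -> := pl; rewrite mul0r.
move: (l%:R * c) lcl lc0 sq => C Cl C0 sq.
have ql : quadratic_form N C \in local_pred p.
  by rewrite /quadratic_form; solve_local.
have qE : residue p (quadratic_form N C) = residue p N ^+ 2.
  rewrite /quadratic_form ?(residueB, residueD, residueM, residueX, residue_nat);
    try solve_local.
  by rewrite C0 !expr0n !mulr0 !addr0.
have Nql := rpredM Nl ql.
have NqNl : - (N * quadratic_form N C) \in local_pred p by rewrite rpredN.
have := residue_square (rpredM NqNl Dl) sq.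
rewrite (residueM NqNl Dl) (residueN Nql) (residueM Nl ql) qE eN.
rewrite neg_cube_mul //.
move=> h; apply: square_div h (square_sqr _).
by rewrite expf_neq0 // mulf_neq0 // invr_eq0.
Qed.

(** Chinese remainder theorem for integers of K modulo rational integers. *)
Lemma integer_chinese (s : seq (nat * K)) :
  pairwise (fun x y => coprime x.1 y.1) s -> (forall x, x \in s -> integer x.2) ->
  exists2 N, integer N & forall x, x \in s ->
    exists2 t, integer t & N - x.2 = x.1%:R * t.
Proof.
elim: s => [|[l n] s IH] /=; first by exists 0 => //; exact: integer0.
move=> /andP[/allP cop pw] si.
have [N Ni HN] := IH pw (fun x xs => si x (mem_behead (s := (l, n) :: s) xs)).
have ni : integer n by have := si (l, n); apply; rewrite inE eqxx.
pose L := \prod_(x <- s) x.1.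
have coL : coprime l L.
  rewrite /L big_seq; elim/big_ind: _ => //=; first exact: coprimen1.
    by move=> u v; rewrite coprimeMr => -> ->.
have dvd x : x \in s -> exists L', L = (x.1 * L')%N.
  by move=> xs; exists (\prod_(y <- rem x s) y.1)%N; rewrite /L (big_rem x).
have [u [v uv]] : exists u v : int, u * L + v * l = 1.
  have [u [v e]] := Bezoutz L l; exists u, v.
  by rewrite e /gcdz /=; move: coL; rewrite coprime_sym /coprime => /eqP ->.
have uvK : u%:~R * L%:R + v%:~R * l%:R = 1 :> K.
  by rewrite -[L%:R]/(L%:Z%:~R) -[l%:R]/(l%:Z%:~R) -!intrM -intrD uv.
exists (N + L%:R * u%:~R * (n - N)).
  apply: integerD => //; apply: integerM; last exact: integerB.
  by apply: integerM; [exact: integer_nat|exact: integer_int].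
move=> x; rewrite inE => /orP[/eqP -> /=|xs].
  exists (v%:~R * (N - n)); first by apply: integerM; [exact: integer_int|exact: integerB].
  have -> : L%:R * u%:~R = 1 - v%:~R * l%:R :> K by rewrite mulrC; exact: (canRL (addrK _) uvK).
  by ring.
have [t ti e] := HN x xs; have [L' eL] := dvd x xs.
exists (t + L'%:R * u%:~R * (n - N)).
  apply: integerD => //; apply: integerM; last exact: integerB.
  by apply: integerM; [exact: integer_nat|exact: integer_int].
have -> : N + L%:R * u%:~R * (n - N) - x.2 = (N - x.2) + L%:R * u%:~R * (n - N) by ring.
by rewrite e eL natrM; ring.
Qed.

Lemma nonsquare_cubics (Ds : seq K) B : (forall D', D' \in Ds -> D' != 0) ->
  exists s : seq (nat * K), [/\ pairwise (fun x y => coprime x.1 y.1) s,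
    forall x, x \in s -> [/\ prime x.1, (B < x.1)%N & integer x.2] &
    forall D', D' \in Ds -> exists2 x, x \in s &
      forall c, integer c -> congruence_forces x.1 x.2 (fun N =>
        ~ square (- (N * quadratic_form N (x.1%:R * c)) * D'))].
Proof.
elim: Ds B => [|D' Ds IH] B D0; first by exists [::].
have [l [n [lp Bl ni H]]] := nonsquare_cubic B (D0 D' (mem_head _ _)).
have [s [pw sP HD]] := IH l (fun D'' h => D0 D'' (mem_behead (s := D' :: Ds) h)).
exists ((l, n) :: s); split.
- rewrite /= pw andbT; apply/allP => x /sP[xp lx _] /=.
  by rewrite prime_coprime // dvdn_prime2 // ltn_eqF.
- move=> x; rewrite inE => /orP[/eqP ->//|/sP[xp lx xi]].
  by split=> //; apply: ltn_trans lx.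
- move=> D''; rewrite inE => /orP[/eqP ->|/HD[x xs Hx]].
    by exists (l, n) => //; rewrite inE eqxx.
  by exists x => //; rewrite inE xs orbT.
Qed.
End Conditions.

(** * Points on the twists *)

Section Twist.
Variables (K : fieldExtType rat) (a b : K).
Hypothesis b_neq0 : b != 0.
Local Notation d := (a ^+ 2 - 4 * b).
Hypothesis d_nonsquare : ~ square d.

Lemma nonsquare_neq0 (k : fieldType) (x : k) : ~ square x -> x != 0.
Proof. by move=> nx; apply/eqP => x0; apply: nx; exists 0; rewrite x0 expr0n. Qed.

Let d_neq0 : d != 0 := nonsquare_neq0 d_nonsquare.
Let two0 : (2 : K) != 0. Proof. by rewrite natr_number_eq0. Qed.
Let four0 : (4 : K) != 0. Proof. by rewrite natr_number_eq0. Qed.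
Let eight0 : (8 : K) != 0. Proof. by rewrite natr_number_eq0. Qed.

Definition conic_value (s : K) : K := s ^+ 2 + 2 * a * s + d.

(** The twist by D acquires the point (D^2, D^2 w) as soon as D^2 + a D + b = w^2;
    s is the parameter of this conic, with w = D + (a + s) / 2. *)
Definition twist_param (s : K) : K := - conic_value s / (4 * s).

Section Point.
Variable s : K.
Hypothesis s_neq0 : s != 0.
Hypothesis q_nonsquare : ~ square (conic_value s).
Hypothesis dq_nonsquare : ~ square (d * conic_value s).

Local Notation q := (conic_value s).
Local Notation D := (twist_param s).
Local Notation A := (a * D).
Local Notation B := (b * D ^+ 2).
Local Notation M := (Weierstrass 0 A 0 B 0).
Let y0 : K := D ^+ 2 * (D + (a + s) / 2).

Let q_neq0 : q != 0 := nonsquare_neq0 q_nonsquare.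

Lemma twist_param_neq0 : D != 0.
Proof. by rewrite /twist_param mulf_neq0 ?oppr_eq0 ?invr_eq0 ?mulf_neq0. Qed.

Let B_neq0 : B != 0.
Proof. by rewrite mulf_neq0 ?expf_neq0 // twist_param_neq0. Qed.

Let dE : A ^+ 2 - 4 * B = d * D ^+ 2.
Proof. by ring. Qed.

Let dD_neq0 : A ^+ 2 - 4 * B != 0.
Proof. by rewrite dE mulf_neq0 ?expf_neq0 // twist_param_neq0. Qed.

Lemma twist_point_rational : rational_points M (Some (D ^+ 2, y0)).
Proof.
rewrite rational_pointsE cubicE /y0 /twist_param /conic_value.
by field; rewrite ?s_neq0 ?two0 ?four0.
Qed.

Let isogenous_point_rational :
  rational_points (Weierstrass 0 (- (2 * A)) 0 (A ^+ 2 - 4 * B) 0)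
    (Some (- D * s, - (2 * D ^+ 2 * s))).
Proof.
rewrite rational_pointsE cubicE /twist_param /conic_value.
by field; rewrite ?s_neq0 ?two0 ?four0.
Qed.

Let isogenous_point_image :
  two_isogeny (A ^+ 2 - 4 * B) (Some (- D * s, - (2 * D ^+ 2 * s))) = Some (D ^+ 2, y0).
Proof.
have D0 := twist_param_neq0.
have x0 : - D * s != 0 by rewrite mulf_neq0 ?oppr_eq0.
rewrite /two_isogeny (negPf x0); congr (Some (_, _)).
  by field; rewrite s_neq0 oppr_eq0 D0 four0.
have -> : y0 = D ^+ 2 * ((s ^+ 2 - d) / (4 * s)).
  by rewrite /y0 /twist_param /conic_value; field; rewrite ?s_neq0 ?two0 ?four0.
by field; rewrite ?s_neq0 ?oppr_eq0 ?D0 ?two0 ?four0 ?eight0.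
Qed.

(* for t^2 the quartic has the roots q / 4 and d q / (4 s^2) *)
Let twist_not_double t :
  (t ^+ 2) ^+ 2 - (2 * A + 4 * D ^+ 2) * t ^+ 2 + (A ^+ 2 - 4 * B) <> 0.
Proof.
have -> : (t ^+ 2) ^+ 2 - (2 * A + 4 * D ^+ 2) * t ^+ 2 + (A ^+ 2 - 4 * B) =
    (t ^+ 2 - q / 4) * (t ^+ 2 - d * q / (4 * s ^+ 2)).
  by rewrite /twist_param /conic_value; field; rewrite ?s_neq0 ?two0 ?four0.
move=> /eqP; rewrite mulf_eq0 !subr_eq0 => /orP[] /eqP e.
  by apply: q_nonsquare; exists (2 * t); rewrite exprMn e; field.
by apply: dq_nonsquare; exists (2 * s * t); rewrite exprMn e; field; rewrite ?s_neq0 ?four0.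
Qed.

Variables (r : K) (p : prime_of K) (m e : nat) (v : K).
Hypothesis p2 : p 2.
Hypothesis ma : 2 ^+ m * a \in local_pred p.
Hypothesis mb : 2 ^+ m * b \in local_pred p.
Hypothesis me : (m < e)%N.
Hypothesis v_unit : local_unit p v.
Hypothesis D_2adic : D^-1 = 2 ^+ e * v.

Lemma twist_nontrivial_point :
  nontrivial_point (change_curve 1 r 0 0 M) (change_point 1 r 0 0 (Some (D ^+ 2, y0))).
Proof.
have Pr := twist_point_rational; have D0 := twist_param_neq0.
split; last split.
- by apply/change_point_rational => //; exact: oner_neq0.
- exact: locally_imprimitive_square.
- move=> /(translated_torsion Pr).
  have DE : D / (2 ^+ e * v) = D ^+ 2 by rewrite -D_2adic invrK expr2.
  have Pr' : rational_points M (Some (D / (2 ^+ e * v), y0)) by rewrite DE.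
  by have := not_torsion_2adic p2 b_neq0 d_neq0 D0 ma mb me v_unit Pr'; rewrite DE.
- rewrite -isogenous_point_image; apply: condC_two_isogeny => //.
  by rewrite mulf_neq0 ?oppr_eq0.
- by move=> /(translated_condA Pr)[t /twist_not_double].
- apply: not_condB_nonsquare => //; rewrite dE => sq; apply: d_nonsquare.
  by apply: square_div sq (square_sqr _); rewrite expf_neq0.
Qed.
End Point.

(** The parameter is N / c^2 with c divisible by a high power of 2 and by primes
    at which -s q(s) has the square class of -N; the integer N is then chosen by
    congruences. *)
Lemma exists_twist_param (p : prime_of K) m (Ds : seq K) : p 2 ->
  2 ^+ m * a \in local_pred p -> 2 ^+ m * b \in local_pred p ->
  (forall D', D' \in Ds -> D' != 0) ->
  exists s : K, [/\ s != 0, ~ square (conic_value s), ~ square (d * conic_value s),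
    exists e v, [/\ (m < e)%N, local_unit p v & (twist_param s)^-1 = 2 ^+ e * v] &
    forall D', D' \in Ds -> ~ square (twist_param s * D')].
Proof.
move=> p2 ma mb Ds0.
have [s [pw sP HD]] := nonsquare_cubics a b 2 Ds0.
pose L := (\prod_(x <- s) x.1)%N.
pose cn := (2 ^ m.+1 * L)%N; pose c : K := cn%:R.
have L_gt0 : (0 < L)%N.
  by rewrite /L big_seq; apply: prodn_cond_gt0 => x /sP[/prime_gt0].
have c0 : c != 0 by rewrite natr_number_eq0 -lt0n muln_gt0 expn_gt0 L_gt0.
have [l0 [n0 [l0p Bl0 n0i H0]]] := nonsquare_quadratic a b_neq0 (L + 2) (oner_neq0 K) c0.
have [l1 [n1 [l1p Bl1 n1i H1]]] := nonsquare_quadratic a b_neq0 l0 d_neq0 c0.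
have le_L x : x \in s -> (x.1 <= L)%N.
  by move=> xs; apply: dvdn_leq => //; rewrite /L (big_rem x) //= dvdn_mulr.
have cop (u w : nat) : prime u -> prime w -> (u < w)%N -> coprime u w.
  by move=> up wp uw; rewrite prime_coprime // dvdn_prime2 // ltn_eqF.
have l02 : (2 < l0)%N by apply: leq_trans Bl0; rewrite ltnS leq_addl.
have lt_l0 x : x \in s -> (x.1 < l0)%N.
  by move=> /le_L xL; apply: leq_trans Bl0; rewrite ltnS (leq_trans xL) ?leq_addr.
pose s' := [:: (2%N, 1), (l0, n0), (l1, n1) & s].
have pw' : pairwise (fun x y : nat * K => coprime x.1 y.1) s'.
  rewrite /s' /= pw andbT; apply/and3P; split.
  - apply/and3P; split; [exact: cop|exact: cop (ltn_trans l02 Bl1)|].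
    by apply/allP => x /sP[xp x2 _]; apply: cop.
  - apply/andP; split; first exact: cop.
    by apply/allP => x xs; rewrite coprime_sym; apply: cop => //; [case: (sP x xs)|exact: lt_l0].
  - apply/allP => x xs; rewrite coprime_sym; apply: cop => //; first by case: (sP x xs).
    exact: ltn_trans (lt_l0 _ xs) Bl1.
have si' x : x \in s' -> integer x.2.
  rewrite !inE => /or4P[/eqP ->|/eqP ->|/eqP ->|/sP[]] //; exact: integer1.
have [N Ni HN] := integer_chinese pw' si'.
have ext0 := HN (l0, n0); have ext1 := HN (l1, n1); have ext2 := HN (2%N, 1).
have [t2 t2i /= e2] : exists2 t, integer t & N - 1 = 2 * t.
  by apply: ext2; rewrite !inE eqxx.
have [t0 t0i /= e0] : exists2 t, integer t & N - n0 = l0%:R * t.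
  by apply: ext0; rewrite !inE eqxx ?orbT.
have [t1 t1i /= e1] : exists2 t, integer t & N - n1 = l1%:R * t.
  by apply: ext1; rewrite !inE eqxx ?orbT.
have N_unit : local_unit p N.
  have -> : N = 1 + 2 * t2 by rewrite -e2; ring.
  by apply: local_unit_1D2 => //; apply: local_int.
have [N0 Nl NVl] := N_unit.
pose Q := quadratic_form a b N c.
have qE : conic_value (N / c ^+ 2) = Q / (c ^+ 2) ^+ 2.
  by rewrite /conic_value /Q /quadratic_form; field.
have DE : twist_param (N / c ^+ 2) = - Q / (4 * N * c ^+ 2).
  by rewrite /twist_param qE; field; rewrite ?N0 ?c0 ?four0.
have sqc : square ((c ^+ 2) ^- 2) by exists (c ^- 2); rewrite exprVn.
have Vc0 : (c ^+ 2) ^- 2 != 0 by rewrite invr_eq0 !expf_neq0.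
have Qn : ~ square Q.
  by have := H0 N t0 Ni t0i e0; rewrite mul1r.
have dQn : ~ square (d * Q) := H1 N t1 Ni t1i e1.
have Q0 := nonsquare_neq0 Qn.
exists (N / c ^+ 2); split.
- by rewrite mulf_neq0 ?invr_eq0 ?expf_neq0.
- rewrite qE => sq; apply: Qn; apply: (square_div _ _ sqc) => //.
- rewrite qE mulrA => sq; apply: dQn; exact: (square_div Vc0 sq sqc).
- have l2 : 2 \in local_pred p by exact: rpred_nat.
  have L_unit : local_unit p L%:R.
    have Lodd : odd L.
      rewrite /L big_seq; apply: (big_ind odd) => // [x y|x /sP[xp x2 _]].
        by rewrite oddM => -> ->.
      by case: (even_prime xp) => // x2'; rewrite x2' in x2.
    have -> : L%:R = 1 + 2 * (L./2)%:R :> K.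
      by rewrite -[in LHS](odd_double_half L) Lodd natrD -mul2n natrM.
    by apply: local_unit_1D2 => //; exact: rpred_nat.
  have [Ll0 Ll LV] := L_unit.
  have cE : c = 2 ^+ m.+1 * L%:R by rewrite /c /cn natrM natrX.
  have cl : c \in local_pred p by exact: rpred_nat.
  have dm : 2 ^+ (m.+1).*2 * d \in local_pred p.
    have -> : 2 ^+ (m.+1).*2 * d =
        4 * ((2 ^+ m * a) ^+ 2 - 4 * (2 ^+ m * (2 ^+ m * b))).
      by rewrite doubleS -addnn !exprS exprD; ring.
    apply: rpredM; first exact: rpred_nat.
    apply: rpredB; first exact: rpredX.
    apply: rpredM; first exact: rpred_nat.
    by apply: rpredM => //; exact: rpredX.
  (* the form is N^2 h, and h is congruent to 1 modulo 2 *)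
  pose h := 1 + 2 * (a * c * (c / N) + 2 ^+ m.+1 * 2 ^+ m * d * L%:R ^+ 2 * c ^+ 2 / N ^+ 2).
  have h_unit : local_unit p h.
    apply: local_unit_1D2 => //; apply: rpredD.
      apply: rpredM; last exact: rpredM.
      have -> : a * c = 2 ^+ m * a * (2 * L%:R) by rewrite cE exprS; ring.
      by apply: rpredM => //; apply: rpredM.
    have -> : 2 ^+ m.+1 * 2 ^+ m * d * L%:R ^+ 2 * c ^+ 2 / N ^+ 2 =
       2 ^+ m.+1 * 2 ^+ m * d * c ^+ 2 * (L%:R ^+ 2 * N^-1 ^+ 2).
      by rewrite exprVn; ring.
    apply: rpredM; last by apply: rpredM; apply: rpredX.
    have -> : 2 ^+ m.+1 * 2 ^+ m * d * c ^+ 2 = 2 ^+ (m.+1).*2 * d * (2 ^+ m.+1 * 2 ^+ m * L%:R ^+ 2).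
      by rewrite cE -addnn exprD; ring.
    by apply: rpredM => //; solve_local.
  have QE : Q = N ^+ 2 * h.
    rewrite /Q /quadratic_form /h cE !exprS; field.
    exact: N0.
  exists (2 + (m.+1).*2)%N, (- (L%:R ^+ 2 * N^-1 * h^-1)); split.
  + by apply: leq_trans (leq_addl _ _); rewrite -addnn leq_addr.
  + have N1_unit : local_unit p (- 1).
      by split; rewrite ?invrN1 ?oppr_eq0 ?oner_neq0 // rpredN rpred1.
    rewrite -mulN1r; apply: (local_unitM N1_unit).
    apply: local_unitM; last exact: local_unitV.
    apply: local_unitM; last exact: local_unitV.
    by rewrite expr2; apply: local_unitM.
  + have [h0 _ _] := h_unit; rewrite DE QE cE exprD -addnn exprD.
    by field; rewrite h0 N0 Ll0 four0 oppr_eq0 mulf_neq0 ?expf_neq0.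
- move=> D' /HD[x xs Hx] sq.
  have xs' : x \in s' by rewrite !inE xs !orbT.
  have [t ti e] := HN x xs'.
  have [c' c'i cE] : exists2 c', integer c' & c = x.1%:R * c'.
    exists ((2 ^ m.+1 * \prod_(y <- rem x s) y.1)%N%:R); first exact: integer_nat.
    by rewrite -natrM /c /cn /L (big_rem x) //= mulnCA.
  apply: (Hx c' c'i N t Ni ti e); rewrite -cE -/Q.
  have -> : - (N * Q) * D' = twist_param (N / c ^+ 2) * D' * (2 * N * c) ^+ 2.
    by rewrite DE; field; rewrite ?N0 ?c0 ?four0.
  by apply: squareM => //; exact: square_sqr.
Qed.
End Twist.

(** * Curves with exactly one rational point of order 2 *)

Lemma card2_set (T : Type) (A : set T) (x : T) : (A #= `I_2)%card -> A x ->
  exists y, [/\ A y, y <> x & forall z, A z -> z = x \/ z = y].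
Proof.
move=> /card_set_bijP[f [fA finj fsurj]] Ax.
have fx2 : (f x < 2)%N := fA x Ax.
have [y Ay fy] : (f @` A) (1 - f x)%N by apply: fsurj => /=; lia.
exists y; split=> //.
  by move=> yx; move: fy; rewrite yx; lia.
move=> z Az; have fz2 : (f z < 2)%N := fA z Az.
have [e|e] := eqVneq (f z) (f x); [left|right]; apply: finj; rewrite ?inE //.
by rewrite fy; move: e; case: (f x) fx2 => [|[|]] //; case: (f z) fz2 => [|[|]].
Qed.

Section OneTorsionPoint.
Variables (K : fieldExtType rat) (E : weierstrass K).
Hypothesis E_elliptic : elliptic E.
Hypothesis E_torsion : (two_torsion E #= `I_2)%card.

Let two0 : (2 : K) != 0. Proof. by rewrite natr_number_eq0. Qed.
Let four0 : (4 : K) != 0. Proof. by rewrite natr_number_eq0. Qed.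

Let two_division (x : K) :=
  x ^+ 3 + wb2 E / 4 * x ^+ 2 + wb4 E / 2 * x + wb6 E / 4.

Lemma two_torsion_root x y : two_torsion E (Some (x, y)) ->
  y = - (wa1 E * x + wa3 E) / 2 /\ two_division x = 0.
Proof.
rewrite /two_torsion /point_muln => -[] /=; rewrite eqxx /= => e.
case: eqP => // y0 _.
have yE : y = - (wa1 E * x + wa3 E) / 2.
  apply: (mulfI two0); rewrite [RHS]mulrC divfK //.
  by apply: (eq_sub2 y0); ring.
split=> //; rewrite /two_division /wb2 /wb4 /wb6.
have -> : wa6 E = y ^+ 2 + wa1 E * x * y + wa3 E * y - (x ^+ 3 + wa2 E * x ^+ 2 + wa4 E * x).
  by rewrite e; ring.
by rewrite yE; field; rewrite ?two0 ?four0.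
Qed.

Lemma root_two_torsion x : two_division x = 0 ->
  two_torsion E (Some (x, - (wa1 E * x + wa3 E) / 2)).
Proof.
rewrite /two_division /wb2 /wb4 /wb6 => e; split.
  rewrite /rational_points /=; apply: (eq_sub2 (esym e)).
  by field; rewrite ?two0 ?four0.
rewrite /point_muln /= eqxx.
set s := (X in X == 0); have -> : s = 0 by rewrite /s; field.
by rewrite eqxx.
Qed.

(** The origin is moved to the rational point of order 2. If a^2 - 4 b were a square,
    the quadratic factor would provide further points of order 2. *)
Lemma two_torsion_normal_form : exists a b e : K,
  [/\ b != 0, ~ square (a ^+ 2 - 4 * b) &
    forall D, quadratic_twist D E =
      change_curve 1 (- (D * e)) 0 0 (Weierstrass 0 (a * D) 0 (b * D ^+ 2) 0)].
Proof.
have tN : two_torsion E None by [].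
have [T [Tt Tn]] := card2_set E_torsion tN.
case: T Tt Tn => [[e ye]|//] /two_torsion_root[_ re] _ uniq.
pose a := 3 * e + wb2 E / 4; pose b := 3 * e ^+ 2 + wb2 E / 2 * e + wb4 E / 2.
have b6E : wb6 E = - 4 * (e ^+ 3 + wb2 E / 4 * e ^+ 2 + wb4 E / 2 * e).
  by apply: (eq_sub2 (congr1 ( *%R 4) re)); rewrite /two_division; field; rewrite ?two0 ?four0.
have discE : wdisc E = 16 * b ^+ 2 * (a ^+ 2 - 4 * b).
  have b8E : wb8 E = (wb2 E * wb6 E - wb4 E ^+ 2) / 4.
    by rewrite /wb8 /wb6 /wb4 /wb2; field; rewrite ?two0 ?four0.
  rewrite /wdisc b8E b6E /a /b; move: (wb2 E) (wb4 E) => b2 b4.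
  by field; rewrite ?two0 ?four0.
move: E_elliptic; rewrite /elliptic discE !mulf_eq0 !negb_or.
move=> /andP[/andP[_ /andP[b0 _]] d0].
exists a, b, e; split=> // [[s es]|D]; last first.
  rewrite /quadratic_twist b6E /change_curve /a /b.
  move: (wb2 E) (wb4 E) => b2 b4.
  by congr Weierstrass; field; rewrite ?two0 ?four0 ?oner_neq0.
have root s' : s' ^+ 2 = a ^+ 2 - 4 * b -> two_division (e + (s' - a) / 2) = 0.
  move=> es'; have -> : two_division (e + (s' - a) / 2) =
      (s' - a) / 2 * (s' ^+ 2 - (a ^+ 2 - 4 * b)) / 4.
    rewrite /two_division b6E /a /b; move: (wb2 E) (wb4 E) => b2 b4.
    by field; rewrite ?two0 ?four0.
  by rewrite es' subrr mulr0 mul0r.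
have fixed s' : s' ^+ 2 = a ^+ 2 - 4 * b -> s' = a.
  move=> es'; case: (uniq _ (root_two_torsion (root s' es'))) => // -[ex _].
  have e0 : (s' - a) / 2 = 0 by apply: (addrI e); rewrite ex addr0.
  by move/eqP: e0; rewrite mulf_eq0 invr_eq0 (negPf two0) orbF subr_eq0 => /eqP.
have := esym es; rewrite (fixed s (esym es)) => ea.
have /eqP : 4 * b = 0 by apply: (eq_sub2 ea); ring.
by rewrite mulf_eq0 (negPf four0) (negPf b0).
Qed.
End OneTorsionPoint.

Lemma square_class_reps (k : fieldType) (s : seq (set k)) :
  exists Ds : seq k, (forall D, D \in Ds -> D != 0) /\
    forall D, D != 0 -> square_class D \in s -> exists2 D', D' \in Ds & square_class D = square_class D'.
Proof.
elim: s => [|C s [Ds [Ds0 IH]]]; first by exists [::].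
have [[D0 D0nz eD0]|none] := pselect (exists2 D, D != 0 & C = square_class D).
  exists (D0 :: Ds); split=> [D|D Dnz].
    by rewrite inE => /orP[/eqP ->|/Ds0].
  rewrite inE => /orP[/eqP e|/(IH _ Dnz)[D' D's e]].
    by exists D0; rewrite ?mem_head // e.
  by exists D' => //; rewrite inE D's orbT.
exists Ds; split=> // D Dnz; rewrite inE => /orP[/eqP e|/(IH _ Dnz)//].
by case: none; exists D.
Qed.

Theorem theorem1p3 (K : fieldExtType rat) (E : weierstrass K)
    (hE : elliptic E) (hE2 : (two_torsion E #= `I_2)%card) :
  infinite_set [set square_class D | D in
    [set D : K | D != 0 /\
      exists P : curve_point K, nontrivial_point (quadratic_twist D E) P]].
Proof.
have [a [b [e [b0 nd twistE]]]] := two_torsion_normal_form hE hE2.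
move=> /finite_seqP[s es].
have [Ds [Ds0 HD]] := square_class_reps s.
have [p p2] := exists_prime_over K (isT : prime 2).
have [na na_gt0 nai] := integer_denom a; have [nb nb_gt0 nbi] := integer_denom b.
have two_power x n : (0 < n)%N -> integer (x * n%:R) ->
    2 ^+ logn 2 n * x \in local_pred p.
  move=> n_gt0 xi; have := pfactor_coprime (isT : prime 2) n_gt0 => -[n' co nE].
  apply: (local_denom (n := n')); last exact: (prime_coprime_nat p2).
  by rewrite mulrC mulrA mulrC -natrX -natrM -nE.
(* 2^m clears the denominators of a and b at p *)
pose m := maxn (logn 2 na) (logn 2 nb).
have weaken x i : (i <= m)%N -> 2 ^+ i * x \in local_pred p -> 2 ^+ m * x \in local_pred p.
  move=> im xl; rewrite -(subnK im) exprD -mulrA.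
  by apply: rpredM => //; apply: rpredX; exact: rpred_nat.
have ma : 2 ^+ m * a \in local_pred p.
  by apply: weaken (two_power a na na_gt0 nai); rewrite leq_maxl.
have mb : 2 ^+ m * b \in local_pred p.
  by apply: weaken (two_power b nb nb_gt0 nbi); rewrite leq_maxr.
have [t [t0 q dq [ex [v [mex vu D2]]] nD]] := exists_twist_param b0 nd p2 ma mb Ds0.
have D0 := twist_param_neq0 t0 q.
have : [set` s] (square_class (twist_param a b t)).
  rewrite -es; exists (twist_param a b t) => //; split=> //.
  eexists; rewrite twistE.
  exact: (twist_nontrivial_point b0 nd t0 q dq _ p2 ma mb mex vu D2).
move=> /= /(HD _ D0)[D' D's e3]; apply: (nD D' D's).
have : square_class D' (twist_param a b t).
  by rewrite -e3; exists 1; rewrite ?expr1n ?mulr1 ?oner_neq0 //=; exact: oner_neq0.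
move=> [c _ <-]; exists (D' * c); ring.
Qed.
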